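(* Let $k$ be a commutative ring with unit and let $H$ be a weak Hopf algebra over $k$ with bijective antipode $S$. Let $R=\mathrm{Im}(\Pi^L)$ and view $H$ also as an $R$-bialgebroid with source map $s_H(r)=r$, target map $t_H(r)=S^{-1}(r)$ $(r\in R)$, comultiplication $h\mapsto h_{(1)}\otimes_R h_{(2)}$ and counit $\Pi^L:H\to R$. Then there is an isomorphism of categories $$\mathcal{WDK}(H)\;\cong\;\mathcal{DK}_R(H)$$ between the category $\mathcal{WDK}(H)$ of left-left weak Doi-Koppinen data over $H$ and the category $\mathcal{DK}_R(H)$ of left-left Doi-Koppinen data over the algebra $R$ with $R$-bialgebroid $H$. Furthermore, for every weak Doi-Koppinen datum over $H$, the category of weak Doi-Koppinen modules associated to it is isomorphic to the category of Doi-Koppinen modules over $R$ associated to the Doi-Koppinen datum over $R$ that corresponds to it under this isomorphism.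
   Context: Conventions. All algebras are unital $k$-algebras, coalgebras are counital $k$-coalgebras, $\otimes=\otimes_k$, modules are unital. Sweedler notation: $\Delta(c)=c_{(1)}\otimes c_{(2)}$ for coproducts, ${}^M\rho(m)=m_{<-1>}\otimes m_{<0>}$ for left coactions (summation understood; iterated coactions are written $m_{<-2>}\otimes m_{<-1>}\otimes m_{<0>}$). $\bar R=R^{op}$, $R^e=R\otimes\bar R$. Weak Hopf algebras. A weak bialgebra is a $k$-algebra and $k$-coalgebra $H$ with multiplicative (not necessarily unital) coproduct $\Delta$ such that $\epsilon(xyz)=\epsilon(xy_{(1)})\epsilon(y_{(2)}z)=\epsilon(xy_{(2)})\epsilon(y_{(1)}z)$ for all $x,y,z\in H$ and $(\Delta\otimes H)\Delta(1)=(\Delta(1)\otimes 1)(1\otimes\Delta(1))=(1\otimes\Delta(1))(\Delta(1)\otimes 1)$. A weak Hopf algebra is a weak bialgebra with an antipode, i.e. a linear map $S:H\to H$ with $h_{(1)}S(h_{(2)})=\epsilon(1_{(1)}h)1_{(2)}$, $S(h_{(1)})h_{(2)}=1_{(1)}\epsilon(h1_{(2)})$, $S(h_{(1)})h_{(2)}S(h_{(3)})=S(h)$ for all $h\in H$. Here $\Delta(1)=1_{(1)}\otimes 1_{(2)}$. Put $\Pi^L(g)=\epsilon(1_{(1)}g)1_{(2)}$; $R=\mathrm{Im}(\Pi^L)$ is a subalgebra of $H$. It is known that the stated data make $H$ an $R$-bialgebroid. Weak Doi-Koppinen data. A left weak $H$-comodule algebra is an algebra $A$ that is a left $H$-comodule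 via ${}^A\rho:A\to H\otimes A$ with ${}^A\rho(a){}^A\rho(b)={}^A\rho(ab)$ for all $a,b\in A$ and $(H\otimes{}^A\rho)({}^A\rho(1))=1_{(1)}\otimes 1_{<-1>}1_{(2)}\otimes 1_{<0>}$. Morphisms: $H$-colinear algebra maps. A left weak $H$-module coalgebra is a coalgebra $C$ that is a left $H$-module with $\Delta_C(h\cdot c)=h_{(1)}\cdot c_{(1)}\otimes h_{(2)}\cdot c_{(2)}$ and $\epsilon_C(hg\cdot c)=\epsilon_H(hg_{(2)})\epsilon_C(g_{(1)}\cdot c)$ for all $c\in C$, $h,g\in H$. Morphisms: $H$-linear coalgebra maps. A left-left weak Doi-Koppinen datum is a triple $(H,A,C)$ with $A$ a left weak $H$-comodule algebra and $C$ a left weak $H$-module coalgebra; morphisms (with $H$ fixed) are pairs consisting of a morphism of left weak $H$-comodule algebras and a morphism of left weak $H$-module coalgebras. A weak Doi-Koppinen module for $(H,A,C)$ is a left $A$-module $M$ that is a left $C$-comodule via ${}^M\rho:M\to C\otimes M$ with ${}^M\rho(a\cdot m)=a_{<-1>}\cdot m_{<-1>}\otimes a_{<0>}\cdot m_{<0>}$; morphisms are $A$-linear $C$-colinear maps. Corings. An $R$-coring is a coalgebra in the monoidal category of $R$-bimodules $({}_R\mathcal M_R,\otimes_R,R)$. A left comodule of an $R$-coring $\mathcal C$ is a left $R$-module $M$ with a left $R$-linear map ${}^M\rho:M\to\mathcal C\otimes_R M$ that is coassociative and counital; morphisms are left $R$-linear maps commuting with coactions. Bialgebroids. An $R$-ring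 is a pair $(U,i)$ with $U$ an algebra and $i:R\to U$ an algebra map. An $R^e$-ring is given by $(H,s_H,t_H)$ with $s_H:R\to H$, $t_H:\bar R\to H$ algebra maps with commuting images; $H$ is an $R$-bimodule by $r\cdot h\cdot r'=s_H(r)t_H(r')h$. For an $R$-ring $(A,s_A)$, viewed as an $R$-bimodule via $s_A$, $$H\times_R A=\Big\{\sum_i h^i\otimes_R a^i\in H\otimes_R A\;\Big|\;\sum_i h^it_H(r)\otimes_R a^i=\sum_i h^i\otimes_R a^is_A(r)\ \ \forall r\in R\Big\},$$ an algebra with componentwise product and unit $1_H\otimes_R 1_A$; $H\times_RH$ is the case $(A,s_A)=(H,s_H)$. An $R$-bialgebroid is an $R^e$-ring $(H,s_H,t_H)$ with an $R$-coring structure $(H,\Delta,\epsilon)$ such that $\mathrm{Im}\,\Delta\subseteq H\times_RH$, $\Delta:H\to H\times_RH$ is an algebra map, $\epsilon(1_H)=1_R$, and $\epsilon(gh)=\epsilon(gs_H(\epsilon(h)))=\epsilon(gt_H(\epsilon(h)))$ for all $g,h\in H$. Doi-Koppinen data over $R$. A left comodule algebra over an $R$-bialgebroid $H$ is a triple $(A,s_A,{}^A\rho)$ such that $(A,s_A)$ is an $R$-ring, $(A,{}^A\rho)$ is a left comodule of the $R$-coring $H$ (with $A$ a left $R$-module via $s_A$), $\mathrm{Im}({}^A\rho)\subseteq H\times_RA$ and ${}^A\rho:A\to H\times_RA$ is an algebra map. Morphisms: left $H$-colinear maps that are morphisms of $R$-rings. A left module coalgebra over $H$ is a coalgebra in the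 monoidal category $({}_H\mathcal M,\otimes_R,R)$ (with $h\cdot(m\otimes_Rn)=h_{(1)}\cdot m\otimes_Rh_{(2)}\cdot n$ and $h\triangleright a=\epsilon(hs_H(a))$ on $R$); equivalently a left $H$-module $C$ with an $R$-coring structure, where $r\cdot c\cdot r'=s_H(r)t_H(r')\cdot c$, such that $\Delta_C(h\cdot c)=h_{(1)}\cdot c_{(1)}\otimes_Rh_{(2)}\cdot c_{(2)}$ and $\epsilon_C(h\cdot c)=\epsilon_H(hs_H(\epsilon_C(c)))$. Morphisms: $H$-linear maps of $R$-corings. A left-left Doi-Koppinen datum over $R$ is a triple $(H,A,C)_R$ with $H$ an $R$-bialgebroid, $A$ a left $H$-comodule algebra and $C$ a left $H$-module coalgebra; morphisms (with $H$ fixed) are pairs consisting of a morphism of left $H$-comodule algebras and a morphism of left $H$-module coalgebras. A Doi-Koppinen module over $R$ for $(H,A,C)_R$ is a left $A$-module $M$ (hence a left $R$-module via $s_A$) that is a left comodule of the $R$-coring $C$ via ${}^M\rho$ with ${}^M\rho(a\cdot m)=a_{<-1>}\cdot m_{<-1>}\otimes_Ra_{<0>}\cdot m_{<0>}$; morphisms are $A$-linear $C$-colinear maps. *)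

(* Defs.v *)
From HB Require Import structures.
From mathcomp Require Import all_boot all_order all_algebra.
From mathcomp Require Import boolp.

Set Implicit Arguments.
Unset Strict Implicit.
Unset Printing Implicit Defensive.

Import GRing.Theory.
Local Open Scope ring_scope.

(* Unital associative algebras over k.  [algType] is not used because it
   excludes the zero algebra. *)
HB.mixin Record isKAlgebra (k : comPzRingType) A of GRing.Lmodule k A := {
  kone : A;
  kmul : A -> A -> A;
  kmulA : associative kmul;
  kmul1r : left_id kone kmul;
  kmulr1 : right_id kone kmul;
  kmul_linl : forall y, linear (kmul^~ y);
  kmul_linr : forall x, linear (kmul x)
}.

#[short(type="kalgType")]
HB.structure Definition KAlgebra (k : comPzRingType) :=
  {A of isKAlgebra k A & GRing.Lmodule k A}.

Notation "x ∙ y" := (kmul x y) (at level 40, left associativity) : ring_scope.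
Notation "𝟙" := kone : ring_scope.

Section Regular.
Variable k : comPzRingType.

Lemma regular_linl (y : k^o) : linear (fun x : k^o => x * y : k^o).
Proof. by move=> c u v; rewrite mulrDl -mulrA. Qed.

Lemma regular_linr (x : k^o) : linear (fun y : k^o => x * y : k^o).
Proof. by move=> c u v; rewrite mulrDr; congr (_ + _); apply: mulrCA. Qed.

HB.instance Definition _ := isKAlgebra.Build k k^o
  (@mulrA k) (@mul1r k) (@mulr1 k) regular_linl regular_linr.

End Regular.

(* Balanced tensor products.  For abelian groups M, N and a family I acting on
   M from the right and on N from the left, [tens ra la] is the quotient of
   the formal finite sums of pairs (m, n) by the relations of biadditivity and
   (m . i, n) ~ (m, i . n).  It is the tensor product over k (I = k, scalar
   multiplications) or over a ring R (I = R).  Formal differences are not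
   needed since (- m, n) is an opposite of (m, n). *)
Section Tensor.
Variables (I : Type) (M N : zmodType) (ra : M -> I -> M) (la : I -> N -> N).

Inductive teq : seq (M * N) -> seq (M * N) -> Prop :=
| teq_refl s : teq s s
| teq_sym s t : teq s t -> teq t s
| teq_trans s t u : teq s t -> teq t u -> teq s u
| teq_cat s s' t t' : teq s s' -> teq t t' -> teq (s ++ t) (s' ++ t')
| teq_comm s t : teq (s ++ t) (t ++ s)
| teq_addl m m' n : teq [:: (m + m', n)] [:: (m, n); (m', n)]
| teq_addr m n n' : teq [:: (m, n + n')] [:: (m, n); (m, n')]
| teq_0l n : teq [:: (0, n)] [::]
| teq_bal m i n : teq [:: (ra m i, n)] [:: (m, la i n)].

Definition teqb : rel (seq (M * N)) := fun s t => `[< teq s t >].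

Lemma teqb_refl : reflexive teqb.
Proof. by move=> s; apply/asboolP; apply: teq_refl. Qed.

Lemma teqb_sym : symmetric teqb.
Proof. by move=> s t; apply/asboolP/asboolP; apply: teq_sym. Qed.

Lemma teqb_trans : transitive teqb.
Proof.
move=> s t u /asboolP ts /asboolP su; apply/asboolP; exact: teq_trans su.
Qed.

Canonical teqb_equiv := EquivRel teqb teqb_refl teqb_sym teqb_trans.

Definition tens := {eq_quot teqb}%qT.

HB.instance Definition _ : EqQuotient _ teqb tens := EqQuotient.on tens.
HB.instance Definition _ := Choice.on tens.

Definition tpi (s : seq (M * N)) : tens := (\pi_tens s)%qT.

Lemma tpiP s t : tpi s = tpi t <-> teq s t.
Proof.
split; first by move/eqP; rewrite /tpi eqquotE => /asboolP.
by move=> st; apply/eqP; rewrite /tpi eqquotE; apply/asboolP.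
Qed.

Lemma trepr s : teq (repr (tpi s)) s.
Proof. by apply/tpiP; rewrite /tpi reprK. Qed.

Lemma tpiK t : tpi (repr t) = t.
Proof. exact: (@reprK _ tens). Qed.

Definition tpure (m : M) (n : N) : tens := tpi [:: (m, n)].

Definition tens_zero : tens := tpi [::].
Definition tens_add (t u : tens) : tens := tpi (repr t ++ repr u).
Definition tens_opp (t : tens) : tens :=
  tpi [seq (- p.1, p.2) | p <- repr t].

Lemma tens_addE s t : tens_add (tpi s) (tpi t) = tpi (s ++ t).
Proof. by apply/tpiP; apply: teq_cat; apply: trepr. Qed.

Lemma teq_Nl s : teq ([seq (- p.1, p.2) | p <- s] ++ s) [::].
Proof.
elim: s => [|[m n] s IH] /=; first exact: teq_refl.
set t := [seq _ | p <- s] in IH *.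
apply: (teq_trans (t := [:: (- m, n); (m, n)] ++ (t ++ s))); last first.
  rewrite -[X in teq _ X]cat0s; apply: teq_cat IH.
  apply: teq_trans (teq_sym (teq_addl _ _ _)) _.
  by rewrite addNr; apply: teq_0l.
apply: (@teq_cat [:: _] [:: _]); first exact: teq_refl.
change (teq (t ++ ([:: (m, n)] ++ s)) ([:: (m, n)] ++ (t ++ s))); rewrite !catA.
by apply: teq_cat; [apply: teq_comm | apply: teq_refl].
Qed.

Lemma tens_addA : associative tens_add.
Proof.
move=> x y z; rewrite -[x]tpiK -[y]tpiK -[z]tpiK.
by rewrite !tens_addE catA.
Qed.

Lemma tens_addC : commutative tens_add.
Proof. by move=> x y; apply/tpiP; apply: teq_comm. Qed.

Lemma tens_add0 : left_id tens_zero tens_add.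
Proof. by move=> x; rewrite -[x]tpiK tens_addE. Qed.

Lemma tens_addN : left_inverse tens_zero tens_opp tens_add.
Proof.
move=> x; rewrite /tens_opp -[in X in tens_add _ X](tpiK x) tens_addE.
by apply/tpiP; apply: teq_Nl.
Qed.

HB.instance Definition _ :=
  GRing.isZmodule.Build tens tens_addA tens_addC tens_add0 tens_addN.

Lemma tpi_cat s t : tpi (s ++ t) = tpi s + tpi t.
Proof. by rewrite -tens_addE. Qed.

Lemma tpureDl m m' n : tpure (m + m') n = tpure m n + tpure m' n.
Proof. by rewrite -tpi_cat; apply/tpiP; apply: teq_addl. Qed.

Lemma tpureDr m n n' : tpure m (n + n') = tpure m n + tpure m n'.
Proof. by rewrite -tpi_cat; apply/tpiP; apply: teq_addr. Qed.

Lemma tpure_bal m i n : tpure (ra m i) n = tpure m (la i n).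
Proof. by apply/tpiP; apply: teq_bal. Qed.

Lemma tpi_sum s : tpi s = \sum_(p <- s) tpure p.1 p.2.
Proof.
elim: s => [|[m n] s IH]; first by rewrite big_nil.
by rewrite big_cons -IH -cat1s tpi_cat.
Qed.

Lemma tens_ind (Q : tens -> Prop) :
  Q 0 -> (forall m n, Q (tpure m n)) -> (forall t u, Q t -> Q u -> Q (t + u)) ->
  forall t, Q t.
Proof.
move=> Q0 Q1 QD t; rewrite -[t]tpiK tpi_sum.
by elim: (repr t) => [|p s IH]; rewrite ?big_nil ?big_cons //; apply: QD.
Qed.

Definition balanced (P : zmodType) (f : M -> N -> P) : Prop :=
  [/\ forall n, {morph f^~ n : m m' / m + m'},
      forall m, {morph f m : n n' / n + n'}
    & forall m i n, f (ra m i) n = f m (la i n)].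

(* The map M (x) N -> P induced by f : M -> N -> P.  It is defined for every f
   by summing over a chosen representative; when f is balanced it is the
   homomorphism of the universal property ([tlift_pure], [tliftD],
   [tlift_uniq]) and does not depend on that choice.  Nested occurrences over
   a noncommutative ring, such as h_1 . c_1 (x) h_2 . c_2, are double sums over
   fixed representatives; they are independent of the choice because the outer
   element lies in a Takeuchi product. *)
Definition tlift (P : zmodType) (f : M -> N -> P) (t : tens) : P :=
  \sum_(p <- repr t) f p.1 p.2.

Section Lift.
Variables (P : zmodType) (f : M -> N -> P) (fB : balanced f).

Lemma balanced0l n : f 0 n = 0.
Proof.
case: fB => fl _ _; have := fl n 0 0; rewrite addr0 /= => /eqP.
by rewrite -subr_eq subrr => /eqP.
Qed.

Lemma teq_sum s t : teq s t ->
  \sum_(p <- s) f p.1 p.2 = \sum_(p <- t) f p.1 p.2.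
Proof.
case: (fB) => fl fr fb.
elim=> {s t} [//|//|s t u _ -> _ -> //|s s' t t' _ e _ e'|s t|||n|m i n].
- by rewrite !big_cat /= e e'.
- by rewrite !big_cat /= addrC.
- by move=> m m' n; rewrite !big_cons !big_nil !addr0 /= fl.
- by move=> m m' n; rewrite !big_cons !big_nil !addr0 /= fr.
- by rewrite big_cons !big_nil addr0 balanced0l.
- by rewrite !big_cons !big_nil !addr0 /= fb.
Qed.

Lemma tlift_pi s : tlift f (tpi s) = \sum_(p <- s) f p.1 p.2.
Proof. by apply: teq_sum; apply: trepr. Qed.

Lemma tlift_pure m n : tlift f (tpure m n) = f m n.
Proof. by rewrite tlift_pi big_cons big_nil addr0. Qed.

Lemma tliftD : {morph tlift f : t u / t + u}.
Proof.
move=> t u; rewrite -[t]tpiK -[u]tpiK -tpi_cat !tlift_pi.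
by rewrite big_cat.
Qed.

Lemma tlift0 : tlift f 0 = 0.
Proof. by rewrite [0]/(tpi [::]) tlift_pi big_nil. Qed.

Lemma tlift_uniq (g : tens -> P) : {morph g : t u / t + u} ->
  (forall m n, g (tpure m n) = f m n) -> g =1 tlift f.
Proof.
move=> gD g1; elim/tens_ind => [|m n|t u e e'].
- by rewrite tlift0; apply: (addIr (g 0)); rewrite -gD !add0r.
- by rewrite g1 tlift_pure.
- by rewrite gD tliftD e e'.
Qed.

End Lift.

Lemma tlift_id t : tlift tpure t = t.
Proof. by rewrite /tlift -tpi_sum tpiK. Qed.

Lemma tpure_balanced : balanced tpure.
Proof.
split=> [n m m'|m n n'|m i n].
- exact: tpureDl. - exact: tpureDr. - exact: tpure_bal.
Qed.

Lemma eq_tlift (P : zmodType) (f g : M -> N -> P) t :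
  (forall m n, f m n = g m n) -> tlift f t = tlift g t.
Proof. by move=> e; apply: eq_bigr. Qed.

Lemma raddf_tlift (P Q : zmodType) (g : P -> Q) (f : M -> N -> P) t :
  {morph g : x y / x + y} -> g (tlift f t) = tlift (fun m n => g (f m n)) t.
Proof.
move=> gD; apply: (big_morph g gD).
by apply: (addIr (g 0)); rewrite -gD !add0r.
Qed.

Lemma tlift_add (P : zmodType) (f g : M -> N -> P) t :
  tlift (fun m n => f m n + g m n) t = tlift f t + tlift g t.
Proof. exact: big_split. Qed.

End Tensor.

Arguments tpure {I M N ra la} m n : simpl never.

Notation "m ⊗ n" := (tpure m n) (at level 40, left associativity) : ring_scope.
(* Sweedler-type notation: \sw_(a, b <- t) E is the value at t of the map
   induced by (a, b) |-> E. *)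
Notation "\sw_ ( a , b <- t ) E" := (tlift (fun a b => E) t)
  (at level 41, E at level 41, a name, b name,
   format "\sw_ ( a ,  b  <-  t )  E") : ring_scope.

Lemma tlift_exchange I (M N : zmodType) ra la I' (M' N' : zmodType) ra' la'
    (P : zmodType)
    (F : M -> N -> M' -> N' -> P)
    (t : @tens I M N ra la) (u : @tens I' M' N' ra' la') :
  \sw_(a, b <- t) \sw_(c, d <- u) F a b c d
  = \sw_(c, d <- u) \sw_(a, b <- t) F a b c d.
Proof. exact: exchange_big. Qed.

Lemma tlift_tlift I (M N : zmodType) ra la I' (M' N' : zmodType) ra' la'
    (P : zmodType)
    (F : M' -> N' -> P) (f : M -> N -> M') (g : M -> N -> N')
    (t : @tens I M N ra la) :
  balanced ra' la' F ->
  tlift F (\sw_(a, b <- t) (f a b ⊗ g a b : @tens I' M' N' ra' la'))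
  = \sw_(a, b <- t) F (f a b) (g a b).
Proof.
move=> FB; rewrite (raddf_tlift _ _ (tliftD FB)).
by apply: eq_tlift => a b; rewrite tlift_pure.
Qed.

Section Algebras.
Variable k : comPzRingType.

Definition is_algmorph (A B : kalgType k) (f : A -> B) : Prop :=
  [/\ linear f, f 𝟙 = 𝟙 & forall x y, f (x ∙ y) = f x ∙ f y].

Definition is_module (A : kalgType k) (M : lmodType k) (act : A -> M -> M) :
    Prop :=
  [/\ forall a, linear (act a),
      forall m, linear (act^~ m),
      forall m, act 𝟙 m = m
    & forall a b m, act (a ∙ b) m = act a (act b m)].

Record is_bimodule (R : kalgType k) (M : lmodType k)
    (la : R -> M -> M) (ra : M -> R -> M) : Prop := IsBimodule {
  bimod_left : is_module la;
  bimod_linl : forall r, linear (ra^~ r);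
  bimod_linr : forall m, linear (ra m);
  bimod_ra1 : forall m, ra m 𝟙 = m;
  bimod_raM : forall m r s, ra m (r ∙ s) = ra (ra m r) s;
  bimod_comm : forall r m s, la r (ra m s) = ra (la r m) s
}.

(* Restriction of an action of A along a map f : R -> A, as a left action and
   as a right action (the latter when f is anti-multiplicative). *)
Definition lres (R A M : Type) (f : R -> A) (act : A -> M -> M) :=
  fun (r : R) (m : M) => act (f r) m.
Definition rres (R A M : Type) (f : R -> A) (act : A -> M -> M) :=
  fun (m : M) (r : R) => act (f r) m.

(* The k-bimodule structure of a k-module. *)
Definition klact (M : lmodType k) (c : k^o) (m : M) : M := (c : k) *: m.
Definition kract (M : lmodType k) (m : M) (c : k^o) : M := (c : k) *: m.

Definition tensk (M N : lmodType k) := tens (@kract M) (@klact N).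

End Algebras.

Arguments klact {k M} c m.
Arguments kract {k M} m c.

Definition tmap I (M N : zmodType) ra la I' (M' N' : zmodType) ra' la'
    (f : M -> M') (g : N -> N')
    (t : @tens I M N ra la) : @tens I' M' N' ra' la' :=
  \sw_(m, n <- t) (f m ⊗ g n).

Arguments tmap {I M N ra la I' M' N' ra' la'} f g t.

(* Componentwise product.  Over a noncommutative ring it is independent of the
   representatives as soon as t lies in the Takeuchi product. *)
Definition tmul I (M N : zmodType) ra la (mulM : M -> M -> M) (mulN : N -> N -> N)
    (t u : @tens I M N ra la) : @tens I M N ra la :=
  \sw_(a, b <- t) \sw_(c, d <- u) (mulM a c ⊗ mulN b d).

(* Left action on M (x) N induced by a left action on M. *)
Definition tlact I (M N : zmodType) ra la J (act : J -> M -> M) (j : J)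
    (t : @tens I M N ra la) : tens ra la :=
  tmap (act j) id t.

(* C (x)_R (D (x)_R N), where C and D carry the same bimodule structure; all
   triple tensor products are associated to the right. *)
Definition tens3 R (C N : zmodType) (la : R -> C -> C) (ra : C -> R -> C)
    (laN : R -> N -> N) :=
  tens ra (@tlact R C N ra laN R la).

Section Corings.
Variables (k : comPzRingType) (R : kalgType k) (C : lmodType k).
Variables (la : R -> C -> C) (ra : C -> R -> C).
Variables (delta : C -> tens ra la) (eps : C -> R).

Record is_coring : Prop := IsCoring {
  coring_bimod : is_bimodule la ra;
  coring_deltaD : {morph delta : x y / x + y};
  coring_deltal : forall r c, delta (la r c) = tmap (la r) id (delta c);
  coring_deltar : forall r c, delta (ra c r) = tmap id (ra^~ r) (delta c);
  coring_epsD : {morph eps : x y / x + y};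
  coring_epsl : forall r c, eps (la r c) = r ∙ eps c;
  coring_epsr : forall r c, eps (ra c r) = eps c ∙ r;
  coring_coassoc : forall c,
    \sw_(a, b <- delta c) \sw_(a1, a2 <- delta a) (a1 ⊗ (a2 ⊗ b))
    = \sw_(a, b <- delta c) (a ⊗ delta b) :> tens3 la ra la;
  coring_counitl : forall c, \sw_(a, b <- delta c) la (eps a) b = c;
  coring_counitr : forall c, \sw_(a, b <- delta c) ra a (eps b) = c
}.

Record is_comodule (M : lmodType k) (laM : R -> M -> M)
    (rho : M -> tens ra laM) : Prop := IsComodule {
  comod_module : is_module laM;
  comod_rhoD : {morph rho : x y / x + y};
  comod_rhol : forall r m, rho (laM r m) = tmap (la r) id (rho m);
  comod_coassoc : forall m,
    \sw_(c, x <- rho m) \sw_(c1, c2 <- delta c) (c1 ⊗ (c2 ⊗ x))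
    = \sw_(c, x <- rho m) (c ⊗ rho x) :> tens3 la ra laM;
  comod_counit : forall m, \sw_(c, x <- rho m) laM (eps c) x = m
}.

End Corings.

(* A k-coalgebra is a coring over k on a symmetric k-bimodule. *)
Definition is_coalgebra (k : comPzRingType) (C : lmodType k) (delta : C -> tensk C C)
    (eps : C -> k^o) : Prop := is_coring delta eps.

Section WeakHopf.
Variable k : comPzRingType.

Section Laws.
Variables (H : kalgType k) (delta : H -> tensk H H) (eps : H -> k^o).

Definition PiL (g : H) : H := \sw_(e, f <- delta 𝟙) (eps (e ∙ g) : k) *: f.

Record is_weak_bialgebra : Prop := IsWeakBialgebra {
  wb_coalg : is_coalgebra delta eps;
  wb_deltaM : forall x y, delta (x ∙ y) = tmul kmul kmul (delta x) (delta y);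
  wb_epsM1 : forall x y z,
    eps (x ∙ y ∙ z) = \sw_(y1, y2 <- delta y) (eps (x ∙ y1) * eps (y2 ∙ z));
  wb_epsM2 : forall x y z,
    eps (x ∙ y ∙ z) = \sw_(y1, y2 <- delta y) (eps (x ∙ y2) * eps (y1 ∙ z));
  wb_delta1l :
    \sw_(e, f <- delta 𝟙) \sw_(e1, e2 <- delta e) (e1 ⊗ (e2 ⊗ f))
    = tmul kmul (tmul kmul kmul)
        (\sw_(e, f <- delta 𝟙) (e ⊗ (f ⊗ 𝟙))) (𝟙 ⊗ delta 𝟙)
    :> tens3 klact kract klact;
  wb_delta1r :
    \sw_(e, f <- delta 𝟙) \sw_(e1, e2 <- delta e) (e1 ⊗ (e2 ⊗ f))
    = tmul kmul (tmul kmul kmul)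
        (𝟙 ⊗ delta 𝟙) (\sw_(e, f <- delta 𝟙) (e ⊗ (f ⊗ 𝟙)))
    :> tens3 klact kract klact
}.

Record is_antipode (S : H -> H) : Prop := IsAntipode {
  antipode_linear : linear S;
  antipode_left : forall h,
    \sw_(h1, h2 <- delta h) (h1 ∙ S h2)
    = \sw_(e, f <- delta 𝟙) ((eps (e ∙ h) : k) *: f);
  antipode_right : forall h,
    \sw_(h1, h2 <- delta h) (S h1 ∙ h2)
    = \sw_(e, f <- delta 𝟙) ((eps (h ∙ f) : k) *: e);
  antipode_mid : forall h,
    \sw_(h1, h23 <- delta h) (S h1 ∙ \sw_(h2, h3 <- delta h23) (h2 ∙ S h3))
    = S h
}.

End Laws.

Record weakHopf := WeakHopf {
  wh_alg :> kalgType k;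
  wh_delta : wh_alg -> tensk wh_alg wh_alg;
  wh_eps : wh_alg -> k^o;
  antipode : wh_alg -> wh_alg;
  wh_bialg : is_weak_bialgebra wh_delta wh_eps;
  wh_antipode : is_antipode wh_delta wh_eps antipode
}.

End WeakHopf.
Section LinearFacts.
Variable k : comPzRingType.

Lemma linD (U V : lmodType k) (f : U -> V) : linear f -> {morph f : x y / x + y}.
Proof. by move=> fl x y; have := fl 1 x y; rewrite !scale1r. Qed.

Lemma lin0 (U V : lmodType k) (f : U -> V) : linear f -> f 0 = 0.
Proof.
by move=> /linD fD; apply: (addIr (f 0)); rewrite -fD !add0r.
Qed.

Lemma linZ (U V : lmodType k) (f : U -> V) : linear f ->
  forall (c : k) x, f (c *: x) = c *: f x.
Proof.
by move=> fl c x; have := fl c x 0; rewrite (lin0 fl) !addr0.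
Qed.

Lemma linP (U V : lmodType k) (f : U -> V) :
  {morph f : x y / x + y} -> (forall (c : k) x, f (c *: x) = c *: f x) ->
  linear f.
Proof. by move=> fD fZ c x y; rewrite fD fZ. Qed.

Variable A : kalgType k.
Implicit Types x y z : A.

Lemma kmulDl x y z : (x + y) ∙ z = x ∙ z + y ∙ z.
Proof. exact: (linD (kmul_linl z)). Qed.

Lemma kmulDr x y z : x ∙ (y + z) = x ∙ y + x ∙ z.
Proof. exact: (linD (kmul_linr x)). Qed.

Lemma kmulZl (c : k) x y : (c *: x) ∙ y = c *: (x ∙ y).
Proof. exact: (linZ (kmul_linl y)). Qed.

Lemma kmulZr (c : k) x y : x ∙ (c *: y) = c *: (x ∙ y).
Proof. exact: (linZ (kmul_linr x)). Qed.

Lemma tpureZ (M N : lmodType k) (c : k) (m : M) (n : N) :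
  m ⊗ (c *: n) = (c *: m) ⊗ n :> tensk M N.
Proof. by rewrite -(tpure_bal (@kract k M) (@klact k N)). Qed.

End LinearFacts.

Section WeakBialgebra.
Variables (k : comPzRingType) (H : kalgType k).
Variables (delta : H -> tensk H H) (eps : H -> k^o).
Hypothesis wb : is_weak_bialgebra delta eps.

Let co : is_coring delta eps := wb_coalg wb.

Lemma wb_epsD x y : eps (x + y) = eps x + eps y.
Proof. exact: (coring_epsD co). Qed.

Lemma wb_epsZ (c : k) x : eps (c *: x) = c * eps x.
Proof. exact: (coring_epsl co c). Qed.

Ltac nrm := rewrite /klact /kract ?(kmulDl, kmulDr, kmulZl, kmulZr, wb_epsD,
  wb_epsZ, tpureDl, tpureDr, tpureZ, scalerDl, scalerDr, scalerA, mulrDl,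
  mulrDr, mulrA).

Ltac bal := split; intros ? ? ?; cbv beta; nrm;
  try done; try (by rewrite mulrC).

(* Trilinearity over k. *)
Definition trilin (P : zmodType) (G : H -> H -> H -> P) : Prop :=
  [/\ forall b c, {morph (fun a => G a b c) : x y / x + y},
      forall a c, {morph (fun b => G a b c) : x y / x + y},
      forall a b, {morph (fun c => G a b c) : x y / x + y},
      forall (c : k) x y z, G (c *: x) y z = G x (c *: y) z
    & forall (c : k) x y z, G x (c *: y) z = G x y (c *: z)].

Lemma trilin_bal (P : zmodType) (G : H -> H -> H -> P) : trilin G ->
  balanced (@kract k H) (tlact (@klact k H))
    (fun a u => \sw_(b, c <- (u : tensk H H)) G a b c).
Proof.
case=> G1 G2 G3 G4 G5.
have Gb a : balanced (@kract k H) (@klact k H) (G a).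
  by split=> [n x y|m x y|m i n]; rewrite ?G2 ?G3 //; apply: G5.
split=> [u x y|a u v|a c u].
- by rewrite -tlift_add; apply: eq_tlift => b d; rewrite G1.
- by rewrite (tliftD (Gb a)).
rewrite /tlact /tmap tlift_tlift //.
by apply: eq_tlift => b d; rewrite /kract /klact /= G4.
Qed.

Lemma coassoc_tri (P : zmodType) (G : H -> H -> H -> P) h : trilin G ->
  \sw_(a, b <- delta h) \sw_(a1, a2 <- delta a) G a1 a2 b
  = \sw_(a, b <- delta h) \sw_(b1, b2 <- delta b) G a b1 b2.
Proof.
move=> Gt; have GB := trilin_bal Gt.
have [G1 G2 G3 G4 G5] := Gt.
have Gb a : balanced (@kract k H) (@klact k H) (G a).
  by split=> [n x y|m x y|m i n]; rewrite ?G2 ?G3 //; apply: G5.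
have := congr1 (tlift (fun a u => \sw_(b, c <- (u : tensk H H)) G a b c))
  (coring_coassoc co h).
rewrite (tlift_tlift _ _ _ GB) (raddf_tlift _ _ (tliftD GB)) => <-.
apply: eq_tlift => a b; rewrite tlift_tlift //.
by apply: eq_tlift => c d; rewrite tlift_pure.
Qed.

Lemma kmul_balr (a b : H) :
  balanced (@kract k H) (@klact k H) (fun c d => a ∙ c ⊗ (b ∙ d) : tensk H H).
Proof. by bal. Qed.

Lemma kmul_ball (u : tensk H H) :
  balanced (@kract k H) (@klact k H)
    (fun a b => \sw_(c, d <- u) (a ∙ c ⊗ (b ∙ d)) : tensk H H).
Proof.
by split=> [n x y|m x y|m i n]; rewrite -?tlift_add; apply: eq_tlift => c d; nrm.
Qed.

Lemma tmulkDl (t t' u : tensk H H) :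
  tmul kmul kmul (t + t') u = tmul kmul kmul t u + tmul kmul kmul t' u.
Proof. exact: (tliftD (kmul_ball u)). Qed.

Lemma tmulkDr (t u u' : tensk H H) :
  tmul kmul kmul t (u + u') = tmul kmul kmul t u + tmul kmul kmul t u'.
Proof.
by rewrite /tmul -tlift_add; apply: eq_tlift => a b; rewrite (tliftD (kmul_balr a b)).
Qed.

Lemma tmulk_pure (a b : H) (u : tensk H H) :
  tmul kmul kmul (a ⊗ b) u = \sw_(c, d <- u) (a ∙ c ⊗ (b ∙ d)).
Proof. by rewrite /tmul (tlift_pure (kmul_ball u)). Qed.

Lemma tmulk_pure_r (a b : H) (u : tensk H H) :
  tmul kmul kmul u (a ⊗ b) = \sw_(c, d <- u) (c ∙ a ⊗ (d ∙ b)).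
Proof. by apply: eq_tlift => c d; rewrite (tlift_pure (kmul_balr c d)). Qed.

Lemma tmulk_lactl (c : k) (t u : tensk H H) :
  tmul kmul kmul (tlact klact c t) u = tlact klact c (tmul kmul kmul t u).
Proof.
rewrite {1}/tlact /tmap /tmul tlift_tlift; last exact: kmul_ball.
rewrite /tlact /tmap (raddf_tlift _ _ (tliftD _)); last by bal.
apply: eq_tlift => a b; rewrite tlift_tlift; last by bal.
by apply: eq_tlift => d e; nrm.
Qed.

Lemma tmulk_lactr (c : k) (t u : tensk H H) :
  tmul kmul kmul t (tlact klact c u) = tlact klact c (tmul kmul kmul t u).
Proof.
rewrite {1}/tlact /tmap /tmul.
rewrite /tlact /tmap (raddf_tlift _ _ (tliftD _)); last by bal.
apply: eq_tlift => a b; rewrite tlift_tlift; last exact: kmul_balr.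
rewrite tlift_tlift; last by bal.
by apply: eq_tlift => d e; nrm.
Qed.

Let T3 := tens3 (@klact k H) (@kract k H) (@klact k H).
Let kra := @kract k H.
Let kla := tlact (N := H) (ra := @kract k H) (la := @klact k H) (@klact k H).

Lemma kmul3_balr a b :
  balanced kra kla (fun c d => a ∙ c ⊗ (tmul kmul kmul b d) : T3).
Proof.
split=> [n x y|m x y|m i n]; first by nrm.
  by rewrite tmulkDr tpureDr.
rewrite tmulk_lactr -tpure_bal; congr (_ ⊗ _); exact: kmulZr.
Qed.

Lemma kmul3_ball (u : T3) :
  balanced kra kla
    (fun a b => \sw_(c, d <- u) (a ∙ c ⊗ (tmul kmul kmul b d)) : T3).
Proof.
split=> [n x y|m x y|m i n]; rewrite -?tlift_add; apply: eq_tlift => c d.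
- by nrm.
- by rewrite tmulkDl tpureDr.
- by rewrite tmulk_lactl -tpure_bal; congr (_ ⊗ _); exact: kmulZl.
Qed.

Lemma delta1l_tri (P : zmodType) (G : H -> H -> H -> P) : trilin G ->
  \sw_(a, b <- delta 𝟙) \sw_(b1, b2 <- delta b) G a b1 b2
  = \sw_(a, b <- delta 𝟙) \sw_(c, d <- delta 𝟙) G a (b ∙ c) d.
Proof.
move=> Gt; have GB := trilin_bal Gt; rewrite -coassoc_tri //.
have [G1 G2 G3 G4 G5] := Gt.
have Gb a : balanced (@kract k H) (@klact k H) (G a).
  by split=> [n x y|m x y|m i n]; rewrite ?G2 ?G3 //; apply: G5.
pose L (t : T3) := tlift (fun a u => \sw_(b, c <- (u : tensk H H)) G a b c) t.
have := congr1 L (wb_delta1l wb).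
rewrite {1}/L (raddf_tlift _ _ (tliftD GB)).
under eq_tlift => a b.
  rewrite tlift_tlift //.
  under eq_tlift => c d do rewrite tlift_pure //.
  over.
move=> ->; rewrite {1}/tmul /L tlift_tlift; last exact: kmul3_ball.
rewrite (raddf_tlift _ _ (tliftD GB)); apply: eq_tlift => a b.
rewrite (tlift_pure (kmul3_balr _ _)) (tlift_pure GB) kmulr1.
rewrite tmulk_pure tlift_tlift //.
by apply: eq_tlift => c d; rewrite kmul1r.
Qed.

Lemma delta1r_tri (P : zmodType) (G : H -> H -> H -> P) : trilin G ->
  \sw_(a, b <- delta 𝟙) \sw_(b1, b2 <- delta b) G a b1 b2
  = \sw_(a, b <- delta 𝟙) \sw_(c, d <- delta 𝟙) G a (c ∙ b) d.
Proof.
move=> Gt; have GB := trilin_bal Gt; rewrite -coassoc_tri //.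
have [G1 G2 G3 G4 G5] := Gt.
have Gb a : balanced (@kract k H) (@klact k H) (G a).
  by split=> [n x y|m x y|m i n]; rewrite ?G2 ?G3 //; apply: G5.
pose L (t : T3) := tlift (fun a u => \sw_(b, c <- (u : tensk H H)) G a b c) t.
have := congr1 L (wb_delta1r wb).
rewrite {1}/L (raddf_tlift _ _ (tliftD GB)).
under eq_tlift => a b.
  rewrite tlift_tlift //.
  under eq_tlift => c d do rewrite tlift_pure //.
  over.
move=> ->; rewrite {1}/tmul /L (tlift_pure (kmul3_ball _)).
rewrite (tlift_tlift _ _ _ (kmul3_balr _ _)).
rewrite (raddf_tlift _ _ (tliftD GB)); apply: eq_tlift => a b.
rewrite (tlift_pure GB) kmul1r.
rewrite tmulk_pure_r tlift_tlift //; apply: eq_tlift => c d.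
by rewrite kmulr1.
Qed.

Ltac tri := split; intros ? ? ? ?; cbv beta; nrm;
  try done; try (by rewrite mulrC ?mulrA); try (by rewrite mulrAC);
  try (by rewrite -mulrA mulrC).

Lemma wb_deltaD x y : delta (x + y) = delta x + delta y.
Proof. exact: (coring_deltaD co). Qed.

Lemma wb_deltaZ (c : k) x :
  delta (c *: x) = \sw_(a, b <- delta x) ((c *: a) ⊗ b).
Proof. exact: (coring_deltal co c x). Qed.

Lemma wb_counitl x : \sw_(a, b <- delta x) ((eps a : k) *: b) = x.
Proof. exact: (coring_counitl co x). Qed.

Lemma wb_counitr x : \sw_(a, b <- delta x) ((eps b : k) *: a) = x.
Proof. exact: (coring_counitr co x). Qed.

Lemma wb_epsS I (M N : zmodType) ra la (t : @tens I M N ra la) F :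
  eps (\sw_(a, b <- t) F a b) = \sw_(a, b <- t) eps (F a b).
Proof. by rewrite (raddf_tlift _ _ wb_epsD). Qed.

Lemma kmulS I (M N : zmodType) ra la (t : @tens I M N ra la) F (x : H) :
  x ∙ (\sw_(a, b <- t) F a b) = \sw_(a, b <- t) (x ∙ F a b).
Proof. by rewrite (raddf_tlift _ _ (kmulDr x)). Qed.

Lemma kmulSl I (M N : zmodType) ra la (t : @tens I M N ra la) F (x : H) :
  (\sw_(a, b <- t) F a b) ∙ x = \sw_(a, b <- t) (F a b ∙ x).
Proof. by rewrite (raddf_tlift _ _ (fun y z => kmulDl y z x)). Qed.

Lemma pureSl I (M N : zmodType) ra la (t : @tens I M N ra la) (F : M -> N -> H)
   (x : H) :
  (\sw_(a, b <- t) F a b) ⊗ x = \sw_(a, b <- t) (F a b ⊗ x) :> tensk H H.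
Proof. by rewrite (raddf_tlift _ _ (fun y z => tpureDl _ _ y z x)). Qed.

Lemma pureSr I (M N : zmodType) ra la (t : @tens I M N ra la) (F : M -> N -> H)
   (x : H) :
  x ⊗ (\sw_(a, b <- t) F a b) = \sw_(a, b <- t) (x ⊗ F a b) :> tensk H H.
Proof. by rewrite (raddf_tlift _ _ (tpureDr _ _ x)). Qed.

Lemma scaleS I (M N : zmodType) ra la (V : lmodType k)
    (t : @tens I M N ra la) (F : M -> N -> V) (c : k) :
  c *: (\sw_(a, b <- t) F a b) = \sw_(a, b <- t) (c *: F a b).
Proof. by rewrite (raddf_tlift _ _ (scalerDr c)). Qed.

Lemma deltaM_bi (P : zmodType) (F : H -> H -> P) x y :
  balanced (@kract k H) (@klact k H) F ->
  tlift F (delta (x ∙ y))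
  = \sw_(a, b <- delta x) \sw_(c, d <- delta y) F (a ∙ c) (b ∙ d).
Proof.
move=> FB; rewrite (wb_deltaM wb) /tmul (raddf_tlift _ _ (tliftD FB)).
by apply: eq_tlift => a b; rewrite tlift_tlift.
Qed.

Notation Pi := (PiL delta eps).

Lemma PiL_linear : linear Pi.
Proof.
move=> c x y; rewrite /PiL scaleS -tlift_add.
by apply: eq_tlift => a b; nrm.
Qed.

Lemma PiLD x y : Pi (x + y) = Pi x + Pi y.
Proof. exact: (linD PiL_linear). Qed.

Lemma PiLZ (c : k) x : Pi (c *: x) = c *: Pi x.
Proof. exact: (linZ PiL_linear). Qed.

Lemma eps_PiL x y : eps (x ∙ Pi y) = eps (x ∙ y).
Proof.
rewrite -[in RHS](kmulr1 x) (wb_epsM2 wb) kmulS wb_epsS.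
by apply: eq_tlift => a b; nrm; rewrite mulrC.
Qed.

Lemma PiL1 : Pi 𝟙 = 𝟙.
Proof.
rewrite -[RHS]wb_counitl; apply: eq_tlift => a b.
by rewrite kmulr1.
Qed.

Lemma PiLM x y : Pi (x ∙ Pi y) = Pi (x ∙ y).
Proof. by apply: eq_tlift => a b; rewrite !kmulA eps_PiL. Qed.

Lemma PiL_id x : Pi (Pi x) = Pi x.
Proof. by rewrite -[Pi x in LHS]kmul1r PiLM kmul1r. Qed.

Lemma delta_PiL_l x : delta (Pi x) = \sw_(e, f <- delta 𝟙) (Pi x ∙ e ⊗ f).
Proof.
rewrite [in LHS]/PiL (raddf_tlift _ _ wb_deltaD).
under eq_tlift => a b do rewrite wb_deltaZ.
rewrite (@delta1l_tri (tensk H H) (fun a b c : H => ((eps (a ∙ x) : k) *: b : H) ⊗ c)); last by tri.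
rewrite tlift_exchange; apply: eq_tlift => c d.
rewrite /PiL kmulSl pureSl; apply: eq_tlift => a b; by nrm.
Qed.

Lemma delta_PiL_r x : delta (Pi x) = \sw_(e, f <- delta 𝟙) (e ∙ Pi x ⊗ f).
Proof.
rewrite [in LHS]/PiL (raddf_tlift _ _ wb_deltaD).
under eq_tlift => a b do rewrite wb_deltaZ.
rewrite (@delta1r_tri (tensk H H) (fun a b c : H => ((eps (a ∙ x) : k) *: b : H) ⊗ c)); last by tri.
rewrite tlift_exchange; apply: eq_tlift => c d.
rewrite /PiL kmulS pureSl; apply: eq_tlift => a b; by nrm.
Qed.

(* h r = eps (h_1 r) h_2 for r = Pi y *)
Lemma mul_PiL h y : h ∙ Pi y = \sw_(a, b <- delta h) ((eps (a ∙ y) : k) *: b).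
Proof.
rewrite -[LHS]wb_counitl deltaM_bi; last by bal.
rewrite delta_PiL_r.
transitivity (\sw_(a, b <- delta h) \sw_(e, f <- delta 𝟙)
    ((eps (a ∙ e ∙ y) : k) *: (b ∙ f) : H)).
  apply: eq_tlift => a b; rewrite tlift_tlift; last by bal.
  by apply: eq_tlift => e f; rewrite kmulA eps_PiL.
rewrite -(deltaM_bi (F := fun a b : H => (eps (a ∙ y) : k) *: b : H)); last by bal.
by rewrite kmulr1.
Qed.

Lemma PiL_mull x y : Pi (Pi x ∙ y) = Pi x ∙ Pi y.
Proof.
rewrite mul_PiL delta_PiL_r tlift_tlift; last by bal.
by apply: eq_tlift => a b; rewrite kmulA.
Qed.

(* Restricts to the inverse of the antipode on the image of Pi ([wh_tE]). *)
Definition PiLbar (r : H) : H := \sw_(e, f <- delta 𝟙) ((eps (f ∙ r) : k) *: e).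
Notation tau := PiLbar.

Lemma PiLbar_linear : linear tau.
Proof.
move=> c x y; rewrite /PiLbar scaleS -tlift_add.
by apply: eq_tlift => a b; nrm.
Qed.

Lemma PiLbar1 : tau 𝟙 = 𝟙.
Proof.
rewrite -[RHS]wb_counitr; apply: eq_tlift => a b; by rewrite kmulr1.
Qed.

Lemma PiLbar_PiL x : tau (Pi x) = tau x.
Proof. by apply: eq_tlift => a b; rewrite eps_PiL. Qed.

Lemma eps_PiLbar x y : eps (x ∙ tau y) = eps (x ∙ y).
Proof.
rewrite -[in RHS](kmulr1 x) (wb_epsM1 wb) kmulS wb_epsS.
by apply: eq_tlift => a b; nrm; rewrite mulrC.
Qed.

Lemma PiL_PiLbar x : Pi (tau x) = Pi x.
Proof. by apply: eq_tlift => a b; rewrite eps_PiLbar. Qed.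

Lemma PiL_tau_comm x y : Pi x ∙ tau y = tau y ∙ Pi x.
Proof.
transitivity (\sw_(a, b <- delta 𝟙) \sw_(b1, b2 <- delta b)
    ((eps (a ∙ x) : k) *: ((eps (b2 ∙ y) : k) *: b1 : H) : H)).
  rewrite (@delta1l_tri H (fun a b c : H => (eps (a ∙ x) : k) *: ((eps (c ∙ y) : k) *: b : H) : H)); last by tri.
  rewrite /PiL kmulSl; apply: eq_tlift => a b.
  by rewrite /PiLbar kmulS; apply: eq_tlift => c d; nrm.
rewrite (@delta1r_tri H (fun a b c : H => (eps (a ∙ x) : k) *: ((eps (c ∙ y) : k) *: b : H) : H)); last by tri.
rewrite /PiL kmulS; apply: eq_tlift => a b.
by rewrite /PiLbar kmulSl; apply: eq_tlift => c d; nrm; rewrite mulrC.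
Qed.

Lemma delta_tau x : delta (tau x) = \sw_(e, f <- delta 𝟙) (e ⊗ (f ∙ tau x)).
Proof.
rewrite [in LHS]/PiLbar (raddf_tlift _ _ wb_deltaD).
under eq_tlift => a b do rewrite wb_deltaZ.
transitivity (\sw_(a, b <- delta 𝟙) \sw_(b1, b2 <- delta b)
    (((eps (b2 ∙ x) : k) *: a : H) ⊗ b1 : tensk H H)).
  rewrite -(@coassoc_tri (tensk H H) (fun a b c : H => ((eps (c ∙ x) : k) *: a : H) ⊗ b)) //; by tri.
rewrite (@delta1l_tri (tensk H H) (fun a b c : H => ((eps (c ∙ x) : k) *: a : H) ⊗ b)); last by tri.
apply: eq_tlift => a b.
by rewrite /PiLbar kmulS pureSr; apply: eq_tlift => c d; nrm.
Qed.

Lemma delta_tau_l x : delta (tau x) = \sw_(e, f <- delta 𝟙) (e ⊗ (tau x ∙ f)).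
Proof.
rewrite [in LHS]/PiLbar (raddf_tlift _ _ wb_deltaD).
under eq_tlift => a b do rewrite wb_deltaZ.
transitivity (\sw_(a, b <- delta 𝟙) \sw_(b1, b2 <- delta b)
    (((eps (b2 ∙ x) : k) *: a : H) ⊗ b1 : tensk H H)).
  rewrite -(@coassoc_tri (tensk H H) (fun a b c : H => ((eps (c ∙ x) : k) *: a : H) ⊗ b)) //; by tri.
rewrite (@delta1r_tri (tensk H H) (fun a b c : H => ((eps (c ∙ x) : k) *: a : H) ⊗ b)); last by tri.
apply: eq_tlift => a b.
by rewrite /PiLbar kmulSl pureSr; apply: eq_tlift => c d; nrm.
Qed.

(* h tau(y) = h_1 eps (h_2 y) *)
Lemma mul_tau h y : h ∙ tau y = \sw_(a, b <- delta h) ((eps (b ∙ y) : k) *: a).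
Proof.
rewrite -[LHS]wb_counitr deltaM_bi; last by bal.
rewrite delta_tau.
transitivity (\sw_(a, b <- delta h) \sw_(e, f <- delta 𝟙)
    ((eps (b ∙ f ∙ y) : k) *: (a ∙ e) : H)).
  apply: eq_tlift => a b; rewrite tlift_tlift; last by bal.
  by apply: eq_tlift => e f; rewrite kmulA eps_PiLbar.
rewrite -(deltaM_bi (F := fun a b : H => (eps (b ∙ y) : k) *: a : H)); last by bal.
by rewrite kmulr1.
Qed.

Lemma tauM x y : tau (Pi x ∙ Pi y) = tau (Pi y) ∙ tau (Pi x).
Proof.
rewrite mul_tau delta_tau tlift_tlift; last by bal.
apply: eq_tlift => a b; congr (_ *: _).
by rewrite -kmulA -PiL_tau_comm !kmulA eps_PiLbar.
Qed.

Lemma takeuchi_delta h y :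
  \sw_(a, b <- delta h) (a ∙ tau y ⊗ b)
  = \sw_(a, b <- delta h) (a ⊗ (b ∙ Pi y)) :> tensk H H.
Proof.
transitivity (\sw_(a, b <- delta h) \sw_(a1, a2 <- delta a)
  (((eps (a2 ∙ y) : k) *: a1 : H) ⊗ b : tensk H H)).
  by apply: eq_tlift => a b; rewrite mul_tau pureSl.
rewrite (@coassoc_tri (tensk H H) (fun a b c : H => ((eps (b ∙ y) : k) *: a : H) ⊗ c)); last by tri.
apply: eq_tlift => a b; rewrite mul_PiL pureSr.
by apply: eq_tlift => c d; nrm.
Qed.

Lemma PiL_mul_tau x y : Pi (tau y ∙ x) = Pi x ∙ Pi y.
Proof.
have := congr1 (tlift (fun a b : H => (eps (a ∙ x) : k) *: b : H)) (takeuchi_delta 𝟙 y).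
rewrite !tlift_tlift; try by bal.
move=> e; rewrite [in LHS]/PiL [Pi x in RHS]/PiL [RHS]kmulSl.
transitivity (\sw_(a, b <- delta 𝟙) ((eps (a ∙ tau y ∙ x) : k) *: b)).
  by apply: eq_tlift => a b; rewrite kmulA.
by rewrite e; apply: eq_tlift => a b; nrm.
Qed.

(* 1_1 (x) Pi (1_2 z) = 1_1 (x) 1_2 Pi z *)
Lemma delta1_PiL z :
  \sw_(e, f <- delta 𝟙) (e ⊗ Pi (f ∙ z))
  = \sw_(e, f <- delta 𝟙) (e ⊗ (f ∙ Pi z)) :> tensk H H.
Proof.
transitivity (\sw_(a, b <- delta 𝟙) \sw_(b1, b2 <- delta b)
   (((eps (b1 ∙ z) : k) *: a : H) ⊗ b2 : tensk H H)); last first.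
  apply: eq_tlift => a b; rewrite mul_PiL pureSr.
  by apply: eq_tlift => c d; nrm.
rewrite (@delta1r_tri (tensk H H) (fun a b c : H => ((eps (b ∙ z) : k) *: a : H) ⊗ c)); last by tri.
apply: eq_tlift => a b; rewrite /PiL pureSr.
by apply: eq_tlift => c d; nrm; rewrite kmulA.
Qed.
End WeakBialgebra.

(* The subalgebra R = Im (Pi^L) of H. *)
Section Base.
Variables (k : comPzRingType) (H : weakHopf k).

Definition Pi_L : H -> H := PiL (@wh_delta k H) (@wh_eps k H).

Definition in_base : {pred H} := fun r => `[< exists h, r = Pi_L h >].

Lemma in_baseP r : reflect (exists h, r = Pi_L h) (r \in in_base).
Proof. exact: asboolP. Qed.

Lemma in_base_Pi h : Pi_L h \in in_base.
Proof. by apply/in_baseP; exists h. Qed.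

Lemma base_submod : submod_closed in_base.
Proof.
have PL : linear Pi_L := PiL_linear (wh_bialg H).
split; first by apply/in_baseP; exists 0; rewrite lin0.
move=> c _ _ /in_baseP[x ->] /in_baseP[y ->]; rewrite -PL; exact: in_base_Pi.
Qed.

HB.instance Definition _ := GRing.isSubmodClosed.Build k H in_base base_submod.

Definition base : Type := {r : H | r \in in_base}.

HB.instance Definition _ := SubType.on base.
HB.instance Definition _ := Choice.on base.
HB.instance Definition _ := [SubChoice_isSubLmodule of base by <:].

Lemma in_base1 : 𝟙 \in in_base.
Proof. by apply/in_baseP; exists 𝟙; rewrite /Pi_L PiL1 //; exact: wh_bialg. Qed.

Lemma in_baseM r s : r \in in_base -> s \in in_base -> r ∙ s \in in_base.
Proof.
move=> /in_baseP[x ->] /in_baseP[y ->].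
rewrite /Pi_L -(PiL_mull (wh_bialg H)); exact: in_base_Pi.
Qed.

Definition base_one : base := exist _ 𝟙 in_base1.
Definition base_mul (r s : base) : base :=
  exist _ (val r ∙ val s) (in_baseM (valP r) (valP s)).

Lemma base_mulA : associative base_mul.
Proof. by move=> x y z; apply: val_inj; apply: kmulA. Qed.
Lemma base_mul1r : left_id base_one base_mul.
Proof. by move=> x; apply: val_inj; apply: kmul1r. Qed.
Lemma base_mulr1 : right_id base_one base_mul.
Proof. by move=> x; apply: val_inj; apply: kmulr1. Qed.
Lemma base_linl y : linear (base_mul^~ y).
Proof. by move=> c u v; apply: val_inj; apply: kmul_linl. Qed.
Lemma base_linr x : linear (base_mul x).
Proof. by move=> c u v; apply: val_inj; apply: kmul_linr. Qed.

HB.instance Definition _ := isKAlgebra.Build k base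
  base_mulA base_mul1r base_mulr1 base_linl base_linr.

Definition Pi_R (h : H) : base := exist _ (Pi_L h) (in_base_Pi h).

End Base.

Section Bialgebroids.
Variables (k : comPzRingType) (R : kalgType k).

(* The Takeuchi product H x_R A inside H (x)_R A, where t is the target map of
   H and s the structure map of the R-ring A. *)
Definition in_takeuchi (H A : kalgType k) (t : R -> H) (s : R -> A)
    (x : tens (rres t kmul) (lres s kmul)) : Prop :=
  forall r, \sw_(h, a <- x) (h ∙ t r ⊗ a) = \sw_(h, a <- x) (h ⊗ (a ∙ s r))
    :> tens (rres t kmul) (lres s kmul).

Record is_bialgebroid (H : kalgType k) (s t : R -> H)
    (delta : H -> tens (rres t kmul) (lres s kmul)) (eps : H -> R) : Prop :=
  IsBialgebroid {
  bg_s_morph : is_algmorph s;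
  bg_t_linear : linear t;
  bg_t1 : t 𝟙 = 𝟙;
  bg_tM : forall r r', t (r ∙ r') = t r' ∙ t r;
  bg_st_comm : forall r r', s r ∙ t r' = t r' ∙ s r;
  bg_coring : is_coring delta eps;
  bg_takeuchi : forall h, in_takeuchi (delta h);
  bg_delta1 : delta 𝟙 = 𝟙 ⊗ 𝟙;
  bg_deltaM : forall g h, delta (g ∙ h) = tmul kmul kmul (delta g) (delta h);
  bg_eps1 : eps 𝟙 = 𝟙;
  bg_epss : forall g h, eps (g ∙ h) = eps (g ∙ s (eps h));
  bg_epst : forall g h, eps (g ∙ h) = eps (g ∙ t (eps h))
}.

Record bialgebroid := Bialgebroid {
  bg_alg :> kalgType k;
  bg_s : R -> bg_alg;
  bg_t : R -> bg_alg;
  bg_delta : bg_alg -> tens (rres bg_t kmul) (lres bg_s kmul);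
  bg_eps : bg_alg -> R;
  bg_laws : is_bialgebroid bg_delta bg_eps
}.

End Bialgebroids.

Section WeakHopfBialgebroid.
Variables (k : comPzRingType) (H : weakHopf k).
Hypothesis antipode_bij : bijective (@antipode k H).

Lemma antipode_inv_ex :
  exists T : H -> H, cancel (@antipode k H) T /\ cancel T (@antipode k H).
Proof. by case: antipode_bij => T ST TS; exists T. Qed.

Definition antipode_inv : H -> H := sval (cid antipode_inv_ex).

Lemma antipodeK : cancel (@antipode k H) antipode_inv.
Proof. by rewrite /antipode_inv; case: cid => T []. Qed.

Lemma antipode_invK : cancel antipode_inv (@antipode k H).
Proof. by rewrite /antipode_inv; case: cid => T []. Qed.

Local Notation R := (base H).
Local Notation delta := (@wh_delta k H).
Local Notation eps := (@wh_eps k H).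
Local Notation wb := (wh_bialg H).
Local Notation S := (@antipode k H).
Local Notation tau := (PiLbar delta eps).

(* The target map is the restriction of the inverse of the antipode; on the
   base it is given by [PiLbar], see [wh_tE]. *)
Definition wh_s (r : R) : H := val r.
Definition wh_t (r : R) : H := antipode_inv (val r).
Definition wh_deltaR (h : H) : tens (rres wh_t kmul) (lres wh_s kmul) :=
  \sw_(h1, h2 <- delta h) (h1 ⊗ h2).

Lemma Pi_base (r : R) : PiL delta eps (wh_s r) = wh_s r.
Proof.
by case/in_baseP: (valP r) => x e; rewrite /wh_s e /Pi_L (PiL_id wb).
Qed.

Lemma antipode_tau x : S (tau x) = PiL delta eps x.
Proof.
have aS := wh_antipode H.
rewrite -(antipode_mid aS).
transitivity (\sw_(a, b <- delta (tau x)) (S a ∙ PiL delta eps b)).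
  by apply: eq_tlift => a b; rewrite (antipode_left aS).
have SD := linD (antipode_linear aS).
have SZ := linZ (antipode_linear aS).
have PD := PiLD wb. have PZ := PiLZ wb.
rewrite (delta_tau wb) tlift_tlift; last first.
  split=> [n y z|m y z|m c n]; rewrite /kract /klact.
  - by rewrite SD kmulDl.
  - by rewrite PD kmulDr.
  - by rewrite SZ PZ kmulZl kmulZr.
have /(congr1 (tlift (fun a b => S a ∙ b))) := delta1_PiL wb (tau x).
have B : balanced (@kract k H) (@klact k H) (fun a b => S a ∙ b).
  split=> [n y z|m y z|m c n]; rewrite /kract /klact.
  - by rewrite SD kmulDl.
  - by rewrite kmulDr.
  - by rewrite SZ kmulZl kmulZr.
rewrite !tlift_tlift // => ->.
under eq_tlift => a b do rewrite kmulA.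
rewrite -kmulSl (antipode_right aS) (PiL_PiLbar wb).
rewrite -[RHS]kmul1r; congr (_ ∙ _); rewrite -[RHS](wb_counitr wb).
by apply: eq_tlift => a b; rewrite kmul1r.
Qed.

Lemma wh_tE r : wh_t r = tau (wh_s r).
Proof.
by rewrite /wh_t -/(wh_s r) -[in LHS]Pi_base -antipode_tau antipodeK.
Qed.

Lemma wh_t_linear : linear wh_t.
Proof. by move=> c x y; rewrite !wh_tE; exact: (PiLbar_linear wb). Qed.

Lemma wh_t1 : wh_t 𝟙 = 𝟙.
Proof. by rewrite wh_tE; exact: (PiLbar1 wb). Qed.

Lemma wh_tM r r' : wh_t (r ∙ r') = wh_t r' ∙ wh_t r.
Proof.
rewrite !wh_tE -(Pi_base r) -(Pi_base r') -(tauM wb) !Pi_base.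
by congr PiLbar.
Qed.

Lemma wh_st_comm r r' : wh_s r ∙ wh_t r' = wh_t r' ∙ wh_s r.
Proof. by rewrite wh_tE -(Pi_base r) (PiL_tau_comm wb). Qed.

Lemma wh_s_morph : is_algmorph wh_s.
Proof. by []. Qed.

Local Notation ra := (rres wh_t (@kmul k H)).
Local Notation la := (lres wh_s (@kmul k H)).
Local Notation TR := (tens ra la).

Lemma Rbal_kbal (P : zmodType) (F : H -> H -> P) :
  balanced ra la F -> balanced (@kract k H) (@klact k H) F.
Proof.
case=> F1 F2 F3; split=> // m c n.
have := F3 m ((c : k) *: 𝟙) n; rewrite /rres /lres.
rewrite (linZ wh_t_linear) wh_t1 (_ : wh_s _ = (c : k) *: 𝟙) //.
by rewrite !kmulZl !kmul1r.
Qed.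

Lemma tlift_deltaR (P : zmodType) (F : H -> H -> P) h : balanced ra la F ->
  tlift F (wh_deltaR h) = tlift F (delta h).
Proof. by move=> FB; rewrite tlift_tlift. Qed.

Lemma pure_kbal : balanced (@kract k H) (@klact k H) (fun a b => a ⊗ b : TR).
Proof. apply: Rbal_kbal; exact: tpure_balanced. Qed.

Lemma wh_deltaRD : {morph wh_deltaR : x y / x + y}.
Proof.
by move=> x y; rewrite /wh_deltaR (wb_deltaD wb) (tliftD pure_kbal).
Qed.

Lemma ract_assoc m r n (x : H) : ra m r ∙ x ⊗ n = m ∙ x ⊗ la r n :> TR.
Proof. by rewrite /rres -kmulA (tpure_bal ra la). Qed.

Lemma sbal r : balanced ra la (fun a b => la r a ⊗ b : TR).
Proof.
split=> [n x y|m x y|m i n]; rewrite /lres.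
- by rewrite kmulDr tpureDl.
- by rewrite tpureDr.
by rewrite /rres kmulA wh_st_comm -kmulA (tpure_bal ra la).
Qed.

Lemma tbal r : balanced ra la (fun a b => a ⊗ ra b r : TR).
Proof.
split=> [n x y|m x y|m i n].
- by rewrite tpureDl.
- by rewrite /rres kmulDr tpureDr.
by rewrite (tpure_bal ra la) /rres /lres !kmulA wh_st_comm.
Qed.

Lemma wh_deltaRl r h : wh_deltaR (la r h) = tmap (la r) id (wh_deltaR h).
Proof.
rewrite [RHS](tlift_deltaR _ (sbal r)) [X in wh_deltaR X]/lres.
rewrite -[X in wh_deltaR (X ∙ _)](Pi_base r).
rewrite [LHS](deltaM_bi wb _ _ pure_kbal) (delta_PiL_l wb).
rewrite -[in RHS](kmul1r h) (deltaM_bi wb _ _ (Rbal_kbal (sbal r))).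
rewrite tlift_tlift.
  by apply: eq_tlift => a b; apply: eq_tlift => c d; rewrite Pi_base /lres kmulA.
have [p1 p2 p3] := pure_kbal.
split=> [n x y|m x y|m c n]; rewrite -?tlift_add; apply: eq_tlift => a b.
- by rewrite kmulDl p1.
- by rewrite kmulDl p2.
- by rewrite kmulZl p3 /klact -kmulZl.
Qed.

Lemma wh_deltaRr r h : wh_deltaR (ra h r) = tmap id (ra^~ r) (wh_deltaR h).
Proof.
rewrite [RHS](tlift_deltaR _ (tbal r)) [X in wh_deltaR X]/rres wh_tE.
rewrite [LHS](deltaM_bi wb _ _ pure_kbal) (delta_tau_l wb).
rewrite -[in RHS](kmul1r h) (deltaM_bi wb _ _ (Rbal_kbal (tbal r))).
rewrite tlift_tlift.
  by apply: eq_tlift => a b; apply: eq_tlift => c d; rewrite /rres kmulA -?wh_tE.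
have [p1 p2 p3] := pure_kbal.
split=> [n x y|m x y|m c n]; rewrite -?tlift_add; apply: eq_tlift => a b.
- by rewrite kmulDl p1.
- by rewrite kmulDl p2.
- by rewrite kmulZl p3 /klact -kmulZl.
Qed.

Lemma wh_takeuchi h : in_takeuchi (wh_deltaR h).
Proof.
move=> r; rewrite !tlift_deltaR; last 2 first.
- split=> [n x y|m x y|m i n]; first by rewrite tpureDl.
    by rewrite kmulDl tpureDr.
  by rewrite (tpure_bal ra la) /lres kmulA.
- split=> [n x y|m x y|m i n]; first by rewrite kmulDl tpureDl.
    by rewrite tpureDr.
  exact: ract_assoc.
have := congr1 (tlift (fun a b => a ⊗ b : TR)) (takeuchi_delta wb h (wh_s r)).
rewrite !tlift_tlift; try exact: pure_kbal.
by rewrite Pi_base -wh_tE.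
Qed.

Lemma wh_bimod : is_bimodule la ra.
Proof.
split=> [|r c u v|m c u v|m|m r s|r m s]; last 5 first.
- by rewrite /rres kmulDr kmulZr.
- by rewrite /rres wh_t_linear kmulDl kmulZl.
- by rewrite /rres wh_t1 kmul1r.
- by rewrite /rres wh_tM kmulA.
- by rewrite /rres /lres !kmulA wh_st_comm.
split=> [r c u v|m c u v|m|r s m]; rewrite /lres.
- by rewrite kmulDr kmulZr.
- by rewrite kmulDl kmulZl.
- exact: kmul1r.
- by rewrite kmulA.
Qed.

Let T3R := tens3 la ra la.

Lemma pure3_bal b : balanced ra la (fun c d => c ⊗ (d ⊗ b) : T3R).
Proof.
split=> [n x y|m x y|m i n]; first by rewrite tpureDl.
  by rewrite tpureDl tpureDr.
rewrite (tpure_bal ra (tlact la)); congr (_ ⊗ _).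
by rewrite /tlact /tmap (tlift_pure (sbal i)).
Qed.

Lemma coassoc_ball : balanced ra la
  (fun a b => \sw_(c, d <- wh_deltaR a) (c ⊗ (d ⊗ b)) : T3R).
Proof.
split=> [n x y|m x y|m i n].
- by rewrite wh_deltaRD (tliftD (pure3_bal n)).
- by rewrite -tlift_add; apply: eq_tlift => a b; rewrite !tpureDr.
rewrite wh_deltaRr /tmap tlift_tlift; last exact: pure3_bal.
apply: eq_tlift => a b; congr (_ ⊗ _); exact: (tpure_bal ra la).
Qed.

Lemma coassoc_balr : balanced ra la (fun a b => a ⊗ wh_deltaR b : T3R).
Proof.
split=> [n x y|m x y|m i n]; first by rewrite tpureDl.
  by rewrite wh_deltaRD tpureDr.
by rewrite wh_deltaRl (tpure_bal ra (tlact la)).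
Qed.

Lemma wh_coring : is_coring wh_deltaR (@Pi_R k H).
Proof.
have PD := PiLD wb.
split.
- exact: wh_bimod.
- exact: wh_deltaRD.
- exact: wh_deltaRl.
- by move=> r c; apply: wh_deltaRr.
- by move=> x y; apply: val_inj; apply: PD.
- move=> r c; apply: val_inj => /=; rewrite /lres.
  by rewrite -{1}(Pi_base r) /Pi_L (PiL_mull wb) Pi_base.
- move=> r c; apply: val_inj => /=; rewrite /rres wh_tE.
  by rewrite /Pi_L (PiL_mul_tau wb) Pi_base.
- move=> h; rewrite (tlift_deltaR _ coassoc_ball) (tlift_deltaR _ coassoc_balr).
  under eq_tlift => a b do rewrite (tlift_deltaR _ (pure3_bal b)).
  rewrite (coassoc_tri wb (G := fun a b c => a ⊗ (b ⊗ c) : T3R)).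
    apply: eq_tlift => a b; rewrite /wh_deltaR.
    by rewrite (raddf_tlift _ _ (tpureDr _ _ a)).
  have [p1 p2 p3] := pure_kbal.
  split=> [b c x y|a c x y|a b x y|c x y z|c x y z]; rewrite ?tpureDl ?tpureDr ?tpureDr //.
  - have [_ _] := Rbal_kbal (pure3_bal z); exact.
  - by congr (_ ⊗ _); exact: p3.
- move=> h; rewrite tlift_deltaR.
    rewrite -[RHS](wb_counitl wb) -[in RHS](kmul1r h) (deltaM_bi wb); last first.
      split=> [n x y|m x y|m i n]; rewrite /klact /kract.
      + by rewrite (wb_epsD wb) scalerDl.
      + by rewrite scalerDr.
      + by rewrite (wb_epsZ wb) scalerA mulrC.
    rewrite tlift_exchange; apply: eq_tlift => a b.
    rewrite /lres /= /wh_s /= /Pi_L /PiL kmulSl; apply: eq_tlift => c d.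
    by rewrite kmulZl.
  split=> [n x y|m x y|m i n]; rewrite /lres /=.
  + by rewrite /wh_s /= /Pi_L PD kmulDl.
  + by rewrite kmulDr.
  rewrite /wh_s /= /rres wh_tE /Pi_L (PiL_mul_tau wb) Pi_base.
  by rewrite kmulA.
- move=> h; rewrite tlift_deltaR.
    rewrite -[RHS](wb_counitr wb) -[in RHS](kmul1r h) (deltaM_bi wb); last first.
      split=> [n x y|m x y|m i n]; rewrite /klact /kract.
      + by rewrite scalerDr.
      + by rewrite (wb_epsD wb) scalerDl.
      + by rewrite (wb_epsZ wb) scalerA mulrC.
    rewrite tlift_exchange; apply: eq_tlift => a b.
    rewrite /rres wh_tE /wh_s /= (PiLbar_PiL wb) /PiLbar kmulSl.
    by apply: eq_tlift => c d; rewrite kmulZl.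
  split=> [n x y|m x y|m i n].
  + by rewrite /rres kmulDr.
  + rewrite /rres !wh_tE /wh_s /= /Pi_L PD.
    by rewrite (linD (PiLbar_linear wb)) kmulDl.
  rewrite /rres kmulA -wh_tM; congr (wh_t _ ∙ _).
  by apply: val_inj => /=; rewrite /lres -(Pi_base i) /Pi_L (PiL_mull wb) Pi_base.
Qed.

Lemma counitr_bal : balanced ra la (fun a b => ra a (Pi_R b)).
Proof.
split=> [n x y|m x y|m i n].
- by rewrite /rres kmulDr.
- rewrite /rres !wh_tE /wh_s /= /Pi_L (PiLD wb).
  by rewrite (linD (PiLbar_linear wb)) kmulDl.
rewrite /rres kmulA -wh_tM; congr (wh_t _ ∙ _).
by apply: val_inj; rewrite /= /lres -(Pi_base i) /Pi_L (PiL_mull wb) Pi_base.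
Qed.

Lemma wh_deltaR1 : wh_deltaR 𝟙 = 𝟙 ⊗ 𝟙.
Proof.
have := congr1 (tlift (fun a b => a ⊗ b : TR)) (delta1_PiL wb 𝟙).
rewrite !tlift_tlift; try exact: pure_kbal.
rewrite (PiL1 wb) => e.
transitivity (\sw_(a, b <- delta 𝟙) (a ⊗ PiL delta eps b : TR)).
  transitivity (\sw_(a, b <- delta 𝟙) (a ⊗ (b ∙ 𝟙) : TR)).
    by apply: eq_tlift => a b; rewrite kmulr1.
  by rewrite -e; apply: eq_tlift => a b; rewrite kmulr1.
have c := coring_counitr wh_coring 𝟙.
rewrite (tlift_deltaR _ counitr_bal) in c.
rewrite -[X in _ = X ⊗ _]c.
rewrite (raddf_tlift (g := fun x : H => x ⊗ 𝟙 : TR)); last first.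
  by move=> x y; rewrite tpureDl.
apply: eq_tlift => a b.
by rewrite (tpure_bal ra la) /lres kmulr1.
Qed.

Lemma wh_deltaRM g h :
  wh_deltaR (g ∙ h) = tmul kmul kmul (wh_deltaR g) (wh_deltaR h).
Proof.
rewrite /tmul tlift_exchange.
have B1 c d : balanced ra la (fun a b => a ∙ c ⊗ (b ∙ d) : TR).
  split=> [n x y|m x y|m i n]; first by rewrite kmulDl tpureDl.
    by rewrite kmulDl tpureDr.
  by rewrite ract_assoc /lres kmulA.
under eq_tlift => c d do rewrite (tlift_deltaR _ (B1 c d)).
rewrite tlift_deltaR; last first.
  split=> [n x y|m x y|m i n].
  - rewrite -tlift_add; apply: eq_tlift => a b.
    by rewrite kmulDr tpureDl.
  - rewrite -tlift_add; apply: eq_tlift => a b.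
    by rewrite kmulDr tpureDr.
  have B2 := Rbal_kbal (B1 m n).
  have := congr1 (tlift (fun a b => a ∙ m ⊗ (b ∙ n) : TR))
    (takeuchi_delta wb g (wh_s i)).
  rewrite !tlift_tlift // Pi_base -wh_tE => e.
  transitivity (\sw_(a, b <- delta g) (a ∙ wh_t i ∙ m ⊗ (b ∙ n) : TR)).
    by apply: eq_tlift => a b; rewrite /rres kmulA.
  by rewrite e; apply: eq_tlift => a b; rewrite /lres kmulA.
rewrite [LHS](deltaM_bi wb _ _ pure_kbal); exact: tlift_exchange.
Qed.

Lemma wh_is_bialgebroid : is_bialgebroid wh_deltaR (@Pi_R k H).
Proof.
split.
- exact: wh_s_morph.
- exact: wh_t_linear.
- exact: wh_t1.
- exact: wh_tM.
- exact: wh_st_comm.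
- exact: wh_coring.
- exact: wh_takeuchi.
- exact: wh_deltaR1.
- exact: wh_deltaRM.
- by apply: val_inj; apply: (PiL1 wb).
- by move=> g h; apply: val_inj; rewrite /= /wh_s /= /Pi_L (PiLM wb).
move=> g h; apply: val_inj; rewrite /= wh_tE /wh_s /= /Pi_L (PiLbar_PiL wb).
rewrite /PiL; apply: eq_tlift => a b.
by rewrite !kmulA (eps_PiLbar wb).
Qed.

Definition wh_bialgebroid : bialgebroid R := Bialgebroid wh_is_bialgebroid.

End WeakHopfBialgebroid.

Record category := Category {
  ob :> Type;
  hom : ob -> ob -> Type;
  idm : forall X, hom X X;
  comp : forall X Y Z, hom Y Z -> hom X Y -> hom X Z;
  comp1m : forall X Y (f : hom X Y), comp (idm Y) f = f;
  compm1 : forall X Y (f : hom X Y), comp f (idm X) = f;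
  compmA : forall X Y Z T (h : hom Z T) (g : hom Y Z) (f : hom X Y),
    comp h (comp g f) = comp (comp h g) f
}.

Record functor (C D : category) := Functor {
  fob :> C -> D;
  fmap : forall X Y : C, hom X Y -> hom (fob X) (fob Y);
  fmap1 : forall X, fmap (idm X) = idm (fob X);
  fmapM : forall X Y Z (g : hom Y Z) (f : hom X Y),
    fmap (comp g f) = comp (fmap g) (fmap f)
}.

Section Functors.

Definition functor_id (C : category) : functor C C :=
  @Functor C C id (fun X Y f => f) (fun _ => erefl) (fun _ _ _ _ _ => erefl).

Variables (C D E : category) (G : functor D E) (F : functor C D).

Lemma functor_comp1 X : fmap G (fmap F (idm X)) = idm (G (F X)).
Proof. by rewrite !fmap1. Qed.

Lemma functor_compM X Y Z (g : hom Y Z) (f : hom X Y) :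
  fmap G (fmap F (comp g f)) = comp (fmap G (fmap F g)) (fmap G (fmap F f)).
Proof. by rewrite !fmapM. Qed.

Definition functor_comp : functor C E :=
  @Functor C E (fun X => G (F X)) (fun X Y f => fmap G (fmap F f))
    functor_comp1 functor_compM.

End Functors.

Definition is_isofunctor (C D : category) (F : functor C D) : Prop :=
  exists G : functor D C,
    functor_comp G F = functor_id C /\ functor_comp F G = functor_id D.

Definition isomorphic_categories (C D : category) : Prop :=
  exists F : functor C D, is_isofunctor F.

(* The category of structured sets whose morphisms are the maps satisfying
   [P]. *)
Section ConcreteCategory.
Variables (O : Type) (car : O -> Type).
Variable P : forall X Y : O, (car X -> car Y) -> Prop.
Hypothesis P1 : forall X, P (X := X) (Y := X) id.
Hypothesis PM : forall X Y Z (g : car Y -> car Z) (f : car X -> car Y),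
  P g -> P f -> P (g \o f).

Definition chom (X Y : O) : Type := {f : car X -> car Y | P f}.

Definition cid_hom X : chom X X := exist _ _ (P1 X).
Definition ccomp X Y Z (g : chom Y Z) (f : chom X Y) : chom X Z :=
  exist _ _ (PM (svalP g) (svalP f)).

Lemma chomP X Y (f g : chom X Y) : sval f = sval g -> f = g.
Proof.
by case: f g => f p [g q] /= e; subst g; rewrite (Prop_irrelevance p q).
Qed.

Lemma ccomp1m X Y (f : chom X Y) : ccomp (cid_hom Y) f = f.
Proof. exact: chomP. Qed.
Lemma ccompm1 X Y (f : chom X Y) : ccomp f (cid_hom X) = f.
Proof. exact: chomP. Qed.
Lemma ccompA X Y Z T (h : chom Z T) (g : chom Y Z) (f : chom X Y) :
  ccomp h (ccomp g f) = ccomp (ccomp h g) f.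
Proof. exact: chomP. Qed.

Definition concrete_category : category :=
  @Category O chom cid_hom ccomp ccomp1m ccompm1 ccompA.

End ConcreteCategory.

Section ProductCategory.
Variables C D : category.

Definition phom (X Y : C * D) : Type := (hom X.1 Y.1 * hom X.2 Y.2)%type.
Definition pid X : phom X X := (idm X.1, idm X.2).
Definition pcomp X Y Z (g : phom Y Z) (f : phom X Y) : phom X Z :=
  (comp g.1 f.1, comp g.2 f.2).

Lemma pcomp1m X Y (f : phom X Y) : pcomp (pid Y) f = f.
Proof. by case: f => f g; rewrite /pcomp !comp1m. Qed.
Lemma pcompm1 X Y (f : phom X Y) : pcomp f (pid X) = f.
Proof. by case: f => f g; rewrite /pcomp !compm1. Qed.
Lemma pcompA X Y Z T (h : phom Z T) (g : phom Y Z) (f : phom X Y) :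
  pcomp h (pcomp g f) = pcomp (pcomp h g) f.
Proof. by rewrite /pcomp !compmA. Qed.

Definition product_category : category :=
  @Category (C * D)%type phom pid pcomp pcomp1m pcompm1 pcompA.

End ProductCategory.

Lemma tmap_id I (M N : zmodType) ra la (t : @tens I M N ra la) :
  tmap id id t = t.
Proof. exact: tlift_id. Qed.

Lemma tmap_comp I (M N : zmodType) ra la I' (M' N' : zmodType) ra' la'
    (M'' N'' : zmodType) ra'' la'' (f : M -> M') (g : N -> N')
    (f' : M' -> M'') (g' : N' -> N'') (t : @tens I M N ra la) :
  {morph f' : x y / x + y} -> {morph g' : x y / x + y} ->
  (forall m i, f' (ra' m i) = ra'' (f' m) i) ->
  (forall i n, g' (la' i n) = la'' i (g' n)) ->
  tmap f' g' (tmap f g t : tens ra' la')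
  = tmap (f' \o f) (g' \o g) t :> @tens I' M'' N'' ra'' la''.
Proof.
move=> fD gD fb gb; rewrite /tmap tlift_tlift //.
split=> [n x y|m x y|m i n].
- by rewrite fD tpureDl.
- by rewrite gD tpureDr.
- by rewrite fb gb tpure_bal.
Qed.

Lemma linear_comp (k : comPzRingType) (U V W : lmodType k)
    (g : V -> W) (f : U -> V) : linear g -> linear f -> linear (g \o f).
Proof. by move=> gl fl c x y /=; rewrite fl gl. Qed.

Lemma algmorph_id (k : comPzRingType) (A : kalgType k) :
  @is_algmorph k A A id.
Proof. by []. Qed.

Lemma algmorph_comp (k : comPzRingType) (A B C : kalgType k)
    (g : B -> C) (f : A -> B) :
  is_algmorph g -> is_algmorph f -> is_algmorph (g \o f).
Proof.
case=> gl g1 gM [fl f1 fM]; split=> [||x y] /=.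
- exact: linear_comp.
- by rewrite f1 g1.
- by rewrite fM gM.
Qed.

Section WeakDoiKoppinen.
Variables (k : comPzRingType) (H : weakHopf k).

Record wcomod_algebra := WComodAlgebra {
  wca_alg :> kalgType k;
  wca_rho : wca_alg -> tensk H wca_alg;
  wca_comod : is_comodule (@wh_delta k H) (@wh_eps k H) wca_rho;
  wca_rhoM : forall a b,
    tmul kmul kmul (wca_rho a) (wca_rho b) = wca_rho (a ∙ b);
  wca_rho1 :
    \sw_(h, a <- wca_rho 𝟙) (h ⊗ wca_rho a)
    = \sw_(e, f <- wh_delta 𝟙) \sw_(h, a <- wca_rho 𝟙) (e ⊗ (h ∙ f ⊗ a))
    :> tens3 klact kract klact
}.

Definition wca_hom (A B : wcomod_algebra) (f : A -> B) : Prop :=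
  is_algmorph f /\ forall a, wca_rho (f a) = tmap id f (wca_rho a).

Lemma wca_hom1 (A : wcomod_algebra) : @wca_hom A A id.
Proof. by split=> [|a]; [exact: algmorph_id | rewrite tmap_id]. Qed.

Lemma wca_homM (A B C : wcomod_algebra) (g : B -> C) (f : A -> B) :
  wca_hom g -> wca_hom f -> wca_hom (g \o f).
Proof.
case=> ga gr [fa fr]; split=> [|a]; first exact: algmorph_comp.
have [gl _ _] := ga.
rewrite /= gr fr tmap_comp //; first exact: linD.
by move=> c x; exact: linZ.
Qed.

Definition WCA : category := concrete_category wca_hom1 wca_homM.

Record wmod_coalgebra := WModCoalgebra {
  wmc_mod :> lmodType k;
  wmc_act : H -> wmc_mod -> wmc_mod;
  wmc_delta : wmc_mod -> tensk wmc_mod wmc_mod;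
  wmc_eps : wmc_mod -> k^o;
  wmc_module : is_module wmc_act;
  wmc_coalg : is_coalgebra wmc_delta wmc_eps;
  wmc_deltaM : forall h c,
    wmc_delta (wmc_act h c)
    = \sw_(h1, h2 <- wh_delta h) \sw_(c1, c2 <- wmc_delta c)
        (wmc_act h1 c1 ⊗ wmc_act h2 c2);
  wmc_epsM : forall h g c,
    wmc_eps (wmc_act (h ∙ g) c)
    = \sw_(g1, g2 <- wh_delta g) (wh_eps (h ∙ g2) * wmc_eps (wmc_act g1 c))
}.

Definition wmc_hom (C D : wmod_coalgebra) (f : C -> D) : Prop :=
  [/\ linear f,
      forall h c, f (wmc_act h c) = wmc_act h (f c),
      forall c, wmc_delta (f c) = tmap f f (wmc_delta c)
    & forall c, wmc_eps (f c) = wmc_eps c].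

Lemma wmc_hom1 (C : wmod_coalgebra) : @wmc_hom C C id.
Proof. by split=> // c; rewrite tmap_id. Qed.

Lemma wmc_homM (C D E : wmod_coalgebra) (g : D -> E) (f : C -> D) :
  wmc_hom g -> wmc_hom f -> wmc_hom (g \o f).
Proof.
case=> gl ga gd ge [fl fa fd fe]; split=> [|h c|c|c] /=.
- exact: linear_comp.
- by rewrite fa ga.
- rewrite gd fd tmap_comp //; try exact: linD.
  + by move=> c' x; exact: linZ.
  + by move=> c' x; exact: linZ.
- by rewrite ge fe.
Qed.

Definition WMC : category := concrete_category wmc_hom1 wmc_homM.

Definition WDK : category := product_category WCA WMC.

Section Modules.
Variables (A : wcomod_algebra) (C : wmod_coalgebra).

Record wdk_module := WDKModule {
  wdm_mod :> lmodType k;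
  wdm_act : A -> wdm_mod -> wdm_mod;
  wdm_rho : wdm_mod -> tensk C wdm_mod;
  wdm_module : is_module wdm_act;
  wdm_comod : is_comodule (@wmc_delta C) (@wmc_eps C) wdm_rho;
  wdm_rhoM : forall a m,
    wdm_rho (wdm_act a m)
    = \sw_(h, b <- wca_rho a) \sw_(c, n <- wdm_rho m)
        (wmc_act h c ⊗ wdm_act b n)
}.

Definition wdm_hom (M N : wdk_module) (f : M -> N) : Prop :=
  [/\ linear f,
      forall a m, f (wdm_act a m) = wdm_act a (f m)
    & forall m, wdm_rho (f m) = tmap id f (wdm_rho m)].

Lemma wdm_hom1 (M : wdk_module) : @wdm_hom M M id.
Proof. by split=> // m; rewrite tmap_id. Qed.

Lemma wdm_homM (M N P : wdk_module) (g : N -> P) (f : M -> N) :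
  wdm_hom g -> wdm_hom f -> wdm_hom (g \o f).
Proof.
case=> gl ga gr [fl fa fr]; split=> [|a m|m] /=.
- exact: linear_comp.
- by rewrite fa ga.
rewrite gr fr tmap_comp //; first exact: linD.
by move=> c x; exact: linZ.
Qed.

End Modules.

Definition WDKMod (X : WDK) : category :=
  concrete_category (@wdm_hom1 X.1 X.2) (@wdm_homM X.1 X.2).

End WeakDoiKoppinen.

Section DoiKoppinen.
Variables (k : comPzRingType) (R : kalgType k) (H : bialgebroid R).

Local Notation s := (@bg_s k R H).
Local Notation t := (@bg_t k R H).
Local Notation delta := (@bg_delta k R H).
Local Notation eps := (@bg_eps k R H).

Record comod_algebra := ComodAlgebra {
  ca_alg :> kalgType k;
  ca_s : R -> ca_alg;
  ca_rho : ca_alg -> tens (rres t kmul) (lres ca_s kmul);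
  ca_s_morph : is_algmorph ca_s;
  ca_comod : is_comodule delta eps ca_rho;
  ca_takeuchi : forall a, in_takeuchi (ca_rho a);
  ca_rho1 : ca_rho 𝟙 = 𝟙 ⊗ 𝟙;
  ca_rhoM : forall a b, ca_rho (a ∙ b) = tmul kmul kmul (ca_rho a) (ca_rho b)
}.

Definition ca_hom (A B : comod_algebra) (f : A -> B) : Prop :=
  [/\ is_algmorph f,
      forall r, f (ca_s A r) = ca_s B r
    & forall a, ca_rho (f a) = tmap id f (ca_rho a)].

Lemma ca_hom1 (A : comod_algebra) : @ca_hom A A id.
Proof. by split=> [|//|a]; [exact: algmorph_id | rewrite tmap_id]. Qed.

Lemma ca_homM (A B C : comod_algebra) (g : B -> C) (f : A -> B) :
  ca_hom g -> ca_hom f -> ca_hom (g \o f).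
Proof.
case=> ga gs gr [fa fs fr]; split=> [|r|a] /=.
- exact: algmorph_comp.
- by rewrite fs gs.
have [gl _ gM] := ga.
rewrite gr fr tmap_comp //; first exact: linD.
by move=> r x; rewrite /lres gM gs.
Qed.

Definition CA : category := concrete_category ca_hom1 ca_homM.

Record mod_coalgebra := ModCoalgebra {
  mc_mod :> lmodType k;
  mc_act : H -> mc_mod -> mc_mod;
  mc_delta : mc_mod -> tens (rres t mc_act) (lres s mc_act);
  mc_eps : mc_mod -> R;
  mc_module : is_module mc_act;
  mc_coring : is_coring mc_delta mc_eps;
  mc_deltaM : forall h c,
    mc_delta (mc_act h c)
    = \sw_(h1, h2 <- delta h) \sw_(c1, c2 <- mc_delta c)
        (mc_act h1 c1 ⊗ mc_act h2 c2);
  mc_epsM : forall h c, mc_eps (mc_act h c) = eps (h ∙ s (mc_eps c))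
}.

Definition mc_hom (C D : mod_coalgebra) (f : C -> D) : Prop :=
  [/\ linear f,
      forall h c, f (mc_act h c) = mc_act h (f c),
      forall c, mc_delta (f c) = tmap f f (mc_delta c)
    & forall c, mc_eps (f c) = mc_eps c].

Lemma mc_hom1 (C : mod_coalgebra) : @mc_hom C C id.
Proof. by split=> // c; rewrite tmap_id. Qed.

Lemma mc_homM (C D E : mod_coalgebra) (g : D -> E) (f : C -> D) :
  mc_hom g -> mc_hom f -> mc_hom (g \o f).
Proof.
case=> gl ga gd ge [fl fa fd fe]; split=> [|h c|c|c] /=.
- exact: linear_comp.
- by rewrite fa ga.
- rewrite gd fd tmap_comp //; try exact: linD.
  + by move=> m r; rewrite /rres ga.
  + by move=> r m; rewrite /lres ga.
- by rewrite ge fe.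
Qed.

Definition MC : category := concrete_category mc_hom1 mc_homM.

Definition DK : category := product_category CA MC.

Section Modules.
Variables (A : comod_algebra) (C : mod_coalgebra).

Record dk_module := DKModule {
  dm_mod :> lmodType k;
  dm_act : A -> dm_mod -> dm_mod;
  dm_rho : dm_mod -> tens (rres t (@mc_act C)) (lres (ca_s A) dm_act);
  dm_module : is_module dm_act;
  dm_comod : is_comodule (@mc_delta C) (@mc_eps C) dm_rho;
  dm_rhoM : forall a m,
    dm_rho (dm_act a m)
    = \sw_(h, b <- ca_rho a) \sw_(c, n <- dm_rho m)
        (mc_act h c ⊗ dm_act b n)
}.

Definition dm_hom (M N : dk_module) (f : M -> N) : Prop :=
  [/\ linear f,
      forall a m, f (dm_act a m) = dm_act a (f m)
    & forall m, dm_rho (f m) = tmap id f (dm_rho m)].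

Lemma dm_hom1 (M : dk_module) : @dm_hom M M id.
Proof. by split=> // m; rewrite tmap_id. Qed.

Lemma dm_homM (M N P : dk_module) (g : N -> P) (f : M -> N) :
  dm_hom g -> dm_hom f -> dm_hom (g \o f).
Proof.
case=> gl ga gr [fl fa fr]; split=> [|a m|m] /=.
- exact: linear_comp.
- by rewrite fa ga.
rewrite gr fr tmap_comp //; first exact: linD.
by move=> r x; rewrite /lres ga.
Qed.

End Modules.

Definition DKMod (X : DK) : category :=
  concrete_category (@dm_hom1 X.1 X.2) (@dm_homM X.1 X.2).

End DoiKoppinen.

(* Main.v *)
(* Write [delta 𝟙] as a sum of [e ⊗ r] with [r] in the base [R].  Since
   [t r ∙ e] sums to [𝟙], the projection of [C ⊗_k N] onto [C ⊗_R N] has the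
   section [c ⊗ n |-> e c ⊗ r n], whose image is the set of tensors fixed by
   [delta 𝟙].  The coproducts and coactions of all weak structures take values
   in this image, so composing with the projection and with its section are
   mutually inverse, and each axiom over [k] is equivalent to the axiom over
   [R].  The counits correspond by [eps_R c = eps (e c) r] and
   [eps c = eps_H (eps_R c)], and the source map of a weak comodule algebra is
   [r |-> eps (1_<-1> r) 1_<0>].  Carriers, algebra structures and actions do
   not change, hence neither do the underlying maps of morphisms. *)

From HB Require Import structures.
From mathcomp Require Import all_boot all_order all_algebra.
From mathcomp Require Import boolp.
Require Import Defs.

Set Implicit Arguments.
Unset Strict Implicit.
Unset Printing Implicit Defensive.

Import GRing.Theory.
Local Open Scope ring_scope.

(** * Bilinear maps and the tensor [delta 𝟙] *)

(** An isomorphism of categories asks for functors that are inverse on the nose, so a weak coaction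
    must be recovered exactly from its image over [R]. The section does this canonically, and it
    respects the quotient because [e ∙ t r' ⊗ r = e ⊗ r ∙ r']. Weak structures are fixed by
    [delta 𝟙] because every [x] is [𝟙] acting on [x]: compatibility with the action then produces
    the factor [delta 𝟙], or [rho 𝟙] over a comodule algebra, which the weak unit axiom identifies
    with [e ⊗ sA r]. Coassociativity is the main obstacle, as it lives in triple tensor products:
    its left side comes with a single factor [delta 𝟙], while two are needed to lift from [R]. The
    weak axiom for [delta] applied to a leg of [delta 𝟙] splits that factor into two. *)

Notation kbal := (balanced kract klact).

Section ModuleFacts.
Variables (k : comPzRingType) (A : kalgType k) (M : lmodType k).
Variables (act : A -> M -> M) (actP : is_module act).

Lemma modDl a b m : act (a + b) m = act a m + act b m.
Proof. by have [_ l _ _] := actP; apply: (linD (l m)). Qed.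

Lemma modDr a m n : act a (m + n) = act a m + act a n.
Proof. by have [l _ _ _] := actP; apply: (linD (l a)). Qed.

Lemma modZl (c : k) a m : act (c *: a) m = c *: act a m.
Proof. by have [_ l _ _] := actP; apply: (linZ (l m)). Qed.

Lemma modZr (c : k) a m : act a (c *: m) = c *: act a m.
Proof. by have [l _ _ _] := actP; apply: (linZ (l a)). Qed.

Lemma mod1 m : act 𝟙 m = m.
Proof. by have [_ _ l _] := actP. Qed.

Lemma modM a b m : act (a ∙ b) m = act a (act b m).
Proof. by have [_ _ _ l] := actP. Qed.

Lemma lres_module (B : kalgType k) (f : B -> A) :
  is_algmorph f -> is_module (lres f act).
Proof.
case=> fl f1 fM; split=> [b c x y|m c a b|m|a b m]; rewrite /lres.
- by rewrite modDr modZr.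
- by rewrite (linD fl) (linZ fl) modDl modZl.
- by rewrite f1 mod1.
- by rewrite fM modM.
Qed.

End ModuleFacts.

Lemma kmul_module (k : comPzRingType) (A : kalgType k) : is_module (@kmul k A).
Proof.
split=> [a|m|m|a b m]; [exact: kmul_linr|exact: kmul_linl|exact: kmul1r|].
by rewrite kmulA.
Qed.

Lemma klact_module (k : comPzRingType) (M : lmodType k) : is_module (@klact k M).
Proof.
split=> [a c x y|m c x y|m|a b m]; rewrite /klact.
- by rewrite scalerDr !scalerA mulrC.
- by rewrite scalerDl scalerA.
- exact: scale1r.
- by rewrite scalerA.
Qed.

(* Scalars are moved to the first factor of a tensor. *)
Ltac lin :=
  rewrite /klact /kract /lres /rres;
  repeat (progress (
    rewrite ?(kmulDl, kmulDr, kmulZl, kmulZr, tpureDl, tpureDr, tpureZ,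
      scalerDl, scalerDr, scalerA, mulrDl, mulrDr, mulrA);
    repeat match goal with
    | P : is_module _ |- _ =>
        progress rewrite ?(modDl P) ?(modDr P) ?(modZl P) ?(modZr P)
    end)).

Ltac linC := lin; try done; try (by rewrite mulrC ?mulrA);
  try (by rewrite mulrAC); try (by rewrite -mulrA mulrC).

Ltac kb := split; intros ? ? ?; cbv beta;
  repeat (rewrite -?tlift_add; apply: eq_tlift => ? ?); linC.

Ltac bi := split; intros ? ? ?; cbv beta; rewrite /klact /kract.

Section BilinearFacts.
Variable k : comPzRingType.

Lemma kbal_pure (M N : lmodType k) :
  kbal (fun (m : M) (n : N) => m ⊗ n : tensk M N).
Proof. exact: tpure_balanced. Qed.

Lemma kbal_comp (M N M' N' : lmodType k) (P : zmodType) (F : M' -> N' -> P)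
    (f : M -> M') (g : N -> N') :
  kbal F -> linear f -> linear g -> kbal (fun m n => F (f m) (g n)).
Proof.
case=> F1 F2 F3 fl gl; split=> [n x y|m x y|m c n].
- by rewrite (linD fl) F1.
- by rewrite (linD gl) F2.
- by rewrite /kract (linZ fl) F3 /klact (linZ gl).
Qed.

Lemma tlift_eq I (M N : zmodType) ra la I1 (M1 N1 : zmodType) ra1 la1
    I2 (M2 N2 : zmodType) ra2 la2 (P : zmodType) (F : M -> N -> P)
    (u : @tens I1 M1 N1 ra1 la1) (v : @tens I2 M2 N2 ra2 la2) f1 g1 f2 g2 :
  balanced ra la F ->
  \sw_(a, b <- u) (f1 a b ⊗ g1 a b)
    = \sw_(a, b <- v) (f2 a b ⊗ g2 a b) :> @tens I M N ra la ->
  \sw_(a, b <- u) F (f1 a b) (g1 a b) = \sw_(a, b <- v) F (f2 a b) (g2 a b).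
Proof. by move=> FB /(congr1 (tlift F)); rewrite !(tlift_tlift _ _ _ FB). Qed.

Lemma pure_sumr I (M N : zmodType) ra la J (M' N' : zmodType) ra' la'
    (t : @tens I M N ra la) (x : M') (F : M -> N -> N') :
  x ⊗ (\sw_(a, b <- t) F a b) = \sw_(a, b <- t) (x ⊗ F a b)
  :> @tens J M' N' ra' la'.
Proof. exact: (raddf_tlift _ _ (tpureDr _ _ x)). Qed.

Lemma pure_suml I (M N : zmodType) ra la J (M' N' : zmodType) ra' la'
    (t : @tens I M N ra la) (x : N') (F : M -> N -> M') :
  (\sw_(a, b <- t) F a b) ⊗ x = \sw_(a, b <- t) (F a b ⊗ x)
  :> @tens J M' N' ra' la'.
Proof. exact: (raddf_tlift _ _ (fun y z => tpureDl _ _ y z x)). Qed.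

Definition trilinear (X Y Z : lmodType k) (P : zmodType) (G : X -> Y -> Z -> P) :=
  [/\ forall y z, {morph (fun x => G x y z) : a b / a + b},
      forall x, kbal (G x)
    & forall z, kbal (fun x y => G x y z)].

Lemma trilinear_bal (X Y Z : lmodType k) (P : zmodType) (G : X -> Y -> Z -> P) :
  trilinear G ->
  balanced kract (tlact klact)
    (fun a (u : tensk Y Z) => \sw_(b, c <- u) G a b c).
Proof.
case=> G1 G2 G3; split=> [u x y|a u v|a c u].
- by rewrite -tlift_add; apply: eq_tlift => b d; rewrite G1.
- by rewrite (tliftD (G2 a)).
rewrite /tlact /tmap tlift_tlift //.
by apply: eq_tlift => b d; have [_ _ ->] := G3 d.
Qed.

Lemma tens3_bal (X Z : lmodType k) (z : Z) :
  kbal (fun (x y : X) => x ⊗ (y ⊗ z) : tens3 klact kract klact).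
Proof.
split=> [y x x'|x y y'|x c y]; rewrite ?tpureDl ?tpureDr //.
rewrite (tpure_bal kract (tlact klact)); congr (_ ⊗ _).
by rewrite /tlact /tmap tlift_pure //; kb.
Qed.

End BilinearFacts.

Lemma trilin_trilinear (k : comPzRingType) (H : kalgType k) (P : zmodType)
    (G : H -> H -> H -> P) :
  trilinear G -> trilin G.
Proof.
case=> G1 G2 G3; split=> [b c|a c|a b|c x y z|c x y z].
- exact: G1.
- by have [+ _ _] := G2 a; apply.
- by have [_ + _] := G2 a; apply.
- by have [_ _] := G3 z; apply.
- by have [_ _] := G2 x; apply.
Qed.

Section UnitTensor.
Variables (k : comPzRingType) (H : weakHopf k).
Hypothesis antipode_bij : bijective (@antipode k H).

Local Notation R := (base H).
Local Notation delta := (@wh_delta k H).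
Local Notation eps := (@wh_eps k H).
Local Notation wb := (wh_bialg H).
Local Notation s := (@wh_s k H).
Local Notation t := (wh_t antipode_bij).

Lemma Pi_R_linear : linear (@Pi_R k H).
Proof. by move=> c x y; apply: val_inj; apply: (PiL_linear wb). Qed.

Lemma Pi_R_s r : Pi_R (s r) = r.
Proof. by apply: val_inj; apply: Pi_base. Qed.

Definition base_delta1 : tensk H R := \sw_(e, f <- delta 𝟙) (e ⊗ Pi_R f).
Local Notation D := base_delta1.

Lemma kbal_Pi_R (P : zmodType) (F : H -> R -> P) : kbal F ->
  kbal (fun e f => F e (Pi_R f)).
Proof. by move=> FB; apply: (kbal_comp FB) => //; exact: Pi_R_linear. Qed.

Lemma kbal_s (P : zmodType) (F : H -> H -> P) : kbal F ->
  kbal (fun e r => F e (s r)).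
Proof. by move=> FB; apply: (kbal_comp FB). Qed.

Lemma tlift_base_delta1 (P : zmodType) (F : H -> R -> P) : kbal F ->
  tlift F D = \sw_(e, f <- delta 𝟙) F e (Pi_R f).
Proof. by move=> FB; rewrite tlift_tlift. Qed.

(** [delta1_PiL] at [𝟙] gives [e ⊗ Pi f = e ⊗ f], so typing the second leg of [delta 𝟙] in the base
    loses nothing. *)
Lemma tlift_delta1 (P : zmodType) (F : H -> H -> P) : kbal F ->
  \sw_(e, r <- D) F e (s r) = tlift F (delta 𝟙).
Proof.
move=> FB; rewrite tlift_base_delta1; last exact: kbal_s.
have := congr1 (tlift F) (delta1_PiL wb 𝟙).
rewrite !tlift_tlift // (PiL1 wb) => e.
transitivity (\sw_(a, b <- delta 𝟙) F a (PiL delta eps (b ∙ 𝟙))).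
  by apply: eq_tlift => a b; rewrite kmulr1.
by rewrite e; apply: eq_tlift => a b; rewrite kmulr1.
Qed.

(** The Takeuchi property of [delta 𝟙]; it makes [base_lift] compatible with the balancing over the
    base. *)
Lemma base_delta1_t (P : zmodType) (F : H -> R -> P) r' : kbal F ->
  \sw_(e, r <- D) F (e ∙ t r') r = \sw_(e, r <- D) F e (r ∙ r').
Proof.
move=> FB; have FP := kbal_Pi_R FB.
have Hl := kmul_linl (s r').
rewrite (tlift_base_delta1 (kbal_comp FB (kmul_linl (t r')) _)) //.
have := congr1 (tlift (fun e f => F e (Pi_R f))) (takeuchi_delta wb 𝟙 (s r')).
rewrite !(tlift_tlift _ _ _ FP) Pi_base -wh_tE => ->.
have FR := kbal_comp FP (f := id) (fun _ _ _ => erefl) Hl.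
rewrite -(tlift_delta1 FR).
by apply: eq_tlift => e r; congr F; apply: val_inj; apply: Pi_base (r ∙ r').
Qed.

(** Both sides evaluate [delta (s r')], obtained from [delta 𝟙] by multiplying on either side. Hence
    [base_lift] is left linear over the base. *)
Lemma base_delta1_comm (P : zmodType) (F : H -> R -> P) r' : kbal F ->
  \sw_(e, r <- D) F (e ∙ s r') r = \sw_(e, r <- D) F (s r' ∙ e) r.
Proof.
move=> FB; have FP := kbal_Pi_R FB.
rewrite tlift_base_delta1; last first.
  by apply: (kbal_comp FB) => //; apply: kmul_linl.
rewrite tlift_base_delta1; last first.
  by apply: (kbal_comp FB) => //; apply: kmul_linr.
have := delta_PiL_l wb (s r'); rewrite (delta_PiL_r wb) Pi_base.
by move/(congr1 (tlift (fun e f => F e (Pi_R f)))); rewrite !tlift_tlift.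
Qed.

(** The right counit law of the coring [H] over the base, read at [𝟙]. *)
Lemma base_delta1_counit : \sw_(e, r <- D) (t r ∙ e) = 𝟙.
Proof.
rewrite tlift_base_delta1; last first.
  have tl := wh_t_linear antipode_bij.
  split=> [n x y|m x y|m c n]; rewrite ?(linD tl) /klact ?(linZ tl); linC.
rewrite -[RHS](coring_counitr (wh_coring antipode_bij)).
by rewrite (tlift_deltaR _ (counitr_bal antipode_bij)).
Qed.

(** Coassociativity and the weak unit axiom split one copy of [delta 𝟙] into the two that are needed
    to lift a triple tensor. *)
Lemma base_delta1_delta (P : zmodType) (G : H -> H -> R -> P) : trilinear G ->
  \sw_(e, r <- D) \sw_(e1, e2 <- delta e) G e1 e2 r
  = \sw_(e, r <- D) \sw_(e', r' <- D) G e (s r ∙ e') r'.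
Proof.
move=> Gt; have [G1 G2 G3] := Gt.
have Gt' : trilinear (fun a b c => G a b (Pi_R c)).
  split=> [y z|x|z]; [exact: G1|exact: kbal_Pi_R|exact: G3].
rewrite tlift_base_delta1; last first.
  split=> [n x y|m x y|m c n].
  - by rewrite (wb_deltaD wb) (tliftD (G3 n)).
  - by rewrite -tlift_add; apply: eq_tlift => a b; have [_ -> _] := G2 a.
  rewrite /kract (wb_deltaZ wb) tlift_tlift; last exact: G3.
  apply: eq_tlift => a b.
  by have [_ _ e1] := G3 n; have [_ _ e2] := G2 a; rewrite [LHS]e1 [LHS]e2.
have e1 := coassoc_tri wb 𝟙 (trilin_trilinear Gt').
have e2 := delta1l_tri wb (trilin_trilinear Gt').
rewrite [LHS]e1 [LHS]e2 -tlift_delta1.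
  apply: eq_tlift => e r; rewrite tlift_base_delta1 //.
  by apply: (kbal_comp (G2 e)) => //; apply: kmul_linr.
split=> [n x y|m x y|m c n]; rewrite -?tlift_add; apply: eq_tlift => a b.
- exact: G1.
- by rewrite kmulDl; have [-> _ _] := G2 m.
by rewrite kmulZl; have [_ _ e] := G3 (Pi_R b); rewrite [LHS]e.
Qed.

End UnitTensor.

(** * The section of the projection onto the tensor product over the base *)

Section BaseTensor.
Variables (k : comPzRingType) (H : weakHopf k).
Hypothesis antipode_bij : bijective (@antipode k H).

Local Notation R := (base H).
Local Notation delta := (@wh_delta k H).
Local Notation s := (@wh_s k H).
Local Notation t := (wh_t antipode_bij).
Local Notation D := (base_delta1 H).

Section Projection.
Variables (C : lmodType k) (act : H -> C -> C) (N : lmodType k).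
Variable la : R -> N -> N.
Hypotheses (actP : is_module act) (laP : is_module la).

Local Notation ra := (rres t act).
Local Notation TR := (tens ra la).

Definition base_proj (u : tensk C N) : TR := tmap id id u.

Definition base_lift (x : TR) : tensk C N :=
  \sw_(c, n <- x) \sw_(e, r <- D) (act e c ⊗ la r n).

(* Equivalently, [u] lies in the image of the section [base_lift] of
   [base_proj], that is, [u] is fixed by the action of [delta 𝟙]. *)
Definition unital (u : tensk C N) : Prop := base_lift (base_proj u) = u.

(** A scalar [c] acts as the element [c *: 𝟙] of the base. *)
Lemma balanced_kbal (P : zmodType) (F : C -> N -> P) :
  balanced ra la F -> kbal F.
Proof.
case=> F1 F2 F3; split=> // m c n.
have := F3 m ((c : k) *: 𝟙) n; rewrite /rres /lres.
rewrite (linZ (wh_t_linear antipode_bij)) wh_t1.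
by rewrite (modZl actP) (modZl laP) (mod1 actP) (mod1 laP).
Qed.

Lemma proj_bal : kbal (fun c n => c ⊗ n : TR).
Proof. exact/balanced_kbal/tpure_balanced. Qed.

Lemma tlift_proj (P : zmodType) (F : C -> N -> P) u :
  balanced ra la F -> tlift F (base_proj u) = tlift F u.
Proof. by move=> FB; rewrite tlift_tlift. Qed.

Lemma base_projD : {morph base_proj : u v / u + v}.
Proof. exact: (tliftD proj_bal). Qed.

Lemma base_proj_pure c n : base_proj (c ⊗ n) = c ⊗ n.
Proof. exact: (tlift_pure proj_bal). Qed.

Lemma base_projS I (M M' : zmodType) ra' la' (v : @tens I M M' ra' la') F :
  base_proj (\sw_(a, b <- v) F a b) = \sw_(a, b <- v) base_proj (F a b).
Proof. exact: (raddf_tlift _ _ base_projD). Qed.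

Lemma unit_act_bal c n : kbal (fun e r => act e c ⊗ la r n : tensk C N).
Proof. by kb. Qed.

Lemma base_lift_bal :
  balanced ra la (fun c n => \sw_(e, r <- D) (act e c ⊗ la r n) : tensk C N).
Proof.
split=> [n x y|m x y|m i n]; rewrite -?tlift_add.
- by apply: eq_tlift => e r; lin.
- by apply: eq_tlift => e r; lin.
have := base_delta1_t antipode_bij i (unit_act_bal m n).
under eq_tlift => e r do rewrite (modM actP).
by move=> ->; apply: eq_tlift => e r; rewrite (modM laP).
Qed.

Lemma base_liftD : {morph base_lift : x y / x + y}.
Proof. exact: (tliftD base_lift_bal). Qed.

Lemma base_lift_proj u : base_lift (base_proj u)
  = \sw_(c, n <- u) \sw_(e, r <- D) (act e c ⊗ la r n).
Proof. exact: tlift_proj base_lift_bal. Qed.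

Lemma base_liftK x : base_proj (base_lift x) = x.
Proof.
rewrite base_projS -[RHS]tlift_id; apply: eq_tlift => c n.
rewrite base_projS.
transitivity (act (\sw_(e, r <- D) (t r ∙ e)) c ⊗ n : TR).
  rewrite (raddf_tlift _ _ (fun x y => modDl actP x y c)) pure_suml.
  apply: eq_tlift => e r; rewrite base_proj_pure -(tpure_bal ra la).
  by rewrite (modM actP).
by rewrite base_delta1_counit (mod1 actP).
Qed.

Lemma unital_lift x : unital (base_lift x).
Proof. by rewrite /unital base_liftK. Qed.

(** A unital tensor equals its translate by [delta 𝟙], so a bilinear expression in it may acquire or
    absorb a factor [e ⊗ r]. *)
Lemma tlift_unital (P : zmodType) (F : C -> N -> P) u : kbal F -> unital u ->
  \sw_(c, n <- u) \sw_(e, r <- D) F (act e c) (la r n) = tlift F u.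
Proof.
move=> FB uu; rewrite -[in RHS]uu base_lift_proj (raddf_tlift _ _ (tliftD FB)).
by apply: eq_tlift => c n; rewrite tlift_tlift.
Qed.

Lemma balanced_lact r : balanced ra la (fun c n => act (s r) c ⊗ n : TR).
Proof.
split=> [n x y|m x y|m i n]; try by lin.
by rewrite -(tpure_bal ra la) /rres -!(modM actP) wh_st_comm.
Qed.

Lemma kbal_lact r : kbal (fun c n => act (s r) c ⊗ n : tensk C N).
Proof. by kb. Qed.

Lemma base_lift_lact r x :
  base_lift (tmap (act (s r)) id x) = tmap (act (s r)) id (base_lift x).
Proof.
rewrite {1}/base_lift tlift_tlift; last exact: base_lift_bal.
rewrite [RHS](raddf_tlift _ _ (tliftD (kbal_lact r))).
apply: eq_tlift => c n; rewrite tlift_tlift; last exact: kbal_lact.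
have := base_delta1_comm r (unit_act_bal c n).
under eq_tlift => e i do rewrite (modM actP).
by move=> ->; apply: eq_tlift => e i; rewrite (modM actP).
Qed.

Lemma base_proj_lact r u :
  base_proj (tmap (act (s r)) id u) = tmap (act (s r)) id (base_proj u).
Proof.
rewrite [RHS](tlift_proj _ (balanced_lact r)) base_projS.
by apply: eq_tlift => c n; rewrite base_proj_pure.
Qed.

Lemma lact_scale (u : tensk C N) (c : k^o) :
  tmap (act (s ((c : k) *: 𝟙))) id u = tmap (klact c) id u :> tensk C N.
Proof.
apply: eq_tlift => m n; congr (_ ⊗ _).
by rewrite [s _](_ : _ = (c : k) *: 𝟙) // (modZl actP) (mod1 actP).
Qed.

End Projection.

(** Naturality of [base_proj] and, in [tmap_lift], of [base_lift] transports colinear maps in the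
    two directions. *)
Lemma tmap_proj (C C' N N' : lmodType k) (act : H -> C -> C) (act' : H -> C' -> C')
    (la : R -> N -> N) (la' : R -> N' -> N') (f : C -> C') (g : N -> N') u :
  is_module act -> is_module act' -> is_module la -> is_module la' ->
  linear f -> linear g ->
  (forall h c, f (act h c) = act' h (f c)) ->
  (forall r n, g (la r n) = la' r (g n)) ->
  base_proj act' la' (tmap f g u) = tmap f g (base_proj act la u).
Proof.
move=> aP aP' lP lP' fl gl fa gl'.
rewrite [RHS]tlift_proj //; last first.
  split=> [n x y|m x y|m i n].
  - by rewrite (linD fl) tpureDl.
  - by rewrite (linD gl) tpureDr.
  by rewrite gl' -(tpure_bal (rres t act') la') /rres fa.
by rewrite base_projS //; apply: eq_tlift => c n; rewrite base_proj_pure.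
Qed.

Lemma tmap_lift (C C' N N' : lmodType k) (act : H -> C -> C) (act' : H -> C' -> C')
    (la : R -> N -> N) (la' : R -> N' -> N') (f : C -> C') (g : N -> N')
    (x : tens (rres t act) la) :
  is_module act -> is_module act' -> is_module la -> is_module la' ->
  linear f -> linear g ->
  (forall h c, f (act h c) = act' h (f c)) ->
  (forall r n, g (la r n) = la' r (g n)) ->
  base_lift (tmap f g x : tens (rres t act') la') = tmap f g (base_lift x).
Proof.
move=> aP aP' lP lP' fl gl fa gl'.
have B : kbal (fun c n => f c ⊗ g n : tensk C' N').
  by apply: (kbal_comp (kbal_pure C' N')).
rewrite {1}/base_lift tlift_tlift; last exact: base_lift_bal.
rewrite [RHS](raddf_tlift _ _ (tliftD B)); apply: eq_tlift => c n.
by rewrite tlift_tlift //; apply: eq_tlift => e r; rewrite fa gl'.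
Qed.

Section TensorAction.
Variables (C : lmodType k) (act : H -> C -> C) (actP : is_module act).
Variables (B : kalgType k) (sB : R -> B) (sBP : is_algmorph sB).
Variables (N : lmodType k) (actB : B -> N -> N) (actBP : is_module actB).

Local Notation la := (lres sB actB).
Let laP : is_module la := lres_module actBP sBP.
Local Notation laB := (lres sB (@kmul k B)).
Let laBP : is_module laB := lres_module (kmul_module B) sBP.

(** The balancings of the arguments and of the value are left free, so that one formula can be read
    over [k] and over the base. *)
Definition tact I I' ra1 la1 ra2 la2 I3 ra3 la3 (u : @tens I H B ra1 la1)
    (v : @tens I' C N ra2 la2) : @tens I3 C N ra3 la3 :=
  \sw_(h, b <- u) \sw_(c, n <- v) (act h c ⊗ actB b n).

Arguments tact {I I' ra1 la1 ra2 la2 I3 ra3 la3} u v.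

Lemma kbal_tact (v : tensk C N) :
  kbal (fun h b => \sw_(c, n <- v) (act h c ⊗ actB b n) : tensk C N).
Proof. by kb. Qed.

(** A base element crossing the inner tensor [v] turns [h ∙ t i ⊗ b] into [h ⊗ b ∙ sB i]; by the
    Takeuchi condition on [u] the right-hand side respects the balancing in [v]. *)
Lemma proj_tact (u : tensk H B) (v : tensk C N) :
  in_takeuchi (base_proj kmul laB u) ->
  base_proj act la (tact u v) = tact (base_proj kmul laB u) (base_proj act la v).
Proof.
move=> tk; rewrite [RHS]tlift_exchange.
have B1 c n : balanced (rres t kmul) laB
    (fun h b => act h c ⊗ actB b n : tens (rres t act) la).
  split=> [b x y|h x y|h i b]; try by lin.
  by rewrite /rres (modM actP) (tpure_bal (rres t act) la) /lres (modM actBP).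
rewrite tlift_proj //; last first.
  split=> [n x y|m x y|m i n]; rewrite -?tlift_add.
  - by apply: eq_tlift => h b; lin.
  - by apply: eq_tlift => h b; lin.
  have := tlift_eq (B1 m n) (tk i).
  under eq_tlift => a b do rewrite (modM actP).
  by move=> ->; apply: eq_tlift => a b; rewrite (modM actBP).
under eq_tlift => c n do rewrite tlift_proj //.
rewrite tlift_exchange /tact base_projS //.
by apply: eq_tlift => h b; rewrite base_projS //; apply: eq_tlift => c n;
  rewrite base_proj_pure.
Qed.

(** The actions are associative, so translating the result by [delta 𝟙] amounts to translating [u],
    which is fixed. *)
Lemma unital_tact (u : tensk H B) (v : tensk C N) :
  unital kmul laB u ->
  unital act la (tact u v).
Proof.
move=> uu; rewrite /unital base_lift_proj //.
have BL := balanced_kbal actP laP (base_lift_bal actP laP).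
rewrite /tact (raddf_tlift _ _ (tliftD BL)).
rewrite -(tlift_unital (kmul_module H) laBP (kbal_tact v) uu).
apply: eq_tlift => h b; rewrite tlift_tlift //.
rewrite tlift_exchange; apply: eq_tlift => e r; apply: eq_tlift => c n.
by rewrite (modM actP) /lres (modM actBP).
Qed.

(** Both sides of the equation over [k] are unital, and [base_proj] is injective on unital tensors.
    In this form multiplicativity axioms return from the base to [k]. *)
Lemma tact_iff (u : tensk H B) (v w : tensk C N) :
  in_takeuchi (base_proj kmul laB u) ->
  unital kmul laB u -> unital act la w ->
  w = tact u v <->
  base_proj act la w = tact (base_proj kmul laB u) (base_proj act la v).
Proof.
move=> tk uu uw; rewrite -proj_tact //; split=> [-> //|e].
by rewrite -uw e unital_tact.
Qed.

End TensorAction.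
End BaseTensor.

(** * Coassociativity over the ground ring and over the base *)

Section ModuleCoring.
Variables (k : comPzRingType) (H : weakHopf k).
Hypothesis antipode_bij : bijective (@antipode k H).

Local Notation R := (base H).
Local Notation delta := (@wh_delta k H).
Local Notation wb := (wh_bialg H).
Local Notation s := (@wh_s k H).
Local Notation t := (wh_t antipode_bij).
Local Notation D := (base_delta1 H).

Variables (C : lmodType k) (act : H -> C -> C) (actP : is_module act).
Variable dk : C -> tensk C C.
Hypothesis dkD : {morph dk : x y / x + y}.
Hypothesis dkM : forall h c,
  dk (act h c) = \sw_(h1, h2 <- delta h) \sw_(c1, c2 <- dk c)
    (act h1 c1 ⊗ act h2 c2).

Local Notation ra := (rres t act).
Local Notation laC := (lres s act).
Let laCP : is_module laC := lres_module actP (wh_s_morph H).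

Definition base_cop (c : C) : tens ra laC := base_proj antipode_bij act laC (dk c).
Local Notation dR := base_cop.

Lemma tlift_dk (P : zmodType) (F : C -> C -> P) h c : kbal F ->
  tlift F (dk (act h c)) = \sw_(h1, h2 <- delta h) \sw_(c1, c2 <- dk c)
    F (act h1 c1) (act h2 c2).
Proof.
move=> FB; rewrite dkM (raddf_tlift _ _ (tliftD FB)).
by apply: eq_tlift => a b; rewrite tlift_tlift.
Qed.

Lemma kbal_dk_act c :
  kbal (fun h1 h2 => \sw_(c1, c2 <- dk c) (act h1 c1 ⊗ act h2 c2) : tensk C C).
Proof. by kb. Qed.

(** Since [delta (s r) = s r ∙ e ⊗ f] and [delta 𝟙] acts trivially on [dk c], only the first leg is
    affected. In [dk_t] it is the second, by [delta_tau_l]. *)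
Lemma dk_s r c : dk (act (s r) c) = tmap (act (s r)) id (dk c).
Proof.
rewrite -{2}(mod1 actP c) dkM -{1}(Pi_base r) (delta_PiL_l wb) Pi_base.
rewrite (tlift_tlift _ _ _ (kbal_dk_act c)) [RHS]tlift_dk; last by kb.
by apply: eq_tlift => a b; apply: eq_tlift => c1 c2; rewrite (modM actP).
Qed.

Lemma dk_t r c : dk (act (t r) c) = tmap id (act (t r)) (dk c).
Proof.
rewrite -{2}(mod1 actP c) dkM wh_tE (delta_tau_l wb).
rewrite (tlift_tlift _ _ _ (kbal_dk_act c)) [RHS]tlift_dk; last by kb.
by apply: eq_tlift => a b; apply: eq_tlift => c1 c2; rewrite (modM actP).
Qed.

(** Writing [c] as [act 𝟙 c] makes [dk c] a translate by [delta 𝟙], and such a translate is fixed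
    because [delta 𝟙] is idempotent. *)
Lemma unital_dk c : unital antipode_bij act laC (dk c).
Proof.
have u1 : unital antipode_bij kmul (lres s kmul) (delta 𝟙).
  rewrite /unital base_lift_proj; try exact: kmul_module; last first.
    exact: (lres_module (kmul_module H) (wh_s_morph H)).
  rewrite tlift_exchange -[in RHS](kmulr1 𝟙).
  rewrite (@tlift_delta1 _ _ _ (fun e f : H =>
    \sw_(c, n <- delta 𝟙) (e ∙ c ⊗ (f ∙ n) : tensk H H))); last by kb.
  by rewrite -(deltaM_bi wb _ _ (kbal_pure H H)) tlift_id.
by rewrite -(mod1 actP c) dkM; apply: unital_tact => //; exact: wh_s_morph.
Qed.

Section Comodule.
Variables (M : lmodType k) (la : R -> M -> M) (laP : is_module la).
Variable rk : M -> tensk C M.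
Hypothesis rkD : {morph rk : x y / x + y}.
Hypothesis rkl : forall r m, rk (la r m) = tmap (act (s r)) id (rk m).
Hypothesis rku : forall m, unital antipode_bij act la (rk m).

Definition base_coact (m : M) : tens ra la := base_proj antipode_bij act la (rk m).
Local Notation rR := base_coact.

Local Notation T3K := (tens3 (@klact k C) (@kract k C) (@klact k M)).
Local Notation T3R := (tens3 laC ra la).

Lemma base_coactD : {morph rR : x y / x + y}.
Proof. by move=> x y; rewrite /base_coact rkD base_projD. Qed.

Lemma base_coactl r m : rR (la r m) = tmap (laC r) id (rR m).
Proof. by rewrite /base_coact rkl base_proj_lact. Qed.

Lemma coact_scale (c : k^o) m : rk (klact c m) = tmap (klact c) id (rk m).
Proof.
rewrite -(lact_scale actP) -rkl; congr rk.
by rewrite (modZl laP) (mod1 laP).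
Qed.

Lemma tens3R_bal x :
  balanced ra laC (fun c1 c2 => c1 ⊗ (c2 ⊗ x) : T3R).
Proof.
split=> [n y z|m y z|m i n]; rewrite ?tpureDl ?tpureDr //.
rewrite (tpure_bal ra (tlact laC)); congr (_ ⊗ _).
by rewrite /tlact /tmap tlift_pure //; exact: balanced_lact.
Qed.

Lemma coassocl_bal :
  balanced ra la (fun c x => \sw_(c1, c2 <- dR c) (c1 ⊗ (c2 ⊗ x)) : T3R).
Proof.
have B x := tens3R_bal x; have BK x := balanced_kbal actP laCP (B x).
have e c x : \sw_(c1, c2 <- dR c) (c1 ⊗ (c2 ⊗ x) : T3R)
    = \sw_(c1, c2 <- dk c) (c1 ⊗ (c2 ⊗ x)) by exact: tlift_proj.
split=> [n x y|m x y|m i n]; rewrite !e.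
- by rewrite dkD (tliftD (BK n)).
- by rewrite -tlift_add; apply: eq_tlift => a b; rewrite !tpureDr.
rewrite [ra m i]/rres dk_t tlift_tlift //; apply: eq_tlift => a b.
by congr (_ ⊗ _); exact: (tpure_bal ra la).
Qed.

Lemma coassocr_bal : balanced ra la (fun c x => c ⊗ rR x : T3R).
Proof.
split=> [n x y|m x y|m i n].
- by rewrite tpureDl.
- by rewrite base_coactD tpureDr.
by rewrite base_coactl (tpure_bal ra (tlact laC)).
Qed.

Lemma proj3_bal : balanced kract (tlact klact)
  (fun c (u : tensk C M) => c ⊗ base_proj antipode_bij act la u : T3R).
Proof.
split=> [n x y|m x y|m i n].
- by rewrite tpureDl.
- by rewrite base_projD // tpureDr.
rewrite /tlact -(lact_scale actP) base_proj_lact //.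
rewrite -[tmap _ _ _]/(tlact laC _ _) -(tpure_bal ra (tlact laC)).
congr (_ ⊗ _).
rewrite /rres (linZ (wh_t_linear _)) wh_t1.
by rewrite (modZl actP) (mod1 actP).
Qed.

Definition proj3 (u : T3K) : T3R :=
  tlift (fun c u => c ⊗ base_proj antipode_bij act la u) u.

Local Notation sh r := (tmap (act (s r)) id).

Lemma sh_bal c (w : tensk C M) :
  kbal (fun e r => act e c ⊗ (sh r w : tensk C M) : T3K).
Proof.
have shE r : sh r w = \sw_(a, b <- w) (act (s r) a ⊗ b) :> tensk C M by [].
split=> [n x y|m x y|m i n].
- by rewrite (modDl actP) tpureDl.
- rewrite -tpureDr !shE -tlift_add; congr (_ ⊗ _); apply: eq_tlift => a b.
  by rewrite (modDl actP) tpureDl.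
rewrite /kract /klact (modZl actP).
rewrite (tpure_bal kract (tlact klact)); congr (_ ⊗ _).
rewrite /tlact {1}/tmap shE (raddf_tlift _ _ (tliftD _)); last by kb.
apply: eq_tlift => a b; rewrite tlift_pure; last by kb.
by congr (_ ⊗ _); rewrite /klact -(modZl actP).
Qed.

(** The outer balancing is [base_delta1_t]. The base acts on the inner tensor through its first leg,
    and [base_lift_lact] lets this action pass the inner lift. *)
Lemma lift3_bal : balanced ra (tlact laC)
  (fun c (v : tens ra la) => \sw_(e, r <- D) (act e c ⊗ sh r (base_lift v)) : T3K).
Proof.
split=> [n x y|m x y|m i n]; rewrite -?tlift_add.
- by apply: eq_tlift => e r; rewrite (modDr actP) tpureDl.
- apply: eq_tlift => e r; rewrite base_liftD // /tmap (tliftD _) ?tpureDr //.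
  by kb.
transitivity (\sw_(e, r <- D) (act (e ∙ t i) m ⊗ sh r (base_lift n) : T3K)).
  by apply: eq_tlift => e r; rewrite (modM actP).
rewrite (base_delta1_t antipode_bij i (sh_bal m (base_lift n))).
apply: eq_tlift => e r; congr (_ ⊗ _).
rewrite /tlact base_lift_lact // tmap_comp //.
- by apply: eq_tlift => a b; rewrite /= -(modM actP).
- by move=> a b; rewrite (modDr actP).
- by move=> a b; rewrite /kract (modZr actP).
Qed.

(* A left inverse of [proj3] on both sides of the coassociativity axiom, so that
   the axiom can be pulled back from the base to the ground ring. *)
Definition lift3 (v : T3R) : T3K :=
  tlift (fun c v => \sw_(e, r <- D) (act e c ⊗ sh r (base_lift v))) v.

Let kl m : T3K := \sw_(c, x <- rk m) \sw_(c1, c2 <- dk c) (c1 ⊗ (c2 ⊗ x)).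
Let kr m : T3K := \sw_(c, x <- rk m) (c ⊗ rk x).

Lemma proj3S I (X Y : zmodType) ra' la' (v : @tens I X Y ra' la') F :
  proj3 (\sw_(a, b <- v) F a b) = \sw_(a, b <- v) proj3 (F a b).
Proof. exact: (raddf_tlift _ _ (tliftD proj3_bal)). Qed.

Lemma lift3S I (X Y : zmodType) ra' la' (v : @tens I X Y ra' la') F :
  lift3 (\sw_(a, b <- v) F a b) = \sw_(a, b <- v) lift3 (F a b).
Proof. exact: (raddf_tlift _ _ (tliftD lift3_bal)). Qed.

Lemma proj3_pure c u : proj3 (c ⊗ u) = c ⊗ base_proj antipode_bij act la u.
Proof. exact: (tlift_pure proj3_bal). Qed.

Lemma lift3_pure c v :
  lift3 (c ⊗ v) = \sw_(e, r <- D) (act e c ⊗ sh r (base_lift v)).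
Proof. exact: (tlift_pure lift3_bal). Qed.

Lemma proj3_coassocl m :
  proj3 (kl m) = \sw_(c, x <- rR m) \sw_(c1, c2 <- dR c) (c1 ⊗ (c2 ⊗ x)).
Proof.
rewrite [RHS](tlift_proj _ coassocl_bal) proj3S.
apply: eq_tlift => c x; rewrite [RHS](tlift_proj _ (tens3R_bal x)) proj3S.
by apply: eq_tlift => a b; rewrite proj3_pure base_proj_pure.
Qed.

Lemma proj3_coassocr m : proj3 (kr m) = \sw_(c, x <- rR m) (c ⊗ rR x).
Proof.
rewrite [RHS](tlift_proj _ coassocr_bal) proj3S.
by apply: eq_tlift => c x; rewrite proj3_pure.
Qed.

Lemma coassocr_kbal : kbal (fun c x => c ⊗ rk x : T3K).
Proof.
split=> [n x y|m x y|m i n].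
- by rewrite tpureDl.
- by rewrite rkD tpureDr.
by rewrite coact_scale (tpure_bal kract (tlact klact)).
Qed.

Lemma coassocl_kbal :
  kbal (fun c x => \sw_(c1, c2 <- dk c) (c1 ⊗ (c2 ⊗ x)) : T3K).
Proof.
have B x : kbal (fun c1 c2 => c1 ⊗ (c2 ⊗ x) : T3K) by exact: tens3_bal.
split=> [n x y|m x y|m i n].
- by rewrite dkD (tliftD (B n)).
- by rewrite -tlift_add; apply: eq_tlift => a b; rewrite !tpureDr.
have -> : kract m i = act (t ((i : k) *: 𝟙)) m.
  by rewrite (linZ (wh_t_linear _)) wh_t1 (modZl actP) (mod1 actP).
rewrite dk_t tlift_tlift //; apply: eq_tlift => a b; congr (_ ⊗ _).
rewrite (linZ (wh_t_linear _)) wh_t1 (modZl actP) (mod1 actP).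
exact: (tpure_bal kract klact).
Qed.

(** The inner lift disappears because [rk x] is unital. By linearity of [rk] the outer one inserts
    [act e c ⊗ rk (la r x)], which is absorbed because [rk m] is unital. *)
Lemma proj3K_coassocr m : lift3 (proj3 (kr m)) = kr m.
Proof.
rewrite [in RHS]/kr -(tlift_unital actP laP coassocr_kbal (rku m)).
rewrite proj3S lift3S; apply: eq_tlift => c x.
rewrite proj3_pure lift3_pure rku.
by apply: eq_tlift => e r; rewrite rkl.
Qed.

(** Unitality of [rk m] gives a single factor [e ⊗ r], and [dk (act e c)] is [dk c] acted on by
    [delta e]. Then [base_delta1_delta] yields the outer and the inner factor that [lift3]
    inserts. *)
Lemma proj3K_coassocl m : lift3 (proj3 (kl m)) = kl m.
Proof.
rewrite [in RHS]/kl -(tlift_unital actP laP coassocl_kbal (rku m)).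
rewrite proj3S lift3S; apply: eq_tlift => c x.
rewrite proj3S lift3S.
have B y : kbal (fun c1 c2 => c1 ⊗ (c2 ⊗ y) : T3K) by exact: tens3_bal.
transitivity (\sw_(e, r <- D) \sw_(e1, e2 <- delta e) \sw_(c1, c2 <- dk c)
    (act e1 c1 ⊗ (act e2 c2 ⊗ la r x) : T3K)); last first.
  by apply: eq_tlift => e r; rewrite tlift_dk.
under [in RHS]eq_tlift => e r do rewrite tlift_exchange.
rewrite [RHS]tlift_exchange; apply: eq_tlift => c1 c2.
rewrite (@base_delta1_delta _ _ _
    (fun a b r => act a c1 ⊗ (act b c2 ⊗ la r x) : T3K)); last first.
  split=> [a b u v|a|a].
  - by rewrite (modDl actP) tpureDl.
  - split=> [n u v|b u v|b i n].
    + by rewrite (modDl actP) tpureDl tpureDr.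
    + by rewrite (modDl laP) !tpureDr.
    by congr (_ ⊗ _); lin.
  apply: (kbal_comp (B (la a x))).
    by move=> i u v; rewrite (modDl actP) (modZl actP).
  by move=> i u v; rewrite (modDl actP) (modZl actP).
rewrite proj3_pure lift3_pure; apply: eq_tlift => e r.
rewrite base_lift_proj // tlift_pure; last first.
  have := balanced_kbal actP laP (base_lift_bal antipode_bij actP laP); apply.
rewrite /tmap (raddf_tlift _ _ (tliftD _)); last by kb.
rewrite pure_sumr; apply: eq_tlift => e' r'; rewrite tlift_pure; last by kb.
by rewrite (modM actP).
Qed.

Lemma coassoc_iff m :
  \sw_(c, x <- rk m) \sw_(c1, c2 <- dk c) (c1 ⊗ (c2 ⊗ x))
    = \sw_(c, x <- rk m) (c ⊗ rk x) :> T3K <->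
  \sw_(c, x <- rR m) \sw_(c1, c2 <- dR c) (c1 ⊗ (c2 ⊗ x))
    = \sw_(c, x <- rR m) (c ⊗ rR x) :> T3R.
Proof.
rewrite -proj3_coassocl -proj3_coassocr; split; first by move=> e; congr proj3.
by move=> e; rewrite -/(kl m) -/(kr m) -proj3K_coassocl e proj3K_coassocr.
Qed.

End Comodule.
End ModuleCoring.

(** * Counits *)

Section Counit.
Variables (k : comPzRingType) (H : weakHopf k).
Hypothesis antipode_bij : bijective (@antipode k H).

Local Notation R := (base H).
Local Notation delta := (@wh_delta k H).
Local Notation eps := (@wh_eps k H).
Local Notation wb := (wh_bialg H).
Local Notation s := (@wh_s k H).
Local Notation t := (wh_t antipode_bij).
Local Notation D := (base_delta1 H).

Variables (C : lmodType k) (act : H -> C -> C) (actP : is_module act).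
Local Notation ra := (rres t act).
Local Notation laC := (lres s act).
Let laCP : is_module laC := lres_module actP (wh_s_morph H).

Lemma Pi_R_delta1 x : Pi_R x = \sw_(e, r <- D) (eps (e ∙ x) : k) *: r.
Proof.
rewrite tlift_base_delta1; last first.
  bi. 
  - by rewrite kmulDl (wb_epsD wb) scalerDl.
  - by rewrite scalerDr.
  by rewrite kmulZl (wb_epsZ wb) scalerA mulrC.
apply: val_inj; rewrite -[RHS]/(s _) (raddf_tlift (g := s)) //.
rewrite -[LHS]/(PiL delta eps x) -[LHS](PiL_id wb) [X in PiL _ _ X = _]/PiL.
rewrite (raddf_tlift _ _ (PiLD wb)).
by apply: eq_tlift => e f; rewrite (PiLZ wb).
Qed.

Section WeakCounit.
Variable ek : C -> k^o.
Hypothesis ekD : forall x y, ek (x + y) = ek x + ek y.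
Hypothesis ekZ : forall (c : k) x, ek (c *: x) = c * ek x.
Hypothesis ekM : forall h g c, ek (act (h ∙ g) c)
  = \sw_(g1, g2 <- delta g) (eps (h ∙ g2) * ek (act g1 c)).

Definition base_counit (c : C) : R := \sw_(e, r <- D) (ek (act e c) : k) *: r.
Local Notation eR := base_counit.

Lemma base_counitD : {morph eR : x y / x + y}.
Proof.
move=> x y; rewrite /base_counit -tlift_add; apply: eq_tlift => e r.
by rewrite (modDr actP) ekD scalerDl.
Qed.

(** The weak counit axiom at [g = 𝟙] expands [ek (e' h c)] as [eps (e' h f) ek (e c)], where
    [delta 𝟙 = e ⊗ f], and [eps (e' x) r'] sums to [Pi_R x]. *)
Lemma base_counitM h c : eR (act h c) = Pi_R (h ∙ s (eR c)).
Proof.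
rewrite [in RHS]/base_counit.
rewrite (raddf_tlift (g := fun r => Pi_R (h ∙ s r))); last first.
  move=> x y; rewrite [s _](_ : _ = s x + s y) // kmulDr.
  exact: (linD (@Pi_R_linear k H)).
transitivity (\sw_(e', r' <- D) (\sw_(e, r <- D)
    (eps (e' ∙ h ∙ s r) * ek (act e c) : k^o) : k) *: r').
  apply: eq_tlift => e' r'; congr (_ *: _).
  rewrite (@tlift_delta1 _ _ _ (fun e f => eps (e' ∙ h ∙ f) * ek (act e c) : k^o)).
    by rewrite -ekM -(modM actP) kmulr1.
  bi.
  - by rewrite (modDl actP) ekD mulrDr.
  - by rewrite kmulDr (wb_epsD wb) mulrDl.
  by rewrite (modZl actP) ekZ kmulZr (wb_epsZ wb) mulrCA mulrA.
under [RHS]eq_tlift => e r.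
  rewrite [s _](_ : _ = (ek (act e c) : k) *: s r) // kmulZr.
  rewrite (linZ (@Pi_R_linear k H)) Pi_R_delta1.
  rewrite scaleS; over.
rewrite [RHS]tlift_exchange; apply: eq_tlift => e' r'.
rewrite (raddf_tlift _ _ (fun x y => scalerDl r' (x : k) y)).
by apply: eq_tlift => e r; rewrite scalerA kmulA mulrC.
Qed.

Lemma base_counitl r c : eR (laC r c) = r ∙ eR c.
Proof. by rewrite base_counitM -[RHS]Pi_R_s. Qed.

Lemma base_counitr r c : eR (ra c r) = eR c ∙ r.
Proof.
rewrite base_counitM; apply: val_inj => /=.
by rewrite wh_tE /Pi_L (PiL_mul_tau wb) !Pi_base.
Qed.

(** The mirror image of [base_counit], with the legs of [delta 𝟙] interchanged. The right counit law
    calls for it, since there the base acts through [t]. *)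
Lemma t_base_counit c : t (eR c) = \sw_(e, r <- D) (ek (act (s r) c) : k) *: e.
Proof.
have tl := wh_t_linear antipode_bij.
transitivity (\sw_(e', f' <- delta 𝟙) (ek (act f' c) : k) *: e'); last first.
  rewrite (@tlift_delta1 _ _ _ (fun e f => (ek (act f c) : k) *: e)) //.
  bi.
  - by rewrite scalerDr.
  - by rewrite (modDl actP) ekD scalerDl.
  by rewrite (modZl actP) ekZ scalerA mulrC.
rewrite /base_counit (raddf_tlift _ _ (linD tl)).
transitivity (\sw_(e, r <- D) \sw_(e', f' <- delta 𝟙)
    (((ek (act e c) : k) * eps (f' ∙ s r) : k) *: e')).
  apply: eq_tlift => e r; rewrite (linZ tl) wh_tE /PiLbar scaleS.
  by apply: eq_tlift => a b; rewrite scalerA.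
rewrite tlift_exchange; apply: eq_tlift => e' f'.
rewrite -[f' in RHS]kmulr1 ekM (raddf_tlift _ _ (fun x y => scalerDl e' (x : k) y)).
rewrite -(@tlift_delta1 _ _ _
    (fun e f => (eps (f' ∙ f) * ek (act e c) : k) *: e')).
  by apply: eq_tlift => e r; rewrite mulrC.
bi.
- by rewrite (modDl actP) ekD mulrDr scalerDl.
- by rewrite kmulDr (wb_epsD wb) mulrDl scalerDl.
by rewrite (modZl actP) ekZ kmulZr (wb_epsZ wb) mulrCA mulrA.
Qed.

(** This is the weak counit axiom at [h = g = 𝟙]. *)
Lemma base_counitK c : eps (s (eR c)) = ek c.
Proof.
rewrite /base_counit (raddf_tlift (g := fun r => eps (s r)));
  last by move=> x y; rewrite -(wb_epsD wb).
rewrite -[act]/act -[c in RHS](mod1 actP) -[X in ek (act X _)]kmulr1 ekM.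
rewrite -(@tlift_delta1 _ _ _ (fun e f => eps (𝟙 ∙ f) * ek (act e c) : k^o)).
  by apply: eq_tlift => e r; rewrite [s _](_ : _ = (ek (act e c) : k) *: s r) //
    (wb_epsZ wb) kmul1r mulrC.
bi.
- by rewrite (modDl actP) ekD mulrDr.
- by rewrite kmulDr (wb_epsD wb) mulrDl.
by rewrite (modZl actP) ekZ kmulZr (wb_epsZ wb) mulrCA mulrA.
Qed.

Variable dk : C -> tensk C C.
Hypothesis dkD : {morph dk : x y / x + y}.
Hypothesis dkM : forall h c,
  dk (act h c) = \sw_(h1, h2 <- delta h) \sw_(c1, c2 <- dk c)
    (act h1 c1 ⊗ act h2 c2).
Local Notation dR := (base_cop antipode_bij act dk).

Lemma counitr_eq c :
  \sw_(a, b <- dR c) ra a (eR b) = \sw_(a, b <- dk c) (ek b : k) *: a.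
Proof.
have tl := wh_t_linear antipode_bij.
rewrite tlift_proj; last first.
  split=> [n x y|m x y|m i n]; rewrite /rres.
  - by rewrite (modDr actP).
  - by rewrite base_counitD (linD tl) (modDl actP).
  by rewrite base_counitl (wh_tM antipode_bij) (modM actP).
rewrite -(tlift_unital actP laCP (F := fun a b => (ek b : k) *: a) _
  (unital_dk antipode_bij actP dkM c)); last first.
  by bi; rewrite ?scalerDr ?ekD ?scalerDl ?ekZ ?scalerA // mulrC.
apply: eq_tlift => a b; rewrite /rres t_base_counit.
rewrite (raddf_tlift _ _ (fun x y => modDl actP x y a)).
by apply: eq_tlift => e r; rewrite (modZl actP).
Qed.

Section Comodule.
Variables (M : lmodType k) (la : R -> M -> M) (laP : is_module la).
Variable rk : M -> tensk C M.
Hypothesis rkD : {morph rk : x y / x + y}.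
Hypothesis rkl : forall r m, rk (la r m) = tmap (act (s r)) id (rk m).
Hypothesis rku : forall m, unital antipode_bij act la (rk m).
Local Notation rR := (base_coact antipode_bij act la rk).

(** The factor [e ⊗ r] in the definition of [base_counit] is the one that unitality of [rk m]
    absorbs. *)
Lemma counitl_eq m :
  \sw_(c, x <- rR m) la (eR c) x = \sw_(c, x <- rk m) (ek c : k) *: x.
Proof.
rewrite tlift_proj; last first.
  split=> [n x y|c x y|c i n].
  - by rewrite base_counitD (modDl laP).
  - by rewrite (modDr laP).
  by rewrite base_counitr (modM laP).
rewrite -(tlift_unital actP laP (F := fun c x => (ek c : k) *: x) _ (rku m));
  last first.
  by bi; rewrite ?scalerDr ?ekD ?scalerDl ?ekZ ?scalerA // mulrC.
apply: eq_tlift => c x; rewrite /base_counit.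
rewrite (raddf_tlift _ _ (fun y z => modDl laP y z x)).
by apply: eq_tlift => e r; rewrite (modZl laP).
Qed.

Lemma comodule_iff :
  is_comodule (la := klact) (ra := kract) dk ek rk <-> is_comodule dR eR rR.
Proof.
have cs := coact_scale actP laP rkl.
split=> -[cm cD cl ca cu]; split=> //.
- exact: base_coactD.
- by move=> r m; apply: base_coactl.
- by move=> m; apply/(coassoc_iff actP dkD dkM laP rkD rkl rku).
- by move=> m; rewrite counitl_eq; apply: cu.
- exact: klact_module.
- by move=> m; apply/(coassoc_iff actP dkD dkM laP rkD rkl rku).
- by move=> m; rewrite -[RHS]cu counitl_eq.
Qed.

End Comodule.

(** Coassociativity and the left counit law are the case [rk := dk] of the results on comodules, [C]
    coacting on itself; the right counit law is [counitr_eq]. *)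
Lemma coring_iff : is_coalgebra dk ek <-> is_coring dR eR.
Proof.
have dkl := dk_s actP dkM; have dku := unital_dk antipode_bij actP dkM.
have tl := wh_t_linear antipode_bij.
split=> -[cb cD cl cr cDe ce1 ce2 ca cul cur].
split=> //.
- split=> // [r c x y|c r x y|c|c r r'|r c r'].
  - by rewrite /rres (modDr actP) (modZr actP).
  - by rewrite /rres tl (modDl actP) (modZl actP).
  - by rewrite /rres wh_t1 (mod1 actP).
  - by rewrite /rres wh_tM (modM actP).
  - by rewrite /lres /rres -!(modM actP) wh_st_comm.
- exact: base_coactD.
- move=> r c; exact: base_coactl.
- move=> r c; rewrite /base_cop /rres (dk_t antipode_bij actP dkM).
  rewrite [RHS]tlift_proj; last first.
    split=> [n x y|m x y|m i n].
    + by rewrite tpureDl.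
    + by rewrite (modDr actP) tpureDr.
    rewrite (tpure_bal ra laC); congr (_ ⊗ _).
    by rewrite /lres -!(modM actP) wh_st_comm.
  by rewrite base_projS //; apply: eq_tlift => a b; rewrite base_proj_pure.
- exact: base_counitD.
- exact: base_counitl.
- by move=> r c; exact: base_counitr.
- by move=> c; apply/(coassoc_iff actP dkD dkM laCP dkD dkl dku).
- by move=> c; rewrite (counitl_eq laCP dku); exact: cul.
- by move=> c; rewrite counitr_eq; exact: cur.
split=> //.
- split=> //; try exact: klact_module.
  + by move=> c u v w; rewrite /kract scalerDr !scalerA mulrC.
  + by move=> m c u v; rewrite /kract scalerDl scalerA.
  + by move=> m; rewrite /kract scale1r.
  + by move=> m r r'; rewrite /kract scalerA mulrC.
  + by move=> r m r'; rewrite /kract /klact !scalerA mulrC.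
- by move=> r c; apply: (coact_scale actP laCP dkl).
- move=> r c; rewrite [kract c r]/(klact r c) (coact_scale actP laCP dkl).
  by apply: eq_tlift => a b; rewrite /kract (tpure_bal kract klact).
- by move=> r c; rewrite /kract ekZ mulrC.
- by move=> c; apply/(coassoc_iff actP dkD dkM laCP dkD dkl dku); exact: ca.
- by move=> c; rewrite -[RHS]cul (counitl_eq laCP dku).
- by move=> c; rewrite -[RHS]cur counitr_eq.
Qed.

End WeakCounit.

Section StrongCounit.
Variable eR : C -> R.
Hypothesis eRD : {morph eR : x y / x + y}.
Hypothesis eRM : forall h c, eR (act h c) = Pi_R (h ∙ s (eR c)).

Definition weak_counit (c : C) : k^o := eps (s (eR c)).
Local Notation ek := weak_counit.

Lemma weak_counitD x y : ek (x + y) = ek x + ek y.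
Proof. by rewrite /weak_counit eRD -(wb_epsD wb). Qed.

Lemma weak_counitE h c : ek (act h c) = eps (h ∙ s (eR c)).
Proof.
rewrite /weak_counit eRM -[s _]kmul1r [s _]/(PiL delta eps _) (eps_PiL wb).
by rewrite kmul1r.
Qed.

Lemma weak_counitZ (c : k) x : ek (c *: x) = c * ek x.
Proof.
rewrite -[x in LHS](mod1 actP) -(modZl actP) weak_counitE kmulZl (wb_epsZ wb).
by rewrite kmul1r.
Qed.

(** By [weak_counitE] this is the axiom [wb_epsM2] of [H] with last argument [s (eR c)]. *)
Lemma weak_counitM h g c : ek (act (h ∙ g) c)
  = \sw_(g1, g2 <- delta g) (eps (h ∙ g2) * ek (act g1 c)).
Proof.
rewrite weak_counitE (wb_epsM2 wb).
by apply: eq_tlift => a b; rewrite weak_counitE.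
Qed.

(** As [ek (act e c) = eps (e ∙ s (eR c))], the sum is [Pi_R] of an element of the base. *)
Lemma weak_counitK c : base_counit ek c = eR c.
Proof.
rewrite -[RHS]Pi_R_s Pi_R_delta1; apply: eq_tlift => e r.
by rewrite weak_counitE.
Qed.

End StrongCounit.
End Counit.

(** * Comodule algebras *)

Section TrilinearEval.
Variables (k : comPzRingType) (X Y Z : lmodType k) (P : zmodType).
Variables (G : X -> Y -> Z -> P) (Gt : trilinear G).

Definition tlift3 (v : tens (@kract k X)
    (tlact (N := Z) (ra := kract) (la := klact) (@klact k Y))) : P :=
  tlift (fun a (u : tensk Y Z) => \sw_(b, c <- u) G a b c) v.

Lemma tlift3S I (M N : zmodType) ra la (v : @tens I M N ra la) F :
  tlift3 (\sw_(a, b <- v) F a b) = \sw_(a, b <- v) tlift3 (F a b).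
Proof. exact: (raddf_tlift _ _ (tliftD (trilinear_bal Gt))). Qed.

Lemma tlift3_pure a u : tlift3 (a ⊗ u) = \sw_(b, c <- u) G a b c.
Proof. exact: (tlift_pure (trilinear_bal Gt)). Qed.

Lemma tlift3_pure2 a b c : tlift3 (a ⊗ (b ⊗ c)) = G a b c.
Proof. by rewrite tlift3_pure tlift_pure //; have [_ + _] := Gt; apply. Qed.

End TrilinearEval.

Lemma comod_coassoc3 (k : comPzRingType) (C M : lmodType k)
    (dk : C -> tensk C C) (ek : C -> k^o) (rk : M -> tensk C M)
    (rkP : is_comodule dk ek rk) (P : zmodType) (G : C -> C -> M -> P) m :
  trilinear G ->
  \sw_(c, x <- rk m) \sw_(c1, c2 <- dk c) G c1 c2 x
  = \sw_(c, x <- rk m) \sw_(c', x' <- rk x) G c c' x'.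
Proof.
move=> Gt; have := congr1 (tlift3 G) (comod_coassoc rkP m).
rewrite !(tlift3S Gt) => e.
transitivity (\sw_(c, x <- rk m) tlift3 G (\sw_(c1, c2 <- dk c) (c1 ⊗ (c2 ⊗ x)))).
  apply: eq_tlift => c x; rewrite (tlift3S Gt).
  by apply: eq_tlift => a b; rewrite (tlift3_pure2 Gt).
by rewrite e; apply: eq_tlift => c x; rewrite (tlift3_pure Gt).
Qed.

Section WeakComoduleAlgebra.
Variables (k : comPzRingType) (H : weakHopf k).
Hypothesis antipode_bij : bijective (@antipode k H).

Local Notation R := (base H).
Local Notation delta := (@wh_delta k H).
Local Notation eps := (@wh_eps k H).
Local Notation wb := (wh_bialg H).
Local Notation s := (@wh_s k H).
Local Notation t := (wh_t antipode_bij).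
Local Notation D := (base_delta1 H).

(** The form in which [unital_dk] and [comodule_iff], used at [C := H], expect multiplicativity of
    [delta]. *)
Lemma delta_kmul h c :
  delta (h ∙ c) = \sw_(h1, h2 <- delta h) \sw_(c1, c2 <- delta c)
    (h1 ∙ c1 ⊗ (h2 ∙ c2)).
Proof. exact: (wb_deltaM wb). Qed.

Variable A : wcomod_algebra H.
Local Notation rho := (@wca_rho k H A).
Let rhoP : is_comodule delta eps rho := wca_comod A.

Lemma wca_rhoD : {morph rho : x y / x + y}.
Proof. exact: (comod_rhoD rhoP). Qed.

Lemma wca_rhoZ (c : k) a : rho (c *: a) = \sw_(h, b <- rho a) ((c *: h) ⊗ b).
Proof. exact: (comod_rhol rhoP c a). Qed.

Lemma wca_counit a : \sw_(h, b <- rho a) (eps h : k) *: b = a.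
Proof. exact: (comod_counit rhoP a). Qed.

Lemma tlift_rhoM (P : zmodType) (F : H -> A -> P) a b : kbal F ->
  tlift F (rho (a ∙ b))
  = \sw_(h, x <- rho a) \sw_(g, y <- rho b) F (h ∙ g) (x ∙ y).
Proof.
move=> FB; rewrite -wca_rhoM /tmul (raddf_tlift _ _ (tliftD FB)).
by apply: eq_tlift => h x; rewrite tlift_tlift.
Qed.

Lemma rho1_coassoc (P : zmodType) (G : H -> H -> A -> P) : trilinear G ->
  \sw_(h, a <- rho 𝟙) \sw_(h', a' <- rho a) G h h' a'
  = \sw_(e, f <- delta 𝟙) \sw_(h, a <- rho 𝟙) G e (h ∙ f) a.
Proof.
move=> Gt; have := congr1 (tlift3 G) (wca_rho1 A).
rewrite !(tlift3S Gt) => e.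
transitivity (\sw_(h, a <- rho 𝟙) tlift3 G (h ⊗ rho a)).
  by apply: eq_tlift => h a; rewrite (tlift3_pure Gt).
rewrite e; apply: eq_tlift => h a; rewrite (tlift3S Gt).
by apply: eq_tlift => x y; rewrite (tlift3_pure2 Gt).
Qed.

Lemma eps_bal (P : lmodType k) (u : H -> H) (v : A -> P) : linear u -> linear v ->
  kbal (fun h a => (eps (u h) : k) *: v a).
Proof.
move=> ul vl; bi.
- by rewrite (linD ul) (wb_epsD wb) scalerDl.
- by rewrite (linD vl) scalerDr.
by rewrite (linZ ul) (linZ vl) (wb_epsZ wb) scalerA mulrC.
Qed.

(* The first leg of [rho 𝟙] lies in the image of [h |-> e eps (h ∙ f)], where
   [delta 𝟙 = e ⊗ f]; this image commutes with the base. *)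
Lemma rho1_PiR (P : zmodType) (F : H -> A -> P) : kbal F ->
  tlift F (rho 𝟙)
  = \sw_(e, f <- delta 𝟙) \sw_(h, a <- rho 𝟙) F ((eps (h ∙ f) : k) *: e) a.
Proof.
case=> F1 F2 F3.
(* The counit is inserted between the two legs, so that the weak unit axiom [rho1_coassoc]
   applies. *)
have Gt : trilinear (fun h h' a => F ((eps h' : k) *: h) a).
  split=> [y z u v|x|z]; first by rewrite scalerDr F1.
    bi; first by rewrite (wb_epsD wb) scalerDl F1.
      by rewrite F2.
    by rewrite (wb_epsZ wb) -F3 /kract scalerA.
  bi; first by rewrite scalerDr F1.
    by rewrite (wb_epsD wb) scalerDl F1.
  by rewrite (wb_epsZ wb) scalerA mulrC.
rewrite -(rho1_coassoc Gt); apply: eq_tlift => h a.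
rewrite -[in LHS](wca_counit a).
rewrite (raddf_tlift _ _ (F2 h)); apply: eq_tlift => h' a'.
by rewrite -[LHS]F3.
Qed.

(** Both products are the middle leg of [1_1 ⊗ 1_2 ⊗ 1_3] with the outer legs paired against [r] and
    [h]; the two forms of the weak unit axiom multiply the factors in opposite orders. *)
Lemma PiR_s_comm h r :
  (\sw_(e, f <- delta 𝟙) (eps (h ∙ f) : k) *: e) ∙ s r
  = s r ∙ \sw_(e, f <- delta 𝟙) (eps (h ∙ f) : k) *: e.
Proof.
pose G (a b c : H) : H := (eps (a ∙ s r) : k) *: ((eps (h ∙ c) : k) *: b).
have Gt : trilin G.
  split; intros ? ? ? ?; rewrite /G; cbv beta; rewrite ?kmulDl ?kmulDr ?kmulZl ?kmulZr
    ?(wb_epsD wb) ?(wb_epsZ wb) ?scalerDl ?scalerDr ?scalerDl ?scalerDr ?scalerA //.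
  - by rewrite -mulrA mulrC.
  by rewrite -mulrA [_ * c]mulrC.
have e1 := delta1l_tri wb Gt; have e2 := delta1r_tri wb Gt.
rewrite -(Pi_base r) /PiL.
transitivity (\sw_(a, b <- delta 𝟙) \sw_(c, d <- delta 𝟙) G a (c ∙ b) d).
  rewrite kmulS; apply: eq_tlift => a b; rewrite kmulSl.
  by apply: eq_tlift => c d; rewrite /G kmulZr kmulZl.
rewrite -e2 e1 kmulSl; apply: eq_tlift => a b; rewrite kmulS.
by apply: eq_tlift => c d; rewrite /G kmulZl kmulZr.
Qed.

Lemma rho1_s_comm (P : zmodType) (F : H -> A -> P) r : kbal F ->
  \sw_(h, a <- rho 𝟙) F (h ∙ s r) a = \sw_(h, a <- rho 𝟙) F (s r ∙ h) a.
Proof.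
move=> FB; have [F1 F2 F3] := FB.
have FS u a : F (\sw_(e, f <- delta 𝟙) u e f) a = \sw_(e, f <- delta 𝟙) F (u e f) a.
  by rewrite (raddf_tlift _ _ (F1 a)).
have l : linear (fun a : A => a) by [].
rewrite (rho1_PiR (kbal_comp FB (kmul_linl (s r)) l)).
rewrite (rho1_PiR (kbal_comp FB (kmul_linr (s r)) l)).
rewrite [LHS]tlift_exchange [RHS]tlift_exchange.
apply: eq_tlift => h a.
transitivity (F ((\sw_(e, f <- delta 𝟙) (eps (h ∙ f) : k) *: e) ∙ s r) a).
  by rewrite kmulSl FS.
by rewrite PiR_s_comm kmulS FS.
Qed.

Definition wca_s (r : R) : A := \sw_(h, a <- rho 𝟙) (eps (h ∙ s r) : k) *: a.
Local Notation sA := wca_s.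
Local Notation la := (lres sA (@kmul k A)).

(** Applying [rho] to the second leg of [rho 𝟙] gives [e ⊗ (h ∙ f ⊗ a)] by the weak unit axiom, and
    [eps (e ∙ s r) f] sums to [s r]. *)
Lemma rho_wca_s r : rho (sA r) = \sw_(h, a <- rho 𝟙) (h ∙ s r ⊗ a).
Proof.
rewrite /wca_s (raddf_tlift _ _ wca_rhoD).
under eq_tlift => h a do rewrite wca_rhoZ.
rewrite (@rho1_coassoc _ (fun h h' a => (((eps (h ∙ s r) : k) *: h') ⊗ a) : tensk H A)).
  rewrite tlift_exchange; apply: eq_tlift => h a.
  rewrite -[in RHS](Pi_base r) /PiL kmulS pure_suml.
  by apply: eq_tlift => e f; rewrite kmulZr.
split=> [y z u v|x|z].
- by rewrite kmulDl (wb_epsD wb) scalerDl tpureDl.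
- by bi; rewrite ?scalerDr ?tpureDl ?tpureDr // tpureZ !scalerA mulrC.
bi; first by rewrite kmulDl (wb_epsD wb) scalerDl tpureDl.
  by rewrite scalerDr tpureDl.
by rewrite kmulZl (wb_epsZ wb) scalerA mulrC.
Qed.

Lemma rho_wca_s_l r : rho (sA r) = tmap (kmul (s r)) id (rho 𝟙).
Proof. by rewrite rho_wca_s (rho1_s_comm _ (kbal_pure H A)). Qed.

(** The counit is applied to [rho (a ∙ sA r)], which by [rho_wca_s] is [rho (a ∙ 𝟙)] with [s r]
    multiplied on the right into the first leg. *)
Lemma mul_wca_s a r : a ∙ sA r = \sw_(h, b <- rho a) (eps (h ∙ s r) : k) *: b.
Proof.
have l : linear (fun a : A => a) by [].
have Hl : linear (fun h : H => h) by [].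
have Hr := kmul_linl (s r).
rewrite -[LHS]wca_counit (tlift_rhoM _ _ (eps_bal Hl l)).
rewrite -[a in RHS]kmulr1 (tlift_rhoM _ _ (eps_bal Hr l)).
apply: eq_tlift => h b; rewrite rho_wca_s tlift_tlift.
  by apply: eq_tlift => g x; rewrite kmulA.
by apply: (kbal_comp (eps_bal Hl l)); [exact: kmul_linr|exact: kmul_linr].
Qed.

Lemma wca_s_morph : is_algmorph sA.
Proof.
split=> [c x y||x y].
- rewrite /wca_s scaleS -tlift_add; apply: eq_tlift => h a.
  rewrite [s _](_ : _ = (c : k) *: s x + s y) // kmulDr kmulZr.
  by rewrite (wb_epsD wb) (wb_epsZ wb) scalerDl scalerA.
- rewrite -[RHS]wca_counit; apply: eq_tlift => h a.
  by rewrite [s _](_ : _ = 𝟙) // kmulr1.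
rewrite mul_wca_s rho_wca_s tlift_tlift.
  by apply: eq_tlift => h a; rewrite -kmulA.
exact: (eps_bal (kmul_linl (s y)) (v := id)).
Qed.

Let laP : is_module la := lres_module (kmul_module A) wca_s_morph.

Lemma rho_lact r a : rho (la r a) = tmap (kmul (s r)) id (rho a).
Proof.
have B : kbal (fun h b => s r ∙ h ⊗ b : tensk H A).
  by apply: (kbal_comp (kbal_pure H A)) => //; exact: kmul_linr.
rewrite -[X in _ = tmap _ _ (rho X)]kmul1r [RHS](tlift_rhoM _ _ B).
rewrite -[LHS]tlift_id (tlift_rhoM _ _ (kbal_pure H A)) rho_wca_s_l.
rewrite tlift_tlift; last by kb.
by apply: eq_tlift => h b; apply: eq_tlift => g x; rewrite kmulA.
Qed.

(** [rho1_PiR] leaves [e] in the first leg and [eps (h ∙ f) a] in the second, which sums to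
    [sA (Pi_R f)]. Thus [rho 𝟙] is an image of [delta 𝟙] and inherits its unitality. *)
Lemma rho1_delta1 : rho 𝟙 = \sw_(e, r <- D) (e ⊗ sA r).
Proof.
have sAl : linear sA by have [] := wca_s_morph.
rewrite tlift_base_delta1; last first.
  by apply: (kbal_comp (kbal_pure H A)).
rewrite -[LHS]tlift_id (rho1_PiR (kbal_pure H A)).
apply: eq_tlift => e f; rewrite /wca_s pure_sumr; apply: eq_tlift => h a.
by rewrite tpureZ [s _]/(PiL delta eps f) (eps_PiL wb).
Qed.

Lemma unital_delta1 : unital antipode_bij kmul (lres s kmul) (delta 𝟙).
Proof.
by have := @unital_dk k H antipode_bij H kmul (kmul_module H) _ delta_kmul 𝟙; apply.
Qed.

Lemma unital_rho1 : unital antipode_bij kmul la (rho 𝟙).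
Proof.
have Hm := kmul_module H.
have Hl : is_module (lres s kmul) := lres_module Hm (wh_s_morph H).
have [sAl _ sAM] := wca_s_morph.
have gl : linear (fun f => sA (Pi_R f)).
  by apply: (linear_comp (g := sA)) => //; exact: Pi_R_linear.
have ge r n : sA (Pi_R (lres s kmul r n)) = la r (sA (Pi_R n)).
  rewrite /lres -sAM; congr sA; apply: val_inj => /=.
  by rewrite -{1}(Pi_base r) /Pi_L (PiL_mull wb) Pi_base.
have -> : rho 𝟙 = tmap id (fun f => sA (Pi_R f)) (delta 𝟙).
  by rewrite rho1_delta1 tlift_base_delta1 //; apply: (kbal_comp (kbal_pure H A)).
rewrite /unital (@tmap_proj _ _ antipode_bij _ _ _ _ kmul kmul (lres s kmul) la) //.
rewrite (@tmap_lift _ _ antipode_bij _ _ _ _ kmul kmul (lres s kmul) la) //.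
by rewrite unital_delta1.
Qed.

Lemma unital_rho a : unital antipode_bij kmul la (rho a).
Proof.
rewrite -[a]kmul1r -wca_rhoM.
by have := @unital_tact k H antipode_bij H kmul (kmul_module H) A sA wca_s_morph
  A kmul (kmul_module A) (rho 𝟙) (rho a) unital_rho1; apply.
Qed.

Local Notation rhoR := (base_coact antipode_bij kmul la rho).

Lemma rhoR1 : rhoR 𝟙 = 𝟙 ⊗ 𝟙.
Proof.
have Hm := kmul_module H.
rewrite /base_coact rho1_delta1 base_projS // -(base_delta1_counit antipode_bij).
rewrite pure_suml; apply: eq_tlift => e r.
rewrite base_proj_pure // [RHS](tpure_bal (rres t kmul) la).
by rewrite /lres kmulr1.
Qed.

(** Both sides come from [a_<-2> eps (a_<-1> ∙ s r) ⊗ a_<0>], the left one by [mul_tau] and the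
    right one by [mul_wca_s]. *)
Lemma rho_takeuchi a : in_takeuchi (rhoR a).
Proof.
have Hm := kmul_module H.
move=> r; rewrite !tlift_proj; last 2 first.
- split=> [n x y|m x y|m i n].
  + by rewrite tpureDl.
  + by rewrite kmulDl tpureDr.
  by rewrite (tpure_bal (rres t kmul) la) /lres kmulA.
- split=> [n x y|m x y|m i n].
  + by rewrite kmulDl tpureDl.
  + by rewrite tpureDr.
  by rewrite /rres -kmulA (tpure_bal (rres t kmul) la).
have e : \sw_(h, b <- rho a) (h ∙ t r ⊗ b)
    = \sw_(h, b <- rho a) (h ⊗ (b ∙ sA r)) :> tensk H A.
  under [RHS]eq_tlift => h b do rewrite mul_wca_s pure_sumr.
  under [RHS]eq_tlift => h b.
    under eq_tlift => h' b' do rewrite tpureZ.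
    over.
  rewrite -(comod_coassoc3 rhoP (G := fun h h' b =>
    ((eps (h' ∙ s r) : k) *: h) ⊗ b : tensk H A)).
    apply: eq_tlift => h b.
    by rewrite wh_tE (mul_tau wb) pure_suml.
  split=> [y z u v|x|z].
  - by rewrite scalerDr tpureDl.
  - bi; first by rewrite kmulDl (wb_epsD wb) scalerDl tpureDl.
      by rewrite tpureDr.
    by rewrite kmulZl (wb_epsZ wb) tpureZ scalerA.
  bi; first by rewrite scalerDr tpureDl.
    by rewrite kmulDl (wb_epsD wb) scalerDl tpureDl.
  by rewrite kmulZl (wb_epsZ wb) scalerA mulrC.
have := congr1 (base_proj antipode_bij kmul la) e; rewrite !base_projS //.
under eq_tlift => x y do rewrite base_proj_pure //.
by move=> ->; apply: eq_tlift => x y; rewrite base_proj_pure.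
Qed.

(** With this, [comodule_iff] at [C := H] concerns the counit of the bialgebroid. *)
Lemma Pi_R_counit : base_counit kmul eps = @Pi_R k H.
Proof. by apply: funext => x; rewrite Pi_R_delta1. Qed.

Lemma rhoR_comodule :
  is_comodule (wh_deltaR antipode_bij) (@Pi_R k H) rhoR.
Proof.
rewrite -Pi_R_counit.
by have [+ _] := @comodule_iff k H antipode_bij H kmul (kmul_module H) eps
  (wb_epsD wb) (wb_epsZ wb) (wb_epsM2 wb) delta (wb_deltaD wb) delta_kmul
  A la laP rho wca_rhoD rho_lact unital_rho; apply.
Qed.

Lemma rhoRM a b : rhoR (a ∙ b) = tmul kmul kmul (rhoR a) (rhoR b).
Proof.
rewrite [in LHS]/base_coact -wca_rhoM.
by have := @proj_tact k H antipode_bij H kmul (kmul_module H) A sA wca_s_morph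
  A kmul (kmul_module A) (rho a) (rho b) (rho_takeuchi a); apply.
Qed.

End WeakComoduleAlgebra.

(** * From comodule algebras over the base to weak ones *)

Section StrongComoduleAlgebra.
Variables (k : comPzRingType) (H : weakHopf k).
Hypothesis antipode_bij : bijective (@antipode k H).

Local Notation R := (base H).
Local Notation BH := (wh_bialgebroid antipode_bij).
Local Notation delta := (@wh_delta k H).
Local Notation eps := (@wh_eps k H).
Local Notation wb := (wh_bialg H).
Local Notation s := (@wh_s k H).
Local Notation D := (base_delta1 H).

Variable A : comod_algebra BH.
Local Notation sA := (@ca_s k R BH A).
Local Notation la := (lres sA (@kmul k A)).
Let Hm := kmul_module H.
Let laP : is_module la := lres_module (kmul_module A) (ca_s_morph A).

Definition ca_weak_rho (a : A) : tensk H A := base_lift (ca_rho a).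
Local Notation rk := ca_weak_rho.

Lemma ca_weak_rhoK : base_coact antipode_bij kmul la rk = @ca_rho k R BH A.
Proof. by apply: funext => a; rewrite /base_coact base_liftK. Qed.

Lemma ca_weak_rhoD : {morph rk : x y / x + y}.
Proof. by move=> x y; rewrite /rk (comod_rhoD (ca_comod A)) base_liftD. Qed.

Lemma ca_weak_rhol r a : rk (la r a) = tmap (kmul (s r)) id (rk a).
Proof. by rewrite /rk (comod_rhol (ca_comod A)) base_lift_lact. Qed.

Lemma ca_weak_rho_unital a : unital antipode_bij kmul la (rk a).
Proof. exact: unital_lift. Qed.

Lemma ca_weak_comod : is_comodule delta eps rk.
Proof.
have [_] := @comodule_iff k H antipode_bij H kmul Hm eps
  (wb_epsD wb) (wb_epsZ wb) (wb_epsM2 wb) delta (wb_deltaD wb) (@delta_kmul k H)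
  A la laP rk ca_weak_rhoD ca_weak_rhol ca_weak_rho_unital; apply.
rewrite ca_weak_rhoK Pi_R_counit; exact: (ca_comod A).
Qed.

Lemma ca_weak_rhoM a b : tmul kmul kmul (rk a) (rk b) = rk (a ∙ b).
Proof.
have tk : in_takeuchi (base_proj antipode_bij kmul la (rk a)).
  by rewrite base_liftK //; exact: (@ca_takeuchi k R BH A a).
have [_ h] := @tact_iff k H antipode_bij H kmul Hm A sA (ca_s_morph A)
  A kmul (kmul_module A) (rk a) (rk b) (rk (a ∙ b)) tk
  (ca_weak_rho_unital a) (ca_weak_rho_unital _).
apply/esym/h; rewrite !base_liftK //; exact: (@ca_rhoM k R BH A a b).
Qed.

Lemma ca_weak_rho1E : rk 𝟙 = \sw_(e, r <- D) (e ⊗ sA r).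
Proof.
rewrite /rk ca_rho1 /base_lift tlift_pure; last exact: base_lift_bal.
by apply: eq_tlift => e r; rewrite /lres !kmulr1.
Qed.

Lemma ca_weak_s_bal : kbal (fun e r => e ⊗ sA r : tensk H A).
Proof.
have [sAl _ _] := ca_s_morph A.
by apply: (kbal_comp (kbal_pure H A)).
Qed.

(** Linearity of [rk] turns the left side into [e ⊗ (s r ∙ e' ⊗ sA r')], and the right side is
    [e ⊗ (e' ∙ s r ⊗ sA r')]; they agree by [base_delta1_comm]. *)
Lemma ca_weak_rho1 :
  \sw_(h, a <- rk 𝟙) (h ⊗ rk a)
  = \sw_(e, f <- delta 𝟙) \sw_(h, a <- rk 𝟙) (e ⊗ (h ∙ f ⊗ a))
  :> tens3 klact kract klact.
Proof.
have B := coassocr_kbal Hm laP ca_weak_rhoD ca_weak_rhol.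
rewrite -(@tlift_delta1 _ _ _ (fun e f => \sw_(h, a <- rk 𝟙) (e ⊗ (h ∙ f ⊗ a))
  : tens3 klact kract klact)); last first.
  split=> [n x y|m x y|m i n]; rewrite -?tlift_add; apply: eq_tlift => a b.
  - by rewrite tpureDl.
  - by rewrite kmulDr tpureDl tpureDr.
  rewrite /klact /kract kmulZr -[_ *: m]/(kract m i).
  rewrite (tpure_bal kract (tlact klact)) /tlact /tmap tlift_pure //.
  by kb.
rewrite ca_weak_rho1E tlift_tlift //; apply: eq_tlift => e r.
have -> : sA r = la r 𝟙 by rewrite /lres kmulr1.
rewrite ca_weak_rhol ca_weak_rho1E /tmap tlift_tlift; last by kb.
rewrite -(@base_delta1_comm _ _ _ (fun e r => e ⊗ sA r : tensk H A) _ ca_weak_s_bal).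
have B2 : kbal (fun h a => e ⊗ (h ∙ s r ⊗ a)
    : tens3 (@klact k H) (@kract k H) (@klact k A)).
  split=> [n x y|m x y|m i n].
  - by rewrite kmulDl tpureDl tpureDr.
  - by rewrite !tpureDr.
  by rewrite /kract kmulZl -tpureZ.
by rewrite (tlift_tlift _ _ _ B2) pure_sumr.
Qed.

Definition wca_of_ca : wcomod_algebra H :=
  WComodAlgebra ca_weak_comod ca_weak_rhoM ca_weak_rho1.

(** With [delta 𝟙 = e ⊗ r'], the sum of [eps (e ∙ s r) *: r'] is [Pi_R (s r) = r], so the source map
    is recovered from the coaction. *)
Lemma wca_of_ca_s r : wca_s wca_of_ca r = sA r.
Proof.
have [sAl _ _] := ca_s_morph A.
rewrite /wca_s /= ca_weak_rho1E tlift_tlift.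
  rewrite -[in RHS](Pi_R_s r) Pi_R_delta1 (raddf_tlift _ _ (linD sAl)).
  by apply: eq_tlift => e r'; rewrite (linZ sAl).
bi; first by rewrite kmulDl (wb_epsD wb) scalerDl.
  by rewrite scalerDr.
by rewrite kmulZl (wb_epsZ wb) scalerA mulrC.
Qed.

End StrongComoduleAlgebra.

(** * Isomorphisms of concrete categories *)

(** Functors are compared for equality, so maps between carriers of objects that are only provably
    equal have to be transported. Proof irrelevance collapses transport along a loop. *)
Definition cast (A B : Type) (e : A = B) (x : A) : B := eq_rect A id x B e.

Lemma cast_id (A : Type) (e : A = A) x : cast e x = x.
Proof. by rewrite (Prop_irrelevance e erefl). Qed.

Lemma cast_comp (A B C : Type) (e : A = B) (e' : B = C) x :
  cast e' (cast e x) = cast (etrans e e') x.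
Proof. by case: C / e'; case: B / e. Qed.

Definition fun_cast (A B A' B' : Type) (eA : A' = A) (eB : B' = B) (f : A -> B) :
  A' -> B' := fun x => cast (esym eB) (f (cast eA x)).

Definition hom_cast (C : category) (X X' Y Y' : C) (eX : X = X') (eY : Y = Y')
    (f : hom X Y) : hom X' Y' :=
  eq_rect X (fun Z => hom Z Y') (eq_rect Y (hom X) f Y' eY) X' eX.

Lemma functor_eq (C D : category) (F G : functor C D) (e : forall X, F X = G X) :
  (forall X Y (f : hom X Y), hom_cast (e X) (e Y) (fmap F f) = fmap G f) ->
  F = G.
Proof.
case: F G e => [F f f1 fM] [G g g1 gM] /= e.
have E : F = G by apply: funext.
case: G / E in g g1 gM e * => h.
have E : f = g.
  apply: functional_extensionality_dep => X.
  apply: functional_extensionality_dep => Y.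
  apply: functional_extensionality_dep => a.
  by rewrite -h (Prop_irrelevance (e X) erefl) (Prop_irrelevance (e Y) erefl).
case: g / E in g1 gM h *.
by rewrite (Prop_irrelevance f1 g1) (Prop_irrelevance fM gM).
Qed.

Section ConcreteFunctors.
Variables (O1 O2 : Type) (car1 : O1 -> Type) (car2 : O2 -> Type).
Variable P1 : forall X Y : O1, (car1 X -> car1 Y) -> Prop.
Variable P2 : forall X Y : O2, (car2 X -> car2 Y) -> Prop.
Variable P1_id : forall X, P1 (X := X) (Y := X) id.
Variable P1_comp : forall X Y Z (g : car1 Y -> car1 Z) (f : car1 X -> car1 Y),
  P1 g -> P1 f -> P1 (g \o f).
Variable P2_id : forall X, P2 (X := X) (Y := X) id.
Variable P2_comp : forall X Y Z (g : car2 Y -> car2 Z) (f : car2 X -> car2 Y),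
  P2 g -> P2 f -> P2 (g \o f).

Local Notation C1 := (concrete_category P1_id P1_comp).
Local Notation C2 := (concrete_category P2_id P2_comp).

Variable F : O1 -> O2.
Variable carF : forall X, car2 (F X) = car1 X.
Hypothesis PF : forall X Y (f : car1 X -> car1 Y),
  P1 f -> P2 (fun_cast (carF X) (carF Y) f).

Definition concrete_fmap (X Y : C1) (f : hom X Y) : @hom C2 (F X) (F Y) :=
  exist _ (fun_cast (carF X) (carF Y) (sval f)) (PF (svalP f)).

Lemma concrete_fmap1 X : concrete_fmap (@idm C1 X) = @idm C2 (F X).
Proof.
apply: chomP; apply: funext => x.
by rewrite /= /fun_cast cast_comp cast_id.
Qed.

Lemma concrete_fmapM (X Y Z : C1) (g : hom Y Z) (f : hom X Y) :
  concrete_fmap (comp g f) = @comp C2 _ _ _ (concrete_fmap g) (concrete_fmap f).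
Proof.
apply: chomP; apply: funext => x.
by rewrite /= /fun_cast /= cast_comp cast_id.
Qed.

Definition concrete_functor : functor C1 C2 :=
  Functor concrete_fmap1 concrete_fmapM.

End ConcreteFunctors.

Lemma sval_hom_cast (O : Type) (car : O -> Type)
    (P : forall X Y : O, (car X -> car Y) -> Prop) (P1 : forall X, P X X id)
    (PM : forall X Y Z (g : car Y -> car Z) (f : car X -> car Y),
      P _ _ g -> P _ _ f -> P _ _ (g \o f))
    (X X' Y Y' : concrete_category P1 PM) (eX : X = X') (eY : Y = Y')
    (f : hom X Y) :
  sval (hom_cast eX eY f)
  = fun_cast (congr1 car (esym eX)) (congr1 car (esym eY)) (sval f).
Proof. by case: X' / eX; case: Y' / eY. Qed.

Section ConcreteIso.
Variables (O1 O2 : Type) (car1 : O1 -> Type) (car2 : O2 -> Type).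
Variable P1 : forall X Y : O1, (car1 X -> car1 Y) -> Prop.
Variable P2 : forall X Y : O2, (car2 X -> car2 Y) -> Prop.
Variable P1_id : forall X, P1 (X := X) (Y := X) id.
Variable P1_comp : forall X Y Z (g : car1 Y -> car1 Z) (f : car1 X -> car1 Y),
  P1 g -> P1 f -> P1 (g \o f).
Variable P2_id : forall X, P2 (X := X) (Y := X) id.
Variable P2_comp : forall X Y Z (g : car2 Y -> car2 Z) (f : car2 X -> car2 Y),
  P2 g -> P2 f -> P2 (g \o f).
Variables (F : O1 -> O2) (G : O2 -> O1).
Variable carF : forall X, car2 (F X) = car1 X.
Variable carG : forall X, car1 (G X) = car2 X.
Hypothesis PF : forall X Y (f : car1 X -> car1 Y),
  P1 f -> P2 (fun_cast (carF X) (carF Y) f).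
Hypothesis PG : forall X Y (f : car2 X -> car2 Y),
  P2 f -> P1 (fun_cast (carG X) (carG Y) f).

(** Equality on objects suffices: the underlying map of a morphism is merely transported, and the
    composite transport runs along a loop. *)
Lemma concrete_comp_id : (forall X, G (F X) = X) ->
  functor_comp (concrete_functor P2_id P2_comp P1_id P1_comp PG)
    (concrete_functor P1_id P1_comp P2_id P2_comp PF)
  = functor_id (concrete_category P1_id P1_comp).
Proof.
move=> GF; set K := LHS.
have e X : K X = functor_id _ X := GF X.
apply: (functor_eq (e := e)) => X Y f.
apply: chomP; rewrite sval_hom_cast; apply: funext => x.
by rewrite /= /fun_cast /= !cast_comp !cast_id.
Qed.

End ConcreteIso.

Lemma concrete_iso (O1 O2 : Type) (car1 : O1 -> Type) (car2 : O2 -> Type)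
    (P1 : forall X Y : O1, (car1 X -> car1 Y) -> Prop)
    (P2 : forall X Y : O2, (car2 X -> car2 Y) -> Prop)
    (P1_id : forall X, P1 X X id)
    (P1_comp : forall X Y Z (g : car1 Y -> car1 Z) (f : car1 X -> car1 Y),
      P1 _ _ g -> P1 _ _ f -> P1 _ _ (g \o f))
    (P2_id : forall X, P2 X X id)
    (P2_comp : forall X Y Z (g : car2 Y -> car2 Z) (f : car2 X -> car2 Y),
      P2 _ _ g -> P2 _ _ f -> P2 _ _ (g \o f))
    (F : O1 -> O2) (G : O2 -> O1)
    (carF : forall X, car2 (F X) = car1 X) (carG : forall X, car1 (G X) = car2 X)
    (PF : forall X Y (f : car1 X -> car1 Y),
      P1 _ _ f -> P2 _ _ (fun_cast (carF X) (carF Y) f))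
    (PG : forall X Y (f : car2 X -> car2 Y),
      P2 _ _ f -> P1 _ _ (fun_cast (carG X) (carG Y) f)) :
  (forall X, G (F X) = X) -> (forall Y, F (G Y) = Y) ->
  is_isofunctor (concrete_functor P1_id P1_comp P2_id P2_comp PF).
Proof.
move=> GF FG; exists (concrete_functor P2_id P2_comp P1_id P1_comp PG).
by split; apply: concrete_comp_id.
Qed.

Section ProductFunctor.
Variables (C D C' D' : category) (F : functor C C') (G : functor D D').

Definition product_fmap (X Y : product_category C D) (f : hom X Y) :
    @hom (product_category C' D') (F X.1, G X.2) (F Y.1, G Y.2) :=
  (fmap F f.1, fmap G f.2).

Lemma product_fmap1 X :
  product_fmap (@idm (product_category C D) X) = @idm (product_category C' D') _.
Proof. by rewrite /product_fmap !fmap1. Qed.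

Lemma product_fmapM X Y Z (g : @hom (product_category C D) Y Z) (f : hom X Y) :
  product_fmap (comp g f)
  = @comp (product_category C' D') _ _ _ (product_fmap g) (product_fmap f).
Proof. by rewrite /product_fmap !fmapM. Qed.

Definition product_functor :
    functor (product_category C D) (product_category C' D') :=
  Functor product_fmap1 product_fmapM.

End ProductFunctor.

Lemma product_functor_id C D :
  product_functor (functor_id C) (functor_id D)
  = functor_id (product_category C D).
Proof.
(* A pair agrees with the pair of its projections only up to [surjective_pairing], hence the object
   equalities. *)
set K := LHS; have e X : K X = functor_id _ X := esym (surjective_pairing X).
apply: (functor_eq (e := e)) => -[X X'] [Y Y'] [f f'].
by rewrite (Prop_irrelevance (e (X, X')) erefl)
  (Prop_irrelevance (e (Y, Y')) erefl).
Qed.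

Lemma product_functor_comp (C D C' D' C'' D'' : category) (F : functor C C')
    (G : functor D D') (F' : functor C' C'') (G' : functor D' D'') :
  functor_comp (product_functor F' G') (product_functor F G)
  = product_functor (functor_comp F' F) (functor_comp G' G).
Proof.
by set K := LHS; set L := RHS; apply: (@functor_eq _ _ K L (fun X => erefl)).
Qed.

Lemma product_iso (C D C' D' : category) (F : functor C C') (G : functor D D') :
  is_isofunctor F -> is_isofunctor G -> is_isofunctor (product_functor F G).
Proof.
case=> F' [F'F FF'] [G' [G'G GG']]; exists (product_functor F' G').
by rewrite !product_functor_comp F'F FF' G'G GG' !product_functor_id.
Qed.

(** * The correspondence *)

Section Extensionality.
Variables (k : comPzRingType) (H : weakHopf k).

(** A round trip keeps the algebra and changes only the coaction and the proofs, and axioms are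
    propositions. The lemmas that follow treat the other structures likewise. *)
Lemma wca_eq (A : wcomod_algebra H) r p1 p2 p3 :
  (forall a, r a = wca_rho (w := A) a) -> @WComodAlgebra k H A r p1 p2 p3 = A.
Proof.
case: A r p1 p2 p3 => A r0 q1 q2 q3 /= r p1 p2 p3 /funext E.
case: r0 / E in q1 q2 q3 *.
by rewrite (Prop_irrelevance p1 q1) (Prop_irrelevance p2 q2)
  (Prop_irrelevance p3 q3).
Qed.

Lemma wmc_eq (C : wmod_coalgebra H) d e p1 p2 p3 p4 :
  (forall c, d c = wmc_delta (w := C) c) -> (forall c, e c = wmc_eps (w := C) c) ->
  @WModCoalgebra k H C (wmc_act (w := C)) d e p1 p2 p3 p4 = C.
Proof.
case: C d e p1 p2 p3 p4 => C act d0 e0 q1 q2 q3 q4 /= d e p1 p2 p3 p4.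
move=> /funext Ed /funext Ee.
case: d0 / Ed in q1 q2 q3 q4 *; case: e0 / Ee in q1 q2 q3 q4 *.
by rewrite (Prop_irrelevance p1 q1) (Prop_irrelevance p2 q2)
  (Prop_irrelevance p3 q3) (Prop_irrelevance p4 q4).
Qed.

Lemma wdm_eq (A : wcomod_algebra H) (C : wmod_coalgebra H) (M : wdk_module A C)
    r p1 p2 p3 :
  (forall m, r m = wdm_rho (w := M) m) ->
  @WDKModule k H A C M (wdm_act (w := M)) r p1 p2 p3 = M.
Proof.
case: M r p1 p2 p3 => M act r0 q1 q2 q3 /= r p1 p2 p3 /funext E.
case: r0 / E in q1 q2 q3 *.
by rewrite (Prop_irrelevance p1 q1) (Prop_irrelevance p2 q2)
  (Prop_irrelevance p3 q3).
Qed.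

Variables (R : kalgType k) (B : bialgebroid R).

(* The coactions of the two sides have different types, the balancing depending
   on the source map, so they are compared through a common lift [u]. *)
Lemma ca_eq (A : comod_algebra B) (u : A -> tensk B A) s r p1 p2 p3 p4 p5 :
  (forall x, s x = ca_s A x) -> (forall a, r a = tmap id id (u a)) ->
  (forall a, ca_rho a = tmap id id (u a)) ->
  @ComodAlgebra k R B A s r p1 p2 p3 p4 p5 = A.
Proof.
case: A u s r p1 p2 p3 p4 p5 => A s0 r0 q1 q2 q3 q4 q5 /= u s r p1 p2 p3 p4 p5.
move=> /funext Es; case: s0 / Es in r0 q1 q2 q3 q4 q5 * => Er Er0.
have E : r = r0 by apply: funext => a; rewrite Er Er0.
case: r0 / E in Er0 q1 q2 q3 q4 q5 *.
by rewrite (Prop_irrelevance p1 q1) (Prop_irrelevance p2 q2)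
  (Prop_irrelevance p3 q3) (Prop_irrelevance p4 q4) (Prop_irrelevance p5 q5).
Qed.

Lemma mc_eq (C : mod_coalgebra B) d e p1 p2 p3 p4 :
  (forall c, d c = mc_delta (m := C) c) -> (forall c, e c = mc_eps (m := C) c) ->
  @ModCoalgebra k R B C (mc_act (m := C)) d e p1 p2 p3 p4 = C.
Proof.
case: C d e p1 p2 p3 p4 => C act d0 e0 q1 q2 q3 q4 /= d e p1 p2 p3 p4.
move=> /funext Ed /funext Ee.
case: d0 / Ed in q1 q2 q3 q4 *; case: e0 / Ee in q1 q2 q3 q4 *.
by rewrite (Prop_irrelevance p1 q1) (Prop_irrelevance p2 q2)
  (Prop_irrelevance p3 q3) (Prop_irrelevance p4 q4).
Qed.

Lemma dm_eq (A : comod_algebra B) (C : mod_coalgebra B) (M : dk_module A C)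
    r p1 p2 p3 :
  (forall m, r m = dm_rho (d := M) m) ->
  @DKModule k R B A C M (dm_act (d := M)) r p1 p2 p3 = M.
Proof.
case: M r p1 p2 p3 => M act r0 q1 q2 q3 /= r p1 p2 p3 /funext E.
case: r0 / E in q1 q2 q3 *.
by rewrite (Prop_irrelevance p1 q1) (Prop_irrelevance p2 q2)
  (Prop_irrelevance p3 q3).
Qed.

End Extensionality.

Section Correspondence.
Variables (k : comPzRingType) (H : weakHopf k).
Hypothesis antipode_bij : bijective (@antipode k H).

Local Notation R := (base H).
Local Notation BH := (wh_bialgebroid antipode_bij).
Local Notation delta := (@wh_delta k H).
Local Notation eps := (@wh_eps k H).
Local Notation wb := (wh_bialg H).
Local Notation s := (@wh_s k H).
Let Hm := kmul_module H.

Definition ca_of_wca (A : wcomod_algebra H) : comod_algebra BH :=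
  @ComodAlgebra k R BH A (@wca_s k H A) _
    (wca_s_morph A) (rhoR_comodule antipode_bij A) (@rho_takeuchi k H antipode_bij A)
    (rhoR1 antipode_bij A) (@rhoRM k H antipode_bij A).

Lemma wca_of_caK (A : wcomod_algebra H) : wca_of_ca (ca_of_wca A) = A.
Proof. by apply: wca_eq => a; exact: unital_rho. Qed.

Lemma ca_of_wcaK (A : comod_algebra BH) : ca_of_wca (wca_of_ca A) = A.
Proof.
apply: (@ca_eq k R BH A (@ca_weak_rho k H antipode_bij A)) => [r|//|a].
  exact: wca_of_ca_s.
rewrite -[RHS]/(base_proj antipode_bij kmul _ (ca_weak_rho a)) base_liftK //.
exact: (lres_module (kmul_module A) (ca_s_morph A)).
Qed.

(** A unital colinear map carries [rho 𝟙] to [rho 𝟙], from which the source map is read off. *)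
Lemma wca_hom_s (A B : wcomod_algebra H) (f : A -> B) r :
  wca_hom f -> f (wca_s A r) = wca_s B r.
Proof.
case=> -[fl f1 _] fr; rewrite /wca_s (raddf_tlift _ _ (linD fl)).
rewrite -f1 fr tlift_tlift.
  by apply: eq_tlift => h a; rewrite (linZ fl).
bi; first by rewrite kmulDl (wb_epsD wb) scalerDl.
  by rewrite scalerDr.
by rewrite kmulZl (wb_epsZ wb) scalerA mulrC.
Qed.

Lemma ca_of_wca_hom (A B : wcomod_algebra H) (f : A -> B) :
  wca_hom f -> @ca_hom k R BH (ca_of_wca A) (ca_of_wca B) f.
Proof.
move=> fP; have [fa fr] := fP; have [fl _ fM] := fa.
split=> // [r|a]; first exact: wca_hom_s.
rewrite /= /base_coact fr.
apply: (@tmap_proj k H antipode_bij H H A B kmul kmul _ _ id f) => //.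
- exact: (lres_module (kmul_module A) (wca_s_morph A)).
- exact: (lres_module (kmul_module B) (wca_s_morph B)).
by move=> r b; rewrite /lres fM wca_hom_s.
Qed.

Lemma wca_of_ca_hom (A B : comod_algebra BH) (f : A -> B) :
  ca_hom f -> @wca_hom k H (wca_of_ca A) (wca_of_ca B) f.
Proof.
case=> fa fs fr; have [fl _ fM] := fa.
split=> // a; rewrite /= /ca_weak_rho fr.
apply: (@tmap_lift k H antipode_bij H H A B kmul kmul _ _ id f) => //.
- exact: (lres_module (kmul_module A) (ca_s_morph A)).
- exact: (lres_module (kmul_module B) (ca_s_morph B)).
by move=> r b; rewrite /lres fM fs.
Qed.

(** * Module coalgebras in both directions *)

Section WeakToStrong.
Variable C : wmod_coalgebra H.
Local Notation act := (@wmc_act k H C).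
Local Notation dk := (@wmc_delta k H C).
Local Notation ek := (@wmc_eps k H C).
Let actP : is_module act := wmc_module C.

Lemma wmc_deltaD : {morph dk : x y / x + y}.
Proof. exact: (coring_deltaD (wmc_coalg C)). Qed.

Lemma wmc_epsD x y : ek (x + y) = ek x + ek y.
Proof. exact: (coring_epsD (wmc_coalg C)). Qed.

Lemma wmc_epsZ (c : k) x : ek (c *: x) = c * ek x.
Proof. exact: (coring_epsl (wmc_coalg C) c). Qed.

Lemma wmc_unital c : unital antipode_bij act (lres s act) (dk c).
Proof. by apply: unital_dk => //; exact: (@wmc_deltaM k H C). Qed.

Lemma base_coring :
  is_coring (base_cop antipode_bij act dk) (base_counit act ek).
Proof.
have [+ _] := @coring_iff k H antipode_bij C act actP ek wmc_epsD wmc_epsZ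
  (@wmc_epsM k H C) dk wmc_deltaD (@wmc_deltaM k H C).
by apply; exact: wmc_coalg.
Qed.

Lemma base_copM h c :
  base_cop antipode_bij act dk (act h c)
  = \sw_(h1, h2 <- wh_deltaR antipode_bij h)
      \sw_(c1, c2 <- base_cop antipode_bij act dk c) (act h1 c1 ⊗ act h2 c2).
Proof.
rewrite {1}/base_cop wmc_deltaM.
by have := @proj_tact k H antipode_bij C act actP H s (wh_s_morph H) C act actP
  (delta h) (dk c) (wh_takeuchi antipode_bij h); apply.
Qed.

Definition mc_of_wmc : mod_coalgebra BH :=
  @ModCoalgebra k R BH C act _ _ actP base_coring base_copM
    (base_counitM actP wmc_epsD wmc_epsZ (@wmc_epsM k H C)).

End WeakToStrong.

Section StrongToWeak.
Variable C : mod_coalgebra BH.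
Local Notation act := (@mc_act k R BH C).
Let actP : is_module act := mc_module C.
Local Notation laC := (lres s act).
Let laP : is_module laC := lres_module actP (wh_s_morph H).
Local Notation eR := (@mc_eps k R BH C).

Definition mc_weak_delta (c : C) : tensk C C := base_lift (mc_delta c).
Local Notation dk := mc_weak_delta.
Definition mc_weak_eps : C -> k^o := weak_counit eR.
Local Notation ek := mc_weak_eps.

Lemma mc_weak_deltaK : base_cop antipode_bij act dk = @mc_delta k R BH C.
Proof. by apply: funext => a; rewrite /base_cop base_liftK. Qed.

Lemma mc_weak_deltaD : {morph dk : x y / x + y}.
Proof. by move=> x y; rewrite /dk (coring_deltaD (mc_coring C)) base_liftD. Qed.

Lemma mc_epsD : {morph eR : x y / x + y}.
Proof. exact: (coring_epsD (mc_coring C)). Qed.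

Lemma mc_weak_deltaM h c :
  dk (act h c) = \sw_(h1, h2 <- delta h) \sw_(c1, c2 <- dk c)
    (act h1 c1 ⊗ act h2 c2).
Proof.
have u : unital antipode_bij kmul (lres s kmul) (delta h).
  by have := @unital_dk k H antipode_bij H kmul Hm _ (@delta_kmul k H) h; apply.
have [_ e] := @tact_iff k H antipode_bij C act actP H s (wh_s_morph H) C act actP
  (delta h) (dk c) (dk (act h c)) (wh_takeuchi antipode_bij h) u
  (unital_lift actP laP _).
apply: e; rewrite !base_liftK //; exact: (@mc_deltaM k R BH C h c).
Qed.

Lemma mc_weak_epsM h g c : ek (act (h ∙ g) c)
  = \sw_(g1, g2 <- delta g) (eps (h ∙ g2) * ek (act g1 c)).
Proof. apply: weak_counitM; exact: (@mc_epsM k R BH C). Qed.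

Lemma mc_weak_coalg : is_coalgebra dk ek.
Proof.
have eM := @mc_epsM k R BH C.
have [_] := @coring_iff k H antipode_bij C act actP ek (weak_counitD mc_epsD)
  (weak_counitZ actP eM) mc_weak_epsM dk mc_weak_deltaD mc_weak_deltaM; apply.
have -> : base_counit act ek = eR by apply: funext => c; exact: weak_counitK.
rewrite mc_weak_deltaK; exact: (@mc_coring k R BH C).
Qed.

Definition wmc_of_mc : wmod_coalgebra H :=
  @WModCoalgebra k H C act dk ek actP mc_weak_coalg mc_weak_deltaM mc_weak_epsM.

End StrongToWeak.

Lemma wmc_of_mcK (C : wmod_coalgebra H) : wmc_of_mc (mc_of_wmc C) = C.
Proof.
apply: wmc_eq => c; first exact: wmc_unital.
exact: (base_counitK (wmc_module C) (@wmc_epsD C) (@wmc_epsZ C) (@wmc_epsM k H C)).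
Qed.

Lemma mc_of_wmcK (C : mod_coalgebra BH) : mc_of_wmc (wmc_of_mc C) = C.
Proof.
apply: (@mc_eq k R BH C) => c; first by rewrite /= mc_weak_deltaK.
apply: weak_counitK; exact: (@mc_epsM k R BH C).
Qed.

Lemma mc_of_wmc_hom (C D : wmod_coalgebra H) (f : C -> D) :
  wmc_hom f -> @mc_hom k R BH (mc_of_wmc C) (mc_of_wmc D) f.
Proof.
case=> fl fa fd fe; split=> // c; last first.
  by apply: eq_tlift => e r; rewrite -fa fe.
rewrite /= /base_cop fd.
have CP := wmc_module C; have DP := wmc_module D.
apply: (@tmap_proj k H antipode_bij C D C D _ _ _ _ f f) => //.
- exact: (lres_module CP (wh_s_morph H)).
- exact: (lres_module DP (wh_s_morph H)).
by move=> r b; rewrite /lres fa.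
Qed.

Lemma wmc_of_mc_hom (C D : mod_coalgebra BH) (f : C -> D) :
  mc_hom f -> @wmc_hom k H (wmc_of_mc C) (wmc_of_mc D) f.
Proof.
case=> fl fa fd fe; split=> // c; last by rewrite /= /mc_weak_eps /weak_counit fe.
rewrite /= /mc_weak_delta fd.
have CP := mc_module C; have DP := mc_module D.
apply: (@tmap_lift k H antipode_bij C D C D _ _ _ _ f f) => //.
- exact: (lres_module CP (wh_s_morph H)).
- exact: (lres_module DP (wh_s_morph H)).
by move=> r b; rewrite /lres fa.
Qed.

(** * Modules over corresponding data *)

Section Modules.
Variables (A : wcomod_algebra H) (C : wmod_coalgebra H).
Local Notation act := (@wmc_act k H C).
Local Notation AR := (ca_of_wca A).
Local Notation CR := (mc_of_wmc C).
Let actP : is_module act := wmc_module C.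

Section WeakToStrong.
Variable M : wdk_module A C.
Local Notation la := (lres (@wca_s k H A) (@wdm_act k H A C M)).
Local Notation rk := (@wdm_rho k H A C M).
Let mP := wdm_module M.
Let laP : is_module la := lres_module mP (wca_s_morph A).

Lemma wdm_rhoD : {morph rk : x y / x + y}.
Proof. exact: (comod_rhoD (wdm_comod M)). Qed.

(** By [rho_wca_s_l], [rho (sA r)] is [rho 𝟙] with [s r] in front of the first leg, so the
    compatibility of [rk] with the action of [A] gives linearity over the base. *)
Lemma wdm_rhol r m : rk (la r m) = tmap (act (s r)) id (rk m).
Proof.
have B : kbal (fun h b => \sw_(c, n <- rk m) (act h c ⊗ wdm_act b n) : tensk C M).
  exact: kbal_tact.
rewrite {1}/lres wdm_rhoM rho_wca_s_l tlift_tlift //.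
rewrite -[m in RHS](mod1 mP) wdm_rhoM.
have BL : kbal (fun c n => act (s r) c ⊗ n : tensk C M) by exact: kbal_lact.
rewrite [RHS](raddf_tlift _ _ (tliftD BL)); apply: eq_tlift => h b.
rewrite tlift_tlift //; apply: eq_tlift => c n.
by rewrite (modM actP).
Qed.

Lemma wdm_unital m : unital antipode_bij act la (rk m).
Proof.
rewrite -[m](mod1 mP) wdm_rhoM.
by have := @unital_tact k H antipode_bij C act actP A _ (wca_s_morph A) M _ mP
  (wca_rho 𝟙) (rk m) (unital_rho1 antipode_bij A); apply.
Qed.

Lemma wdm_base_comod :
  is_comodule (@mc_delta k R BH CR) (@mc_eps k R BH CR)
    (base_coact antipode_bij act la rk).
Proof.
have [+ _] := @comodule_iff k H antipode_bij C act actP (@wmc_eps k H C)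
  (@wmc_epsD C) (@wmc_epsZ C) (@wmc_epsM k H C) (@wmc_delta k H C)
  (@wmc_deltaD C) (@wmc_deltaM k H C) M la laP rk wdm_rhoD wdm_rhol wdm_unital.
by apply; exact: wdm_comod.
Qed.

Lemma wdm_base_rhoM a m :
  base_coact antipode_bij act la rk (wdm_act a m)
  = \sw_(h, b <- @ca_rho k R BH AR a)
      \sw_(c, n <- base_coact antipode_bij act la rk m) (act h c ⊗ wdm_act b n).
Proof.
rewrite {1}/base_coact wdm_rhoM.
by have := @proj_tact k H antipode_bij C act actP A _ (wca_s_morph A) M _ mP
  (wca_rho a) (rk m) (@rho_takeuchi k H antipode_bij A a); apply.
Qed.

Definition dkm_of_wdkm : dk_module AR CR :=
  @DKModule k R BH AR CR M (@wdm_act k H A C M) _ mP wdm_base_comod wdm_base_rhoM.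

End WeakToStrong.

Section StrongToWeak.
Variable M : dk_module AR CR.
Local Notation actM := (@dm_act k R BH AR CR M).
Local Notation la := (lres (@wca_s k H A) actM).
Let mP := dm_module M.
Let laP : is_module la := lres_module mP (wca_s_morph A).

Definition dm_weak_rho (m : M) : tensk C M := base_lift (dm_rho m).
Local Notation rk := dm_weak_rho.

Lemma dm_weak_rhoK :
  base_coact antipode_bij act la rk = @dm_rho k R BH AR CR M.
Proof. by apply: funext => a; rewrite /base_coact base_liftK. Qed.

Lemma dm_weak_rhoD : {morph rk : x y / x + y}.
Proof. by move=> x y; rewrite /rk (comod_rhoD (dm_comod M)) base_liftD. Qed.

Lemma dm_weak_rhol r m : rk (la r m) = tmap (act (s r)) id (rk m).
Proof. by rewrite /rk (comod_rhol (dm_comod M)) base_lift_lact. Qed.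

Lemma dm_weak_unital m : unital antipode_bij act la (rk m).
Proof. exact: unital_lift. Qed.

Lemma dm_weak_comod : is_comodule (@wmc_delta k H C) (@wmc_eps k H C) rk.
Proof.
have [_] := @comodule_iff k H antipode_bij C act actP (@wmc_eps k H C)
  (@wmc_epsD C) (@wmc_epsZ C) (@wmc_epsM k H C) (@wmc_delta k H C)
  (@wmc_deltaD C) (@wmc_deltaM k H C) M la laP rk
  dm_weak_rhoD dm_weak_rhol dm_weak_unital; apply.
rewrite dm_weak_rhoK; exact: (@dm_comod k R BH AR CR M).
Qed.

Lemma dm_weak_rhoM a m :
  rk (actM a m) = \sw_(h, b <- wca_rho a) \sw_(c, n <- rk m) (act h c ⊗ actM b n).
Proof.
have [_ e] := @tact_iff k H antipode_bij C act actP A _ (wca_s_morph A) M _ mP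
  (wca_rho a) (rk m) (rk (actM a m)) (@rho_takeuchi k H antipode_bij A a)
  (unital_rho antipode_bij a) (dm_weak_unital _).
apply: e; rewrite !base_liftK //; exact: (@dm_rhoM k R BH AR CR M a m).
Qed.

Definition wdkm_of_dkm : wdk_module A C :=
  @WDKModule k H A C M actM rk mP dm_weak_comod dm_weak_rhoM.

End StrongToWeak.

Lemma wdkm_of_dkmK (M : wdk_module A C) : wdkm_of_dkm (dkm_of_wdkm M) = M.
Proof. by apply: wdm_eq => m; exact: wdm_unital. Qed.

Lemma dkm_of_wdkmK (M : dk_module AR CR) : dkm_of_wdkm (wdkm_of_dkm M) = M.
Proof.
by apply: (@dm_eq k R BH AR CR M) => m; rewrite /= dm_weak_rhoK.
Qed.

Lemma dkm_of_wdkm_hom (M N : wdk_module A C) (f : M -> N) :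
  wdm_hom f -> @dm_hom k R BH AR CR (dkm_of_wdkm M) (dkm_of_wdkm N) f.
Proof.
case=> fl fa fr; split=> // m.
rewrite /= /base_coact fr.
apply: (@tmap_proj k H antipode_bij C C M N _ _ _ _ id f) => //.
- exact: (lres_module (wdm_module M) (wca_s_morph A)).
- exact: (lres_module (wdm_module N) (wca_s_morph A)).
by move=> r b; rewrite /lres fa.
Qed.

Lemma wdkm_of_dkm_hom (M N : dk_module AR CR) (f : M -> N) :
  dm_hom f -> @wdm_hom k H A C (wdkm_of_dkm M) (wdkm_of_dkm N) f.
Proof.
case=> fl fa fr; split=> // m.
rewrite /= /dm_weak_rho fr.
apply: (@tmap_lift k H antipode_bij C C M N _ _ _ _ id f) => //.
- exact: (lres_module (dm_module M) (wca_s_morph A)).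
- exact: (lres_module (dm_module N) (wca_s_morph A)).
by move=> r b; rewrite /lres fa.
Qed.

End Modules.

(** * The isomorphisms of categories *)

Definition comod_algebra_functor : functor (WCA H) (CA BH) :=
  concrete_functor (@wca_hom1 k H) (@wca_homM k H) (@ca_hom1 k R BH)
    (@ca_homM k R BH) (F := ca_of_wca) (carF := fun _ => erefl) ca_of_wca_hom.

Definition mod_coalgebra_functor : functor (WMC H) (MC BH) :=
  concrete_functor (@wmc_hom1 k H) (@wmc_homM k H) (@mc_hom1 k R BH)
    (@mc_homM k R BH) (F := mc_of_wmc) (carF := fun _ => erefl) mc_of_wmc_hom.

Definition dk_functor : functor (WDK H) (DK BH) :=
  product_functor comod_algebra_functor mod_coalgebra_functor.

Lemma dk_functor_iso : is_isofunctor dk_functor.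
Proof.
apply: product_iso.
- apply: (concrete_iso (G := @wca_of_ca k H antipode_bij)
    (carG := fun _ => erefl) _ _ _ _ _ _ wca_of_caK ca_of_wcaK).
  exact: wca_of_ca_hom.
apply: (concrete_iso (G := wmc_of_mc) (carG := fun _ => erefl) _ _ _ _ _ _
  wmc_of_mcK mc_of_wmcK).
exact: wmc_of_mc_hom.
Qed.

Lemma dk_module_iso (X : WDK H) :
  isomorphic_categories (WDKMod X) (DKMod (dk_functor X)).
Proof.
exists (concrete_functor (@wdm_hom1 k H X.1 X.2) (@wdm_homM k H X.1 X.2)
  (@dm_hom1 k R BH _ _) (@dm_homM k R BH _ _)
  (F := @dkm_of_wdkm X.1 X.2) (carF := fun _ => erefl) (@dkm_of_wdkm_hom X.1 X.2)).
apply: (concrete_iso (G := @wdkm_of_dkm X.1 X.2) (carG := fun _ => erefl) _ _ _ _ _ _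
  (@wdkm_of_dkmK X.1 X.2) (@dkm_of_wdkmK X.1 X.2)).
exact: wdkm_of_dkm_hom.
Qed.

End Correspondence.

Theorem theorem3p11 (k : comPzRingType) (H : weakHopf k)
    (antipode_bij : bijective (@antipode k H)) :
  exists F : functor (WDK H) (DK (wh_bialgebroid antipode_bij)),
    is_isofunctor F /\
    forall X : WDK H, isomorphic_categories (WDKMod X) (DKMod (F X)).
Proof.
exists (dk_functor antipode_bij); split; first exact: dk_functor_iso.
exact: dk_module_iso.
Qed.
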